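(* There is an algorithm that, given a simple undirected graph $G$ on $n$ vertices with maximum degree $\delta$ and terminals $s,t$, computes in $\mathcal{O}(n^2)$ time a tracking set for $G$ of size at most $2(\delta+1)\cdot OPT$, where $OPT$ is the minimum size of a tracking set for $G$.
   Context: An $s$-$t$ path is a simple path from $s$ to $t$. A set $T\subseteq V(G)$ is a tracking set if for any two distinct $s$-$t$ paths $P_1,P_2$, the sequence of vertices of $T\cap V(P_1)$ in the order encountered along $P_1$ differs from the sequence of vertices of $T\cap V(P_2)$ in the order encountered along $P_2$. *)

(* Defs.v *)
From mathcomp Require Import all_boot.
Set Implicit Arguments. Unset Strict Implicit. Unset Printing Implicit Defensive.

(* A simple undirected graph on vertex set 'I_n is a symmetric,        *)
(* irreflexive relation e : rel 'I_n.                                  *)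

Definition st_path (n : nat) (e : rel 'I_n) (s t : 'I_n) (P : seq 'I_n) : bool :=
  if P is x :: q then [&& x == s, path e x q, last x q == t & uniq P] else false.

Definition tracking_set (n : nat) (e : rel 'I_n) (s t : 'I_n) (T : {set 'I_n}) : Prop :=
  forall P1 P2 : seq 'I_n, st_path e s t P1 -> st_path e s t P2 -> P1 <> P2 ->
    [seq v <- P1 | v \in T] <> [seq v <- P2 | v \in T].

Definition max_degree (n : nat) (e : rel 'I_n) : nat :=
  \max_(v : 'I_n) #|[set u | e v u]|.

Definition is_opt_tracking_size (n : nat) (e : rel 'I_n) (s t : 'I_n) (k : nat) : Prop :=
  (exists T : {set 'I_n}, tracking_set e s t T /\ #|T| = k) /\
  (forall T : {set 'I_n}, tracking_set e s t T -> k <= #|T|).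

(* Machine model: unit-cost RAM with unbounded natural-number registers *)

Inductive instr : Type :=
| Const of nat & nat
| Add of nat & nat & nat
| Sub of nat & nat & nat
| Rd of nat & nat
| Wr of nat & nat
| Jz of nat & nat
| Jmp of nat
| Halt.

Definition memory := nat -> nat.

Definition upd (m : memory) (r x : nat) : memory :=
  fun i => if i == r then x else m i.

(* one step; None iff the machine has halted (Halt or pc out of range) *)
Definition step (prog : seq instr) (c : nat * memory) : option (nat * memory) :=
  let: (pc, m) := c in
  match nth Halt prog pc with
  | Const r k => Some (pc.+1, upd m r k)
  | Add r a b => Some (pc.+1, upd m r (m a + m b))
  | Sub r a b => Some (pc.+1, upd m r (m a - m b))
  | Rd r a => Some (pc.+1, upd m r (m (m a)))
  | Wr a b => Some (pc.+1, upd m (m a) (m b))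
  | Jz a l => Some (if m a == 0 then l else pc.+1, m)
  | Jmp l => Some (l, m)
  | Halt => None
  end.

Fixpoint run (prog : seq instr) (fuel : nat) (c : nat * memory) : option memory :=
  match step prog c with
  | None => Some c.2
  | Some c' => if fuel is f.+1 then run prog f c' else None
  end.

Definition init_mem (n : nat) (s t : 'I_n) (es : seq ('I_n * 'I_n)) : memory :=
  fun i => nth 0 ([:: n; val s; val t; size es] ++
                  flatten [seq [:: val p.1; val p.2] | p <- es]) i.

Definition edge_list (n : nat) (e : rel 'I_n) (es : seq ('I_n * 'I_n)) : Prop :=
  uniq es /\ forall u v : 'I_n, e u v = ((u, v) \in es) || ((v, u) \in es).

Definition output_set (n : nat) (m : memory) : {set 'I_n} :=
  [set v : 'I_n | [exists i : 'I_(m 0), m i.+1 == val v]].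

(* Main.v *)
Require Import Defs.
From mathcomp Require Import all_boot.
From mathcomp Require Import zify.
Set Implicit Arguments. Unset Strict Implicit. Unset Printing Implicit Defensive.

(* Let G' be the subgraph spanned by the vertices lying on s-t paths; it is found by depth-first
   search with low points, a vertex being kept iff it is s, or its parent is kept and its low point is
   strictly above the parent (the low point of t being above everything).  A vertex of degree 2
   other than s and t whose neighbours a and b are not adjacent is replaced by the edge ab, until no
   such vertex is left; the output is the set of the remaining vertices other than s and t.

   It is a tracking set since a path of G' can be recovered from the remaining graph H, where each
   path is determined by its vertices.  For the bound, a tracking set F of G meets every cycle C of
   G': two disjoint paths join s and t to C, and C can be traversed both ways.  Elimination preserves
   degrees and (moving a vertex of F to a neighbour) the existence of such an F.  In H, a vertex of
   degree 2 outside F lies in a triangle, so it has a neighbour in F: there are at most delta |F|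
   such vertices.  Counting degrees in the forest H - F, there are at most delta |F| vertices of
   degree at least 3 outside F.  Altogether H has at most (2 delta + 1) |F| vertices besides s and t. *)

(** * Paths and cycles *)

(** Elimination need not preserve tracking sets of the original size, so what is carried along is
    weaker: some set F of bounded size whose complement is a forest. The program never sees F, which
    is why one output satisfies the bound for every admissible size. Quadratic time is the other
    concern. One sweep of elimination is enough: a removed vertex lies in no triangle, its
    neighbours not being adjacent, so a vertex already found to have degree at least 3, or to lie in
    a triangle, remains so. The search takes 2n steps with one row scan each, as a step opens or
    closes a vertex. Processing vertices by decreasing or increasing discovery time replaces
    recursion for low points and kept vertices. The machine can neither multiply nor offers free
    registers at the start, hence a table of row offsets, arrays interleaved with stride 8 beyond
    the input, and a relocation of the first words. A small language whose loop bounds are never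
    assigned makes the running time a syntactic quantity. *)

Lemma sorted_cat_cons (A : Type) (r : rel A) p x q :
  sorted r (p ++ x :: q) = sorted r (rcons p x) && path r x q.
Proof. by case: p => [|a p] //=; rewrite cat_path rcons_path /= andbA. Qed.

Lemma first_hit (A : Type) (a : pred A) (l : seq A) :
  has a l -> exists p x q, [/\ l = p ++ x :: q, a x & ~~ has a p].
Proof.
elim: l => //= y l IH; have [ay _|ay /= /IH] := boolP (a y).
  by exists [::], y, l.
by move=> [p [x [q [-> ax np]]]]; exists (y :: p), x, q; rewrite /= negb_or ay.
Qed.

Lemma last_hit (A : Type) (a : pred A) (l : seq A) :
  has a l -> exists p x q, [/\ l = p ++ x :: q, a x & ~~ has a q].
Proof.
elim: l => //= y l IH; have [/IH|hl] := boolP (has a l).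
  by move=> [p [x [q [-> ax np]]]] _; exists (y :: p), x, q.
by rewrite orbF => ay; exists [::], y, l.
Qed.

(** Make the walk simple, keep the part from its last vertex in [a] on, then cut this at the first
    vertex in [b]. The inside then avoids both sets, as a detour or an ear requires. *)
Lemma subpath_between (A : eqType) (r : rel A) (a b : pred A) x p :
  path r x p -> a x -> b (last x p) ->
  exists x' p', [/\ path r x' p', a x', b (last x' p') &
    [/\ {subset x' :: p' <= x :: p}, uniq (x' :: p'), ~~ has a p' & ~~ has b (belast x' p')]].
Proof.
move=> pp ax; case/shortenP: pp => {}p' pp up sp bl.
have [p1 [x1 [q1 [e1 ax1 n1]]]] : exists p x' q, [/\ x :: p' = p ++ x' :: q, a x' & ~~ has a q].
  by apply: last_hit; rewrite /= ax.
have pp1 : path r x1 q1.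
  have : sorted r (x :: p') by [].
  by rewrite e1 sorted_cat_cons => /andP[].
have l1 : last x1 q1 = last x p' by rewrite -[RHS](last_cons x) e1 last_cat.
have [p2 [x2 [q2 [e2 bx2 n2]]]] : exists p x' q, [/\ x1 :: q1 = p ++ x' :: q, b x' & ~~ has b p].
  by apply: first_hit; apply/hasP; exists (last x1 q1); rewrite ?mem_last ?l1.
have up1 : uniq (x1 :: q1) by move: up; rewrite e1 cat_uniq => /and3P[].
have s1 : {subset x1 :: q1 <= x :: p}.
  move=> y yq; have : y \in x :: p' by rewrite e1 mem_cat yq orbT.
  by rewrite !inE => /orP[->//|/sp ->]; rewrite orbT.
case: p2 e2 n2 => [|x0 p2] /= [e2 e3] n2.
  exists x1, [::]; split=> //=; first by rewrite e2.
  split=> // y; rewrite inE => /eqP->; apply: s1; exact: mem_head.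
subst x0 q1; exists x1, (rcons p2 x2); split=> //.
- by move: pp1; rewrite cat_path rcons_path /= => /and3P[-> ->].
- by rewrite last_rcons.
have sub2 : {subset rcons p2 x2 <= p2 ++ x2 :: q2}.
  by move=> y; rewrite mem_rcons mem_cat !inE => /orP[->|->]; rewrite ?orbT.
split.
- move=> y; rewrite inE => /orP[/eqP->|/sub2 h]; apply: s1; rewrite inE ?eqxx //.
  by rewrite h orbT.
- by move: up1; rewrite -cat_rcons -cat_cons cat_uniq => /andP[].
- by apply: contra n1; rewrite -cat_rcons has_cat => ->.
- by rewrite belast_rcons.
Qed.

(** [st_path] with both ends described alike, so that a path can be split at any vertex and its
    pieces reversed. The defaults of [head] and [last] would accept the empty list, hence the first
    conjunct. *)
Definition spath (A : eqType) (r : rel A) s t (P : seq A) :=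
  [&& P != [::], head s P == s, last t P == t, sorted r P & uniq P].

Lemma st_pathE n (e : rel 'I_n) s t P : st_path e s t P = spath e s t P.
Proof. by case: P => //= x q; rewrite /spath /= (andbCA (path _ _ _)). Qed.

Lemma spath_cat_cons (A : eqType) (r : rel A) s t p x q :
  spath r s t (p ++ x :: q) = [&& head s (rcons p x) == s, last x q == t,
     sorted r (rcons p x), path r x q & uniq (p ++ x :: q)].
Proof.
rewrite /spath sorted_cat_cons last_cat /=.
by case: p => [|y p] //=; rewrite -!andbA.
Qed.

Lemma sym_path_rcons_rev (A : Type) (r : rel A) a q b : symmetric r ->
  path r a (rcons q b) = path r b (rcons (rev q) a).
Proof.
move=> sr; have := rev_path r a (rcons q b).
rewrite last_rcons belast_rcons rev_cons => ->.
by apply: eq_path => x y; rewrite sr.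
Qed.

Lemma sym_sorted_rev (A : Type) (r : rel A) p : symmetric r ->
  sorted r (rev p) = sorted r p.
Proof. by move=> sr; rewrite rev_sorted; apply: eq_sorted => x y; rewrite sr. Qed.


(** The ear replaces the stretch of the path between its two feet; if [b] comes first on the path,
    the ear is traversed backwards. *)
Lemma ear (A : eqType) (r : rel A) s t P a b q : symmetric r ->
  spath r s t P -> a \in P -> b \in P -> a != b ->
  path r a (rcons q b) -> uniq q -> ~~ has (mem P) q ->
  exists2 P', spath r s t P' & {subset q <= P'}.
Proof.
move=> sr.
have base p1 u p2 v p3 w : spath r s t (p1 ++ u :: p2 ++ v :: p3) ->
  path r u (rcons w v) -> uniq w -> ~~ has (mem (p1 ++ u :: p2 ++ v :: p3)) w ->
  spath r s t (p1 ++ u :: w ++ v :: p3).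
  rewrite !spath_cat_cons !last_cat /= => /and5P[-> -> -> + up] pw uw nw /=.
  rewrite -!cat_rcons !cat_path !last_rcons pw => /andP[_ ->] /=.
  rewrite -!cat_rcons in up nw.
  have up' : uniq (rcons p1 u ++ v :: p3).
    move: up; rewrite [rcons p2 v ++ _]cat_rcons.
    by apply/subseq_uniq/cat_subseq => //; apply: suffix_subseq.
  rewrite [rcons w v ++ _]cat_rcons uniq_catCA cat_uniq uw up' andbT /=.
  apply: contra nw => /hasP[x xp xw]; apply/hasP; exists x => //=.
  by move: xp; rewrite !mem_cat !mem_rcons !inE; case/or3P => ->; rewrite ?orbT.
move=> sP aP; have := sP; case/splitPr: aP (sP) => p1 p2 _ sp bP ab pq uq nq.
move: bP; rewrite mem_cat inE eq_sym (negPf ab) /= => /orP[] /splitPr eqp.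
  case: eqp sp nq => p3 p4; rewrite -catA /= => sp nq.
  exists (p3 ++ b :: rev q ++ a :: p2); first apply: (base _ _ p4) => //.
  - by rewrite -sym_path_rcons_rev.
  - by rewrite rev_uniq.
  - by rewrite has_rev.
  by move=> x xq; rewrite mem_cat inE mem_cat mem_rev xq !orbT.
case: eqp sp nq => p3 p4 sp nq.
exists (p1 ++ a :: q ++ b :: p4); first exact: (base _ _ p3).
by move=> x xq; rewrite mem_cat inE mem_cat xq !orbT.
Qed.

Lemma cycle_arcs (A : eqType) (r : rel A) C u v : symmetric r ->
  cycle r C -> uniq C -> 2 < size C -> u \in C -> v \in C -> u != v ->
  exists A1 A2, [/\ A1 <> A2, path r u (rcons A1 v), path r u (rcons A2 v) &
    [/\ uniq (u :: rcons A1 v), uniq (u :: rcons A2 v),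
      {subset A1 <= C} & {subset A2 <= C}]].
Proof.
move=> sr cC uC szC uinC vC uv.
case: (rot_to uinC) => i C' eC.
have cC' : cycle r (u :: C') by rewrite -eC rot_cycle.
have uC' : uniq (u :: C') by rewrite -eC rot_uniq.
have sC' : 1 < size C' by have : 2 < size (u :: C') by rewrite -eC size_rot.
have memC x : x \in C = (x \in u :: C') by rewrite -eC mem_rot.
have : v \in C' by move: vC; rewrite memC inE eq_sym (negPf uv).
move=> vC'; case/splitPr: vC' cC' uC' sC' memC => A1 A2 cC' uC' sC' memC.
exists A1, (rev A2); split.
(* Equal arcs would share their vertices, so uniqueness forces both to be empty, and the cycle would
   have only two vertices. *)
- move=> e1; move: uC' sC'; rewrite e1 /= => /andP[_].
  rewrite cat_uniq rev_uniq => /and3P[_ /hasPn h _].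
  case: A2 h {e1 cC' memC} => // y l h.
  have /h : y \in v :: y :: l by rewrite !inE eqxx orbT.
  by rewrite /= mem_rev mem_head.
- by move: cC'; rewrite /= rcons_cat /= -cat_rcons cat_path => /andP[].
- rewrite -sym_path_rcons_rev //.
  by move: cC'; rewrite /= rcons_cat /= -cat_rcons cat_path last_rcons => /andP[].
- split.
  + by move: uC'; rewrite -cat_rcons -cat_cons cat_uniq => /andP[].
  + rewrite -rev_cons cons_uniq mem_rev rev_uniq.
    move: uC'; rewrite /= mem_cat negb_or cat_uniq => /andP[/andP[_ ->]] /and3P[_ _].
    by [].
  + by move=> x xA; rewrite memC inE mem_cat xA orbT.
  + by move=> x; rewrite mem_rev => xA; rewrite memC inE mem_cat inE xA !orbT.
Qed.

(** Both arcs between [u] and [v] complete the pieces [p] and [q] to simple s-t paths. As the cycle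
    avoids [T], both paths leave the same trace, that of [p] followed by that of [q]. *)
Lemma not_tracking_arcs n (e : rel 'I_n) s t (T : {set 'I_n}) C p u v q : symmetric e ->
  cycle e C -> uniq C -> 2 < size C -> [disjoint C & T] ->
  u \in C -> v \in C -> u != v ->
  head s (rcons p u) = s -> last v q = t -> sorted e (rcons p u) -> path e v q ->
  uniq p -> uniq q -> ~~ has (mem q) p -> ~~ has (mem C) p -> ~~ has (mem C) q ->
  ~ tracking_set e s t T.
Proof.
move=> se cC uC sC CT uinC vC uv hs lt sp pq up uq npq npC nqC tr.
have [A1 [A2 [A12 p1 p2 [u1 u2 s1 s2]]]] := cycle_arcs se cC uC sC uinC vC uv.
have sub A : path e u (rcons A v) -> uniq (u :: rcons A v) -> {subset A <= C} ->
  st_path e s t (p ++ u :: A ++ v :: q) /\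
  [seq x <- p ++ u :: A ++ v :: q | x \in T] =
  [seq x <- p | x \in T] ++ [seq x <- q | x \in T].
  move=> pA uA sA.
  have nCT x : x \in C -> x \notin T by move=> xC; rewrite (disjointFr CT).
  split; last first.
    rewrite filter_cat /= (negPf (nCT _ uinC)) filter_cat /= (negPf (nCT _ vC)).
    by congr (_ ++ _); rewrite (eq_in_filter (a2 := pred0)) ?filter_pred0 // => x /sA/nCT/negPf.
  rewrite st_pathE spath_cat_cons hs eqxx last_cat /= lt eqxx sp -cat_rcons cat_path pA.
  rewrite last_rcons pq -cat_cons uniq_catCA cat_uniq uA cat_uniq up uq.
  rewrite has_cat negb_or andbT /=.
  have h x : x \in u :: rcons A v -> x \in C.
    by rewrite inE mem_rcons inE => /or3P[/eqP->|/eqP->|/sA].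
  rewrite (_ : ~~ has (mem p) q); last first.
    by apply: contra npq => /hasP[x xp xq]; apply/hasP; exists x.
  rewrite !andbT; apply/andP; split.
    by apply: contra npC => /hasP[x xp /= /h xC]; apply/hasP; exists x.
  by apply: contra nqC => /hasP[x xp /= /h xC]; apply/hasP; exists x.
have [st1 f1] := sub A1 p1 u1 s1; have [st2 f2] := sub A2 p2 u2 s2.
apply: (tr _ _ st1 st2); last by rewrite f1 f2.
move/eqP; rewrite eqseq_cat // eqxx /= eqseq_cons eqxx /= -!cat_rcons => /eqP h.
apply: A12; have szA : size A1 = size A2.
  by move/(congr1 size): h; rewrite !size_cat !size_rcons => /addIn[].
by move/eqP: h; rewrite eqseq_cat ?size_rcons ?szA // eqseq_rcons => /andP[/andP[/eqP]].
Qed.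

(** The disjoint connections of s and t to the cycle are built from one path [P] that meets it,
    entering at its first vertex [u] on the cycle. If [P] meets the cycle again, the exit is the
    last such vertex. Otherwise another vertex of the cycle lies on a second path, half of which
    avoids [u]; this gives a connection from the cycle to [P] that misses [u], used as entry or as
    exit according to whether it reaches [P] before or after [u]. *)
Lemma cycle_not_tracking n (e : rel 'I_n) s t (T : {set 'I_n}) C : symmetric e ->
  cycle e C -> uniq C -> 2 < size C -> [disjoint C & T] ->
  (forall x, x \in C -> exists2 P, st_path e s t P & x \in P) ->
  ~ tracking_set e s t T.
Proof.
move=> se cC uC sC CT onC.
have [x0 x0C] : exists x, x \in C by case: (C) sC => // x l _; exists x; rewrite mem_head.
have [P sP x0P] := onC _ x0C.
have [p [u [R [eP uinC npC]]]] : exists p x q, [/\ P = p ++ x :: q, x \in C & ~~ has (mem C) p].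
  by apply: first_hit; apply/hasP; exists x0.
move: (sP); rewrite eP st_pathE spath_cat_cons => /and5P[/eqP hs /eqP lt sp pR].
rewrite cat_uniq cons_uniq => /and3P[up npR /andP[uR uqR]].
have upR : u \notin p by move: npR => /=; rewrite negb_or => /andP[].
have npR' : ~~ has (mem p) R by move: npR => /=; rewrite negb_or => /andP[].
have [hR|nR] := boolP (has (mem C) R).
  have [r1 [v [q [eR vC nqC]]]] := last_hit hR; subst R.
  have vq : uniq (v :: q) by move: uqR; rewrite cat_uniq => /and3P[].
  apply: (not_tracking_arcs (C := C) (p := p) (u := u) (v := v) (q := q)) => //.
  - by apply: contraNneq uR => ->; rewrite mem_cat inE eqxx orbT.
  - by move: lt; rewrite last_cat.
  - by move: pR; rewrite cat_path /= => /and3P[].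
  - by case/andP: vq.
  - apply: contra npR' => /hasP[y yp /= yq]; apply/hasP; exists y => //=.
    by rewrite mem_cat inE yq !orbT.
have [y yC yu] : exists2 y, y \in C & y != u.
  case: (C) uC sC => [|a [|b l]] //= /and3P[ab _ _] _.
  have [eau|] := eqVneq a u; last by exists a; rewrite ?mem_head.
  exists b; rewrite ?inE ?eqxx ?orbT //.
  by apply: contra ab => /eqP->; rewrite inE eau eqxx.
have [P' sP' yP'] := onC _ yC.
have sinP : s \in P.
  by case: (P) sP => //= a l /and4P[/eqP-> _ _ _]; apply: mem_head.
have tinP : t \in P.
  by case: (P) sP => //= a l /and4P[_ _ /eqP<- _]; apply: mem_last.
(* [u] occurs at most once on [P'], so the half before [y] or the half after it avoids [u]; the
   halves end in s and t, which are on [P]. *)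
have [w [pw lw nw]] : exists w, [/\ path e y w, last y w \in P & u \notin w].
  case/splitPr: yP' sP' => p1 p2.
  rewrite st_pathE spath_cat_cons => /and5P[/eqP h1 /eqP l2 s1 pp2 up'].
  have [up2|up2] := boolP (u \in p2); last by exists p2; rewrite l2.
  case: p1 h1 s1 up' => [|a p1] h1 s1 up'; first by exists [::]; rewrite /= in h1 *; rewrite h1.
  exists (rev (a :: p1)); split.
  + by have := sym_sorted_rev (rcons (a :: p1) y) se; rewrite rev_rcons s1.
  + by rewrite rev_cons last_rcons; move: h1 => /= ->.
  + rewrite mem_rev; move: up'; rewrite cat_uniq => /and3P[_ /hasPn h _].
    by apply: h; rewrite inE up2 orbT.
have [c [w' [pw' cC' lw' [sub uw' nCw' nPw']]]] := subpath_between (a := mem C) (b := mem P) pw yC lw.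
have unw : u \notin c :: w'.
  by apply/negP => /sub; rewrite inE eq_sym (negPf yu) (negPf nw).
have ncP : c \notin P.
  move: unw cC'; rewrite inE negb_or => /andP[uc _] cC'; rewrite eP mem_cat inE eq_sym (negPf uc) /=.
  rewrite negb_or; apply/andP; split.
    by apply: contra npC => cp; apply/hasP; exists c.
  by apply: contra nR => cp; apply/hasP; exists c.
case: (lastP w') pw' lw' sub uw' nCw' nPw' unw => [|w1 z] pw' lw' sub uw' nCw' nPw' unw.
  by rewrite /= (negPf ncP) in lw'.
rewrite last_rcons belast_rcons in lw' nPw'.
have zu : z != u by apply: contraNneq unw => <-; rewrite inE mem_rcons mem_head orbT.
have uc : c != u by apply: contraNneq unw => <-; rewrite mem_head.
have nCw : ~~ has (mem C) w1 by apply: contra nCw'; rewrite has_rcons => ->; rewrite orbT.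
have nPw : ~~ has (mem P) w1 by move: nPw' => /=; rewrite negb_or => /andP[].
have uw1 : uniq w1 by move: uw' => /= /andP[_]; rewrite rcons_uniq => /andP[].
have zw1 : z \notin w1 by move: uw' => /= /andP[_]; rewrite rcons_uniq => /andP[].
(* If [z] precedes [u] on [P], the cycle is entered at [c] along the reversed connection and left at
   [u]; otherwise it is entered at [u] and left at [c]. *)
move: lw'; rewrite /= eP mem_cat inE (negPf zu) /= => /orP[zp|zR].
  case/splitPr: zp hs sp up npC npR npR' upR eP => p1 p2 hs sp up npC npR npR' upR eP.
  have hpre A (a : pred 'I_n) : has a (p1 ++ z :: A) = [|| has a p1, a z | has a A].
    by rewrite has_cat.
  apply: (not_tracking_arcs (C := C) (p := p1 ++ z :: rev w1) (u := c) (v := u) (q := R)) => //.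
  - by move: hs; case: (p1).
  - move: sp; rewrite !rcons_cat /= !sorted_cat_cons => /andP[-> _] /=.
    by rewrite -sym_path_rcons_rev //; case/andP: pw' => //.
  - move: up; rewrite !cat_uniq /= mem_rev zw1 rev_uniq uw1 => /and3P[-> h _] /=.
    move: h; rewrite !negb_or has_rev => /andP[-> _] /=; rewrite andbT.
    apply: contra nPw => /hasP[a aw ap]; apply/hasP; exists a => //=.
    by rewrite eP !mem_cat ap.
  - rewrite hpre has_rev; apply/negP => /or3P[|zr|] .
    + move=> /hasP[a ap ar]; move/negP: npR'; apply; apply/hasP; exists a => //=.
      by rewrite mem_cat ap.
    + move/negP: npR'; apply; apply/hasP; exists z => //=.
      by rewrite mem_cat mem_head orbT.
    + move=> /hasP[a aw /= ar]; move/negP: nPw; apply; apply/hasP; exists a => //=.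
      by rewrite eP mem_cat inE ar !orbT.
  - rewrite hpre has_rev (negPf nCw) orbF; move: npC; rewrite has_cat /= !negb_or.
    by case/and3P=> -> ->.
case/splitPr: zR lt pR npR npR' uR uqR nR eP => r1 r2 lt pR npR npR' uR uqR nR eP.
have hpre A (a : pred 'I_n) : has a (A ++ z :: r2) = [|| has a A, a z | has a r2].
  by rewrite has_cat.
apply: (not_tracking_arcs (C := C) (p := p) (u := u) (v := c) (q := w1 ++ z :: r2)) => //.
- by rewrite eq_sym.
- by move: lt; rewrite !last_cat.
- rewrite -cat_rcons cat_path pw' last_rcons.
  by move: pR; rewrite cat_path /= => /and3P[].
- have ur2 : uniq (z :: r2) by move: uqR; rewrite cat_uniq => /and3P[].
  rewrite cat_uniq uw1 ur2 andbT /= negb_or zw1 /=.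
  apply: contra nPw => /hasP[a aw ap]; apply/hasP; exists a => //=.
  by rewrite eP mem_cat inE mem_cat inE aw !orbT.
- apply/negP=> /hasP[a ap /=]; rewrite mem_cat => /orP[aw|ar].
    move/negP: nPw; apply; apply/hasP; exists a => //=.
    by rewrite eP mem_cat ap.
  move/negP: npR'; apply; apply/hasP; exists a => //=.
  by rewrite mem_cat ar orbT.
- rewrite hpre (negPf nCw) /=; move: nR; rewrite has_cat /= !negb_or.
  by case/and3P=> _ -> ->.
Qed.

(** The graph induced on [X] is a forest, in the form of 1-degeneracy: no cycles have to be handled,
    the property passes to subsets, and edges are counted by removing one vertex at a time. *)
Definition degenerate n (g : rel 'I_n) (X : {set 'I_n}) :=
  forall Y : {set 'I_n}, Y \subset X -> Y != set0 ->
  exists2 v, v \in Y & #|[set u in Y | g v u]| <= 1.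

(** Take a longest simple path in [Y]. By maximality all neighbours of its first vertex [x] lie on
    it, and a neighbour other than the successor of [x] closes a cycle. *)
Lemma min_degree2_cycle n (g : rel 'I_n) (Y : {set 'I_n}) : irreflexive g -> symmetric g ->
  Y != set0 -> (forall v, v \in Y -> 1 < #|[set u in Y | g v u]|) ->
  exists C, [/\ cycle g C, uniq C, 2 < size C & {subset C <= Y}].
Proof.
move=> ig sg /set0Pn[y0 y0Y] deg.
pose good k := [exists p : k.-tuple 'I_n, [&& k > 0, sorted g p, uniq p & all (mem Y) p]].
have ex1 : exists k, good k.
  by exists 1; apply/existsP; exists [tuple y0]; rewrite /= y0Y.
have bnd k : good k -> k <= n.
  move=> /existsP[p /and4P[_ _ up _]]; rewrite -[n]card_ord -(size_tuple p).
  by rewrite -(card_uniqP up); apply: max_card.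
case: (ex_maxnP ex1 bnd) => k /existsP[[P /= /eqP sP]] /and4P[k0 gP uP aP] maxk.
case: P sP gP uP aP => [|x p] sP gP uP aP; first by rewrite -sP in k0.
have xY : x \in Y by move/allP: aP => /(_ x (mem_head _ _)).
have nbrs u : u \in Y -> g x u -> u \in p.
  move=> uY gxu; have [//|up] := boolP (u \in p).
  suff /maxk : good k.+1 by rewrite ltnn.
  have uu : uniq (u :: x :: p).
    rewrite cons_uniq uP andbT inE negb_or up andbT.
    by apply: contraTneq gxu => ->; rewrite ig.
  have sz : size (u :: x :: p) == k.+1 by rewrite -sP.
  have [tp etp] : exists tp : k.+1.-tuple 'I_n, tval tp = u :: x :: p by exists (Tuple sz).
  apply/existsP; exists tp; rewrite etp; apply/and4P; split=> //.
    by rewrite /= sg gxu.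
  by rewrite /= uY.
case: p nbrs gP uP aP {sP} => [|y p] nbrs gP uP aP.
  move: (deg x xY); rewrite (_ : [set u in Y | g x u] = set0) ?cards0 //.
  by apply/setP=> u; rewrite !inE; apply/negP => /andP[uY /(nbrs u uY)].
have [z] : exists2 z, z \in [set u in Y | g x u] & z != y.
  have : 0 < #|[set u in Y | g x u] :\ y|.
    have := deg x xY; rewrite (cardsD1 y) => d; rewrite -ltnS; apply: leq_trans d _.
    by rewrite -[X in _ <= X]add1n leq_add2r; case: (y \in _).
  by rewrite card_gt0 => /set0Pn[z]; rewrite in_setD1 => /andP[zy zin]; exists z.
rewrite inE => /andP[zY gxz] zy.
have : z \in p by move: (nbrs z zY gxz); rewrite inE (negPf zy).
move=> zp; case/splitPr: zp nbrs gP uP aP => p1 p2 _ gP uP aP.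
exists (x :: y :: rcons p1 z); split.
- move: gP; rewrite /= -cat_rcons cat_path => /and3P[gxy gz _].
  by rewrite gxy rcons_path gz last_rcons sg gxz.
- by move: uP; rewrite -cat_rcons -!cat_cons cat_uniq => /andP[].
- by rewrite /= size_rcons.
- move=> w wC; move/allP: aP => /(_ w); apply.
  by rewrite -cat_rcons -!cat_cons mem_cat wC.
Qed.

(** * Restriction to the s-t paths and elimination of degree-2 vertices *)

Definition restrict n (e : rel 'I_n) (K : {set 'I_n}) : rel 'I_n :=
  fun u v => [&& e u v, u \in K & v \in K].

Definition on_st_path n (e : rel 'I_n) s t x := exists2 P, st_path e s t P & x \in P.

Lemma path_restrict n (e : rel 'I_n) (K : {set 'I_n}) x q :
  path e x q -> {subset x :: q <= K} -> path (restrict e K) x q.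
Proof.
elim: q x => //= y q IH x /andP[exy pq] sub; rewrite /restrict exy !sub ?inE ?eqxx ?orbT //=.
by apply: IH => // z zq; apply: sub; rewrite inE zq orbT.
Qed.

Lemma restrict_st_path n (e : rel 'I_n) s t (K : {set 'I_n}) P :
  (forall x, on_st_path e s t x -> x \in K) ->
  st_path e s t P -> st_path (restrict e K) s t P.
Proof.
move=> onK sP; have subK : {subset P <= K} by move=> x xP; apply: onK; exists P.
by case: P sP subK => //= x q /and4P[-> pq -> ->] sub; rewrite path_restrict.
Qed.

(** A subset with all degrees at least 2 would carry a cycle that avoids [T] and whose vertices all
    lie on s-t paths. *)
Lemma degenerate_restrict n (e : rel 'I_n) s t (K T : {set 'I_n}) :
  symmetric e -> irreflexive e ->
  (forall x, x \in K -> on_st_path e s t x) ->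
  tracking_set e s t T -> degenerate (restrict e K) (K :\: T).
Proof.
move=> se ie onK tr Y YK Y0.
have [/existsP[v /andP[vY dv]]|] := boolP [exists v in Y, #|[set u in Y | restrict e K v u]| <= 1].
  by exists v.
rewrite negb_exists_in => /forall_inP degY.
have [||v /degY|C [cC uC szC CY]] := @min_degree2_cycle _ (restrict e K) Y _ _ Y0.
- by move=> x; rewrite /restrict ie.
- by move=> x y; rewrite /restrict se [(y \in K) && _]andbC.
- by rewrite -ltnNge.
have Csub x : x \in C -> x \in K :\: T by move/CY/(subsetP YK).
case: (@cycle_not_tracking _ e s t T C se _ uC szC _ _ tr).
- by apply: sub_cycle cC => x y /and3P[].
- by rewrite disjoint_subset; apply/subsetP => x /Csub; rewrite !inE => /andP[].
- by move=> x /Csub; rewrite inE => /andP[_ /onK].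
Qed.

Definition nbh n (g : rel 'I_n) v := [set u | g v u].

(* The state of the elimination once the candidate vertices below i have been examined. *)
Record reduced n (e : rel 'I_n) s t (d f : nat) (g : rel 'I_n) (V : {set 'I_n}) (i : nat) : Prop :=
  Reduced {
    red_sym : symmetric g;
    red_irr : irreflexive g;
    red_supp : forall u v, g u v -> u \in V;
    red_track : forall T : {set 'I_n}, T \subset V ->
      tracking_set g s t T -> tracking_set e s t T;
    red_deg : forall v, #|nbh g v| <= d;
    red_deg2 : forall v, v \in V -> v != s -> v != t -> 1 < #|nbh g v|;
    red_ends : V \subset [set s] \/ (s != t /\ 0 < #|nbh g s| /\ 0 < #|nbh g t|);
    red_fvs : exists2 F : {set 'I_n}, #|F| <= f & degenerate g (V :\: F);
    red_done : forall v, v \in V -> v != s -> v != t -> v < i ->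
      2 < #|nbh g v| \/ (exists a b, nbh g v = [set a; b] /\ g a b)
  }.

(** An inner vertex of an s-t path has its predecessor and its successor as distinct kept
    neighbours. [s] is kept even if no s-t path exists, so it is exempt from the condition that kept
    vertices lie on such paths, and the case where nothing else is kept is treated apart. *)
Lemma reduced_init n (e : rel 'I_n) s t (K : {set 'I_n}) f :
  symmetric e -> irreflexive e -> s \in K ->
  (forall x, on_st_path e s t x -> x \in K) ->
  (forall x, x \in K -> x != s -> on_st_path e s t x) ->
  (exists2 T, tracking_set e s t T & #|T| <= f) ->
  reduced e s t (max_degree e) f (restrict e K) K 0.
Proof.
move=> se ie sK onK Kon [T trT fT].
have sr : symmetric (restrict e K).
  by move=> x y; rewrite /restrict se; case: (e y x) => //=; rewrite andbC.
have ir : irreflexive (restrict e K) by move=> x; rewrite /restrict ie.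
have next P x : st_path e s t P -> x \in P -> x != t ->
    exists p y q, P = p ++ x :: y :: q /\ y \in nbh (restrict e K) x.
  move=> sP xP xt; have onP z : z \in P -> z \in K by move=> zP; apply: onK; exists P.
  case/splitPr: xP sP onP => p [|y q].
    by rewrite st_pathE spath_cat_cons /= (negPf xt) andbF.
  rewrite st_pathE spath_cat_cons /= => /and5P[_ _ _ /andP[exy _] _] onP.
  exists p, y, q; split=> //; rewrite inE /restrict exy !onP // mem_cat !inE eqxx ?orbT //.
have prev P x : st_path e s t P -> x \in P -> x != s ->
    exists p y q, P = rcons p y ++ x :: q /\ y \in nbh (restrict e K) x.
  move=> sP xP xs; have onP z : z \in P -> z \in K by move=> zP; apply: onK; exists P.
  case/splitPr: xP sP onP => p q; case/lastP: p => [|p y].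
    by rewrite st_pathE spath_cat_cons /= (negPf xs).
  rewrite st_pathE spath_cat_cons => /and5P[_ _ + _ _] onP.
  rewrite -cats1 cat_rcons sorted_cat_cons /= andbT => /andP[_ eyx].
  exists p, y, q; rewrite cat_rcons; split=> //; rewrite inE /restrict se eyx.
  by rewrite !onP // !mem_cat ?mem_rcons !inE eqxx ?orbT.
have cardP (B : {set 'I_n}) y : y \in B -> 0 < #|B|.
  by move=> yB; rewrite card_gt0; apply/set0Pn; exists y.
split=> //.
- by move=> u v /and3P[].
- move=> T' sT' tr P1 P2 s1 s2; apply: tr; exact: restrict_st_path.
- move=> v; apply: leq_trans (leq_bigmax v); apply: subset_leq_card.
  by apply/subsetP => u; rewrite !inE => /and3P[].
- move=> v vK vs vt; have [P sP vP] := Kon v vK vs.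
  have [p [y [q [eP yv]]]] := next P v sP vP vt.
  have [p' [y' [q' [eP' yv']]]] := prev P v sP vP vs.
  have uP : uniq P by move: sP; rewrite st_pathE => /and5P[].
  have vp : v \notin p by move: uP; rewrite eP cat_uniq /= => /and3P[_]; rewrite negb_or => /andP[].
  have vp' : v \notin rcons p' y'.
    by move: uP; rewrite eP' cat_uniq /= => /and3P[_]; rewrite negb_or => /andP[].
  (* [v] occurs only once on the path, so both ways of splitting at [v] have the same prefix. *)
  have ep : p = rcons p' y'.
    have : index v P = index v P by [].
    rewrite {1}eP {1}eP' !index_cat (negPf vp) (negPf vp') /= eqxx !addn0 => sz.
    move: eP; rewrite eP' => /eqP; rewrite eqseq_cat ?sz // => /andP[/eqP-> _] //.
  rewrite (cardsD1 y) yv (cardsD1 y') in_setD1 yv' andbT.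
  suff -> : y' != y by [].
  move: uP; rewrite eP ep cat_uniq => /and3P[_ /hasPn/(_ y)]; rewrite !inE eqxx orbT => /(_ isT) + _.
  by rewrite /= mem_rcons inE negb_or eq_sym => /andP[].
- have [st|st] := eqVneq s t.
    left; apply/subsetP => x xK; rewrite inE; apply: contraT => xs.
    have [P sP xP] := Kon x xK xs; move: sP xP; rewrite -st.
    case: P => //= a [|b l]; first by rewrite inE => /and4P[/eqP-> _ _ _] /eqP ex; rewrite ex eqxx in xs.
    case/and4P => /eqP-> _ /eqP ls; by case/andP => /negP[]; have := mem_last b l; rewrite /= in ls; rewrite ls.
  have [/set0Pn[x]|] := boolP (K :\ s != set0); last first.
    rewrite negbK => /eqP K0; left; apply/subsetP => x xK; rewrite inE.
    by apply: contraT => xs; move/setP/(_ x): K0; rewrite !inE xs xK.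
  rewrite !inE => /andP[xs xK]; right; split=> //; have [P sP _] := Kon x xK xs.
  have sinP : s \in P by case: (P) sP => //= a l /and4P[/eqP-> _ _ _]; apply: mem_head.
  have tinP : t \in P by case: (P) sP => //= a l /and4P[_ _ /eqP<- _]; apply: mem_last.
  split; first by have [p [y [q [_ /cardP]]]] := next P s sP sinP st.
  by have [|p [y [q [_ /cardP]]]] := prev P t sP tinP => //; rewrite eq_sym.
- exists T => //; have [Ks1|sKs] := boolP (K == [set s]).
    move=> Y YK Y0; exists s.
      have /set0Pn[y yY] := Y0; have := subsetP YK y yY.
      by rewrite (eqP Ks1) !inE => /andP[_ /eqP ys]; rewrite -ys.
    rewrite (_ : [set _ in _ | _] = set0) ?cards0 //; apply/setP=> u; rewrite !inE /restrict.
    by rewrite (eqP Ks1) !inE eqxx /=; case: eqP => [->|]; rewrite ?ie ?andbF.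
  apply: (degenerate_restrict se ie _ trT) => x xK.
  have [->|/(Kon x xK)//] := eqVneq x s.
  have /set0Pn[y] : K :\ s != set0.
    by apply: contraNneq sKs => K0; rewrite -(setD1K sK) K0 setU0.
  rewrite !inE => /andP[ys yK]; have [P sP _] := Kon y yK ys.
  by exists P => //; case: (P) sP => //= a l /and4P[/eqP-> _ _ _]; apply: mem_head.
Qed.

(** * Contraction of a vertex of degree 2 *)

Definition swaps n (a b u v : 'I_n) := (u == a) && (v == b) || (u == b) && (v == a).

(** The vertex type stays ['I_n]: the removed [w] merely becomes isolated, and the remaining
    vertices are recorded in a separate set. *)
Definition contract n (g : rel 'I_n) (w a b : 'I_n) : rel 'I_n :=
  fun u v => [&& u != w, v != w & g u v || swaps a b u v].

(** Inverse of deleting [w] from a path that starts at [x]. Since [a] and [b] are not adjacent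
    before the contraction, every step between them stems from a passage through [w]. *)
Fixpoint reinsert n (w a b x : 'I_n) (l : seq 'I_n) : seq 'I_n :=
  if l is y :: l' then
    (if swaps a b x y then [:: w; y] else [:: y]) ++ reinsert w a b y l'
  else [::].

Lemma swapsC n (a b u v : 'I_n) : swaps a b u v = swaps a b v u.
Proof. by rewrite /swaps orbC andbC [X in _ || X]andbC. Qed.

Lemma contract_path n (g : rel 'I_n) (w a b : 'I_n) x q :
  symmetric g -> irreflexive g -> nbh g w = [set a; b] -> ~~ g a b ->
  x != w -> last x q != w -> path g x q -> uniq (x :: q) ->
  let q' := [seq v <- q | v != w] in
  [/\ path (contract g w a b) x q', reinsert w a b x q' = q & last x q' = last x q].
Proof.
move=> sg ig Nw ab.
have nsw u v : g u v -> ~~ swaps a b u v.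
  by apply: contraL => /orP[] /andP[/eqP-> /eqP->] //; rewrite sg.
have Nwv v : g w v -> v \in [set a; b] by rewrite -Nw inE.
(* Induction on the length rather than on the list, as a passage through [w] consumes two
   vertices. *)
have [k] := ubnP (size q); elim: k q x => // k IH [|y q] x //= lek xw lw /andP[gxy pq].
have [ey|yw] /= := eqVneq y w; last first.
  move=> /andP[_ uq]; have [h1 h2 h3] := IH q y lek yw lw pq uq.
  by rewrite (negPf (nsw _ _ gxy)) /= h2 h3 /contract xw yw gxy.
subst y; case: q lek lw pq => [|z q] /= lek lw; first by rewrite eqxx in lw.
move=> /andP[gwz pq] /and3P[]; rewrite !inE !negb_or => /and3P[_ xz xq] /andP[wz wq] uq.
have zw : z != w by rewrite eq_sym.
rewrite zw /=.
have sw : swaps a b x z.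
  have := Nwv x; rewrite sg => /(_ gxy); have := Nwv z gwz; rewrite !inE.
  by move=> /orP[]/eqP ez /orP[]/eqP ex; move: xz; rewrite /swaps ez ex !eqxx ?orbT.
have [h1 h2 h3] := IH q z (ltnW (lek : (size q).+2 <= k)) zw lw pq uq.
by rewrite sw /= h2 h3 /contract xw zw sw orbT.
Qed.

Lemma contract_sym n (g : rel 'I_n) w a b : symmetric g -> symmetric (contract g w a b).
Proof. by move=> sg u v; rewrite /contract andbCA sg swapsC. Qed.

(** Deleting [w] is injective on paths, because [reinsert] undoes it, and keeps all traces, because
    [w] is outside [T]. *)
Lemma contract_tracking n (g : rel 'I_n) s t (T : {set 'I_n}) w a b :
  symmetric g -> irreflexive g -> nbh g w = [set a; b] -> ~~ g a b ->
  w != s -> w != t -> w \notin T ->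
  tracking_set (contract g w a b) s t T -> tracking_set g s t T.
Proof.
move=> sg ig Nw ab ws wt wT tr.
have shrink P : st_path g s t P ->
    exists q', [/\ st_path (contract g w a b) s t (s :: q'), P = s :: reinsert w a b s q' &
      [seq v <- P | v \in T] = [seq v <- s :: q' | v \in T]].
  case: P => //= x q /and4P[/eqP-> pq /eqP lq] uq; have lw : last s q != w by rewrite lq eq_sym.
  have sw : s != w by rewrite eq_sym.
  have [h1 h2 h3] := contract_path sg ig Nw ab sw lw pq uq.
  exists [seq v <- q | v != w]; split=> /=.
  - rewrite eqxx h1 h3 lq eqxx /= mem_filter sw filter_uniq ?andbT; by case/andP: uq.
  - by rewrite h2.
  - congr (if _ then _ :: _ else _); rewrite -filter_predI; apply: eq_filter => v /=.
      by case: eqP => [->|]; rewrite ?(negPf wT) ?andbT.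
    by case: eqP => [->|]; rewrite ?(negPf wT) ?andbT.
move=> P1 P2 /shrink[q1 [s1 -> ->]] /shrink[q2 [s2 -> ->]] P12.
by apply: tr => // -[e12]; apply: P12; rewrite e12.
Qed.

Definition other n (a b v : 'I_n) := if v == a then b else a.

(** A new edge at [v] is charged to the edge from [v] to [w] that it replaces; this is injective
    because [a] and [b] differ. *)
Lemma card_contract n (g : rel 'I_n) w a b (Y : {set 'I_n}) v :
  symmetric g -> nbh g w = [set a; b] -> a != b -> ~~ g a b -> w \notin Y -> v != w ->
  #|[set u in Y | contract g w a b v u]| <= #|[set u in w |: Y | g v u]|.
Proof.
move=> sg Nw nab ab wY vw.
pose phi u := if swaps a b v u then w else u.
have sub u : u \in [set u in Y | contract g w a b v u] -> phi u \in [set u in w |: Y | g v u].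
  rewrite !inE /phi /contract => /andP[uY /and3P[_ uw]].
  case sw: (swaps a b v u); last by rewrite orbF uY orbT => ->.
  move=> _; rewrite eqxx /= sg.
  have : v \in [set a; b] by move: sw => /orP[] /andP[/eqP-> _]; rewrite !inE eqxx ?orbT.
  by rewrite -Nw inE.
have <- : #|phi @: [set u in Y | contract g w a b v u]| = #|[set u in Y | contract g w a b v u]|.
  apply: card_in_imset.
  move=> x y; rewrite !inE /contract => /andP[_ /and3P[_ xw _]] /andP[_ /and3P[_ yw _]].
  rewrite /phi; case: ifP => sx; case: ifP => sy exy //.
  - move: sx sy => /orP[]/andP[/eqP v1 /eqP->] /orP[]/andP[/eqP v2 /eqP->] //.
      by rewrite -v1 -v2 eqxx in nab.
    by rewrite -v1 -v2 eqxx in nab.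
  - by rewrite -exy eqxx in yw.
  - by rewrite exy eqxx in xw.
by apply/subset_leq_card/subsetP => _ /imsetP[u uin ->]; apply: sub.
Qed.

(** One inequality is the charging above, with [Y] everything but [w]. Conversely, a neighbour [w]
    of [v] is replaced by the other one of [a] and [b], which was not adjacent to [v] before. *)
Lemma card_nbh_contract n (g : rel 'I_n) w a b v :
  symmetric g -> irreflexive g -> nbh g w = [set a; b] -> a != b -> ~~ g a b -> v != w ->
  #|nbh (contract g w a b) v| = #|nbh g v|.
Proof.
move=> sg ig Nw nab ab vw; apply/eqP; rewrite eqn_leq; apply/andP; split.
  have := @card_contract n g w a b [set~ w] v sg Nw nab ab.
  rewrite !inE eqxx => /(_ isT vw).
  suff [-> ->] : [set u in [set~ w] | contract g w a b v u] = nbh (contract g w a b) v /\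
     [set u in w |: [set~ w] | g v u] = nbh g v by [].
  split; apply/setP=> u; rewrite !inE /contract; first by case: (u == w); rewrite ?andbF.
  by rewrite orbN.
pose psi u := if u == w then other a b v else u.
have Nwv x : g w x = (x \in [set a; b]) by rewrite -Nw inE.
have gaw : g a w by rewrite sg Nwv !inE eqxx.
have gbw : g b w by rewrite sg Nwv !inE eqxx orbT.
have aw : a != w by apply: contraTneq gaw => ->; rewrite ig.
have bw : b != w by apply: contraTneq gbw => ->; rewrite ig.
have oth : g v w -> psi w \in nbh (contract g w a b) v /\ ~~ g v (psi w).
  rewrite sg Nwv !inE /psi eqxx /contract /other /swaps vw => /orP[]/eqP->.
    by rewrite !eqxx bw /= orbT.
  by rewrite [b == a]eq_sym (negPf nab) !eqxx aw /= orbT sg.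
have <- : #|psi @: nbh g v| = #|nbh g v|.
  apply: card_in_imset.
  move=> x y; rewrite !inE => gx gy; rewrite /psi.
  case: eqP => [ex|_]; case: eqP => [ey|_] //; first by rewrite ex ey.
    by move=> ey; subst x; have [_] := oth gx; rewrite /psi eqxx ey gy.
  by move=> ex; subst y; have [_] := oth gy; rewrite /psi eqxx -ex gx.
apply/subset_leq_card/subsetP => _ /imsetP[u uin ->]; rewrite inE in uin.
have [uw|uw] := eqVneq u w; first by subst u; have [] := oth uin.
by rewrite /psi (negPf uw) inE /contract vw uw uin.
Qed.

(** If [w] is in [F], then [a] takes its place. So when [Y] contains both [a] and [b], [w] is
    outside [F], and [Y] with [w] added can be tested in [g]; there [w] has degree 2, so the vertex
    of low degree is another one. When [Y] misses [a] or [b], the new edge does not occur inside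
    [Y]. *)
Lemma degenerate_contract n (g : rel 'I_n) (V F : {set 'I_n}) w a b :
  symmetric g -> irreflexive g -> w \in V -> nbh g w = [set a; b] -> a != b -> ~~ g a b ->
  degenerate g (V :\: F) ->
  exists2 F' : {set 'I_n}, #|F'| <= #|F| & degenerate (contract g w a b) ((V :\ w) :\: F').
Proof.
move=> sg ig wV Nw nab ab dg.
pose F' := if w \in F then a |: (F :\ w) else F.
exists F'.
  rewrite /F'; case: ifP => // wF; rewrite [X in _ <= X](cardsD1 w) wF cardsU1.
  by rewrite leq_add2r; case: (_ \notin _).
move=> Y YV Y0.
have YV' y : y \in Y -> [/\ y \notin F, y \in V, y != w & y \notin F'].
  move=> /(subsetP YV); rewrite !inE => /and3P[yF yw yV]; split=> //.
  move: yF; rewrite /F'; case: ifP => // _; rewrite !inE negb_or => /andP[_].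
  by rewrite (negPf yw).
have wY : w \notin Y by apply/negP => /YV'[_ _]; rewrite eqxx.
have [/andP[aY bY]|nabY] := boolP ((a \in Y) && (b \in Y)).
  have wF : w \notin F.
    by apply/negP => wF; have [_ _ _] := YV' a aY; rewrite /F' wF setU11.
  have [||v] := dg (w |: Y).
  - apply/subsetP => y; rewrite !inE => /orP[/eqP->|/YV'[-> -> //]]; by rewrite wF.
  - by apply/set0Pn; exists w; rewrite setU11.
  rewrite in_setU1 => /orP[/eqP-> |vY dv].
    rewrite (_ : [set u in _ | _] = [set a; b]) ?cards2 ?nab //.
    apply/setP => u; have := Nw => /setP/(_ u); rewrite !inE => ->.
    by apply: andb_idl => /orP[]/eqP->; rewrite ?aY ?bY orbT.
  exists v => //; apply: leq_trans dv; apply: card_contract => //.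
  by have [] := YV' v vY.
have [|v vY dv] := dg Y _ Y0.
  by apply/subsetP => y /YV'[yF yV _ _]; rewrite inE yF.
exists v => //; apply: leq_trans dv; apply/subset_leq_card/subsetP => u.
rewrite !inE /contract => /andP[uY /and3P[_ _ /orP[->|]]]; first by rewrite uY.
by case/orP => /andP[/eqP ev /eqP eu]; subst u v; rewrite uY vY in nabY.
Qed.

Lemma reduced_skip n (e : rel 'I_n) s t d f g (V : {set 'I_n}) (i : nat) :
  reduced e s t d f g V i ->
  (forall v : 'I_n, val v = i -> v \in V -> v != s -> v != t ->
     2 < #|nbh g v| \/ (exists a b, nbh g v = [set a; b] /\ g a b)) ->
  reduced e s t d f g V i.+1.
Proof.
case=> *; split=> // v vV vs vt; rewrite ltnS leq_eqVlt => /orP[/eqP|]; auto.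
Qed.

(** The delicate field is [red_done]. A triangle cannot contain [w], whose neighbours are not
    adjacent; so a vertex of degree 2 in a triangle is not adjacent to [w], hence is no end of the
    new edge, and its neighbourhood does not change. *)
Lemma reduced_contract n (e : rel 'I_n) s t d f g (V : {set 'I_n}) (w a b : 'I_n) :
  reduced e s t d f g V w -> w \in V -> w != s -> w != t ->
  nbh g w = [set a; b] -> a != b -> ~~ g a b ->
  reduced e s t d f (contract g w a b) (V :\ w) w.+1.
Proof.
case=> sg ig sup tr dg dg2 ends [F Ff dF] dn wV ws wt Nw nab ab.
have cN v : v != w -> #|nbh (contract g w a b) v| = #|nbh g v|.
  by move=> vw; apply: card_nbh_contract.
have Nwv x : g w x = (x \in [set a; b]) by rewrite -Nw inE.
split.
- exact: contract_sym.
- move=> x; rewrite /contract ig /= /swaps; case: eqP => //= _.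
  by apply/negP => /orP[]/andP[/eqP e1 /eqP e2]; move: nab; rewrite -e1 -e2 eqxx.
- move=> u v /and3P[uw _]; rewrite !inE uw /= => /orP[/sup //|].
  have sup' x : g w x -> x \in V by rewrite sg => /sup.
  by case/orP => /andP[/eqP-> _]; apply: sup'; rewrite Nwv !inE eqxx ?orbT.
- move=> T TV trT; apply: tr; first exact: subset_trans TV (subsetDl _ _).
  apply: contract_tracking trT => //.
  by apply/negP => /(subsetP TV); rewrite !inE eqxx.
- move=> v; have [->|/cN-> //] := eqVneq v w.
  rewrite (_ : nbh _ _ = set0) ?cards0 //; apply/setP => u; by rewrite !inE /contract eqxx.
- by move=> v; rewrite !inE => /andP[vw vV] vs vt; rewrite cN //; apply: dg2.
- case: ends => [Vs|[st [ds dt]]]; first by left; apply: subset_trans Vs; apply: subsetDl.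
  by right; rewrite !cN // eq_sym.
- have [F' F'F dF'] := degenerate_contract sg ig wV Nw nab ab dF.
  by exists F' => //; apply: leq_trans Ff.
- move=> v; rewrite !inE => /andP[vw vV] vs vt; rewrite ltnS leq_eqVlt => /orP[/eqP/val_inj evw|vi].
    by rewrite evw eqxx in vw.
  rewrite cN //; case: (dn v vV vs vt vi) => [|[x [y [Nv gxy]]]]; [by left | right; exists x, y].
  have Nvx z : g v z = (z \in [set x; y]) by rewrite -Nv inE.
  have gvx : g v x by rewrite Nvx !inE eqxx.
  have gvy : g v y by rewrite Nvx !inE eqxx orbT.
  have nsw z1 z2 : g z1 z2 -> ~~ swaps a b z1 z2.
    by apply: contraL => /orP[] /andP[/eqP-> /eqP->] //; rewrite sg.
  have tri z1 z2 z3 : g z1 z2 -> g z2 z3 -> g z3 z1 -> z3 != w.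
    move=> g12 g23 g31; apply/eqP => ez; subst z3.
    have : z1 \in [set a; b] by rewrite -Nwv.
    have : z2 \in [set a; b] by rewrite -Nwv sg.
    rewrite !inE => /orP[]/eqP e2 /orP[]/eqP e1; move: g12; rewrite e1 e2 ?ig //.
      by rewrite sg (negPf ab).
    by rewrite (negPf ab).
  have xw : x != w by apply: (tri v y x); rewrite // 1?sg // sg.
  have yw : y != w by apply: (tri v x y); rewrite // 1?sg // sg.
  rewrite /contract xw yw gxy; split=> //; apply/setP => z; rewrite -Nv !inE /contract vw.
  have [->|zw] /= := eqVneq z w.
    by apply/esym/negbTE; rewrite Nvx !inE negb_or ![w == _]eq_sym xw.
  case sw : (swaps a b v z); rewrite ?orbF // orbT; apply/esym; rewrite Nvx.
  have : v \in [set a; b].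
    by move: sw => /orP[]/andP[/eqP-> _]; rewrite !inE eqxx ?orbT.
  rewrite -Nwv sg Nvx !inE ![w == _]eq_sym => /orP[]/eqP ew; last by rewrite ew eqxx in yw.
  by rewrite ew eqxx in xw.
Qed.

(** * Counting the remaining vertices *)

Lemma card_set_in_sum (A : finType) (X : {set A}) (P : pred A) :
  #|[set u in X | P u]| = \sum_(u in X) (P u : nat).
Proof.
rewrite -sum1_card big_mkcond [RHS]big_mkcond; apply: eq_bigr => u _.
by rewrite inE; case: (u \in X); case: (P u).
Qed.

(** A nonempty forest has fewer edges than vertices: removing a vertex of degree at most 1 lowers
    the sum of degrees by at most 2. *)
Lemma degenerate_sum n (g : rel 'I_n) (X : {set 'I_n}) :
  symmetric g -> irreflexive g -> degenerate g X -> X != set0 ->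
  \sum_(v in X) #|[set u in X | g v u]| + 2 <= 2 * #|X|.
Proof.
move=> sg ig; have [k] := ubnP #|X|; elim: k X => // k IH X leX dX X0.
have [v vX dv] := dX X (subxx _) X0.
have cX : #|X| = #|X :\ v|.+1 by rewrite (cardsD1 v) vX.
have drop u : #|[set x in X | g u x]| = g u v + #|[set x in X :\ v | g u x]|.
  by rewrite !card_set_in_sum (big_setD1 v vX).
rewrite (big_setD1 v vX) /= (eq_bigr _ (fun u _ => drop u)) big_split /=.
have -> : \sum_(i in X :\ v) (g i v : nat) = #|[set x in X | g v x]|.
  rewrite drop ig card_set_in_sum; apply: eq_bigr => i _; by rewrite sg.
have [Y0|Y0] := eqVneq (X :\ v) set0.
  by rewrite drop ig cX Y0 big_set0 !card_set_in_sum big_set0 cards0.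
have := IH (X :\ v); rewrite -cX -ltnS => /(_ leX) H.
have {}H := H (fun Y YX => dX Y (subset_trans YX (subsetDl _ _))) Y0.
move: H dv; rewrite cX mulnS; set S := \sum_(i in _) _; set D := #|[set _ in X | _]|.
move=> H dv; rewrite -!addnA addnA leq_add //.
by rewrite -[2]/(1 + 1) leq_add.
Qed.

(** The number [M] of edges between [X] and [F] bounds both [L] and [R]. In the degree count on [X],
    the 2 gained from the forest bound pays for s and t, whose degree may be only 1. *)
Lemma reduced_card n (e : rel 'I_n) (s t : 'I_n) d f g (V : {set 'I_n}) :
  reduced e s t d f g V n -> #|V :\: [set s; t]| <= 2 * d.+1 * f.
Proof.
case=> sg ig sup _ dg dg2 ends [F Ff dF] dn.
case: ends => [Vs|[st [ds dt]]].
  rewrite (_ : V :\: _ = set0) ?cards0 //; apply/setP => x; rewrite !inE.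
  by apply/negP => /andP[+ /(subsetP Vs)]; rewrite inE negb_or => /andP[/negPf->].
set X := V :\: F in dF.
pose fF v := #|[set u in F | g v u]|; pose fX v := #|[set u in X | g v u]|.
pose M := \sum_(v in X) fF v.
have MF : M <= d * #|F|.
  rewrite /M (eq_bigr _ (fun v _ => card_set_in_sum F (g v))) exchange_big /=.
  rewrite mulnC -sum_nat_const; apply: leq_sum => u _.
  apply: leq_trans (dg u); rewrite -(eq_bigr _ (fun v _ => congr1 nat_of_bool (sg u v))).
  by rewrite -card_set_in_sum; apply/subset_leq_card/subsetP => x; rewrite !inE => /andP[].
have degX v : #|nbh g v| <= fX v + fF v.
  apply: leq_trans (leq_card_setU _ _); apply/subset_leq_card/subsetP => u.
  by rewrite !inE => gvu; rewrite gvu (sup u v) 1?sg // andbT; case: (u \in F).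
pose R := [set v in X | [&& v != s, v != t & 2 < #|nbh g v|]].
pose L := [set v in X | [&& v != s, v != t & #|nbh g v| <= 2]].
have LM : #|L| <= M.
  rewrite card_set_in_sum; apply: leq_sum => v vX.
  have [/and3P[vs vt d2]|//] := boolP [&& _, _ & _].
  have vV : v \in V by move: vX; rewrite inE => /andP[].
  case: (dn v vV vs vt (ltn_ord v)) => [|[a [b [Nv gab]]]]; first by rewrite ltnNge d2.
  rewrite /= card_gt0; apply/negP => /eqP F0.
  have gv x : g v x = (x \in [set a; b]) by rewrite -Nv inE.
  have gva : g v a by rewrite gv !inE eqxx.
  have gvb : g v b by rewrite gv !inE eqxx orbT.
  have inX x : g v x -> x \in X.
    move=> gvx; rewrite inE (sup x v) 1?sg // andbT.
    by apply/negP => xF; move/setP/(_ x): F0; rewrite !inE xF gvx.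
  have ab : a != b by apply: contraTneq gab => ->; rewrite ig.
  have va : v != a by apply: contraTneq gva => ->; rewrite ig.
  have vb : v != b by apply: contraTneq gvb => ->; rewrite ig.
  have two (Y : {set 'I_n}) x y z : y != z -> y \in Y -> z \in Y -> g x y -> g x z ->
      ~~ (#|[set u in Y | g x u]| <= 1).
    move=> yz yY zY gxy gxz; rewrite -ltnNge (cardsD1 y) (cardsD1 z) !inE.
    by rewrite yY gxy zY gxz eq_sym yz.
  (* Without a neighbour of [v] in [F], the triangle on [v], [a] and [b] lies in [X], where every
     subset has a vertex of degree at most 1. For this, [a] and [b] need not avoid [F] by
     assumption: they are neighbours of [v]. *)
  have [||x] := dF (v |: [set a; b]).
  - by apply/subsetP => x; rewrite in_setU1 in_set2 => /or3P[]/eqP->; rewrite ?vX // inX.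
  - by apply/set0Pn; exists v; rewrite setU11.
  rewrite !inE => /or3P[]/eqP->; apply/negP.
  - by apply: (two _ v a b); rewrite ?inE ?eqxx ?orbT.
  - by apply: (two _ a v b); rewrite ?inE ?eqxx ?orbT // sg.
  - by apply: (two _ b v a); rewrite ?inE ?eqxx ?orbT // sg.
have RM : #|R| <= M.
  have [->|X0] := eqVneq R set0; first by rewrite cards0.
  have /(degenerate_sum sg ig dF) dsum : X != set0.
    by apply: contraNneq X0 => X0; rewrite /R X0; apply/eqP/setP => x; rewrite !inE.
  (* Degrees are at least 2 and at least 3 on [R]; the last summand makes up for s and t. *)
  have pw v : v \in X -> 2 + [&& v != s, v != t & 2 < #|nbh g v|] <= fX v + fF v + (v \in [set s; t]).
    move=> vX; have vV : v \in V by move: vX; rewrite inE => /andP[].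
    apply: leq_trans (leq_add (degX v) (leqnn _)); rewrite !inE.
    have [->|vs] := eqVneq v s; first by rewrite /= addn0 addn1 ltnS.
    have [->|vt] /= := eqVneq v t; first by rewrite /= addn0 addn1 ltnS.
    by rewrite addn0; case: ltnP => //= _; rewrite addn0 dg2.
  have := @leq_sum _ (index_enum _) _ _ _ pw.
  rewrite !big_split /= sum_nat_const -card_set_in_sum -/R -/M -card_set_in_sum.
  have : #|[set u in X | u \in [set s; t]]| <= 2.
    apply: leq_trans (_ : #|[set s; t]| <= 2); last by rewrite cards2; case: (_ != _).
    by apply/subset_leq_card/subsetP => x; rewrite inE => /andP[].
  move: dsum; rewrite -/fX; set S := \sum_(v in X) _.
  move=> h1 h2 h3; rewrite -(leq_add2l (S + 2)) [S + 2 + M]addnAC.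
  apply: leq_trans (leq_add h1 (leqnn _)) _; rewrite mulnC; apply: leq_trans h3 _.
  by rewrite leq_add2l.
have sub : V :\: [set s; t] \subset F :|: (L :|: R).
  apply/subsetP => v; rewrite !inE negb_or => /andP[/andP[-> ->] ->] /=.
  by case: (v \in F) => //=; rewrite leqNgt orNb.
apply: leq_trans (subset_leq_card sub) _; apply: leq_trans (leq_card_setU _ _) _.
apply: leq_trans (leq_add (leqnn _) (leq_card_setU _ _)) _.
apply: leq_trans (leq_add (leqnn _) (leq_add LM RM)) _.
apply: leq_trans (_ : 2 * d.+1 * #|F| <= _); last by rewrite leq_mul2l Ff orbT.
rewrite addnn -mul2n -mulnA [d.+1 * _]mulSn mulnDr; apply: leq_add; last by rewrite leq_mul2l MF.
by rewrite mul2n -addnn leq_addr.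
Qed.

(** * Depth-first search and low points *)

(** [u] is the ancestor. The root will be its own parent, so iterating beyond it is harmless. *)
Definition anc (A : Type) (p : A -> A) (u v : A) := exists k, iter k p v = u.

Lemma ancP (A : finType) (p : A -> A) u v : reflect (anc p u v) (fconnect p v u).
Proof.
apply: (iffP idP) => [h|[k <-]]; last exact: fconnect_iter.
by exists (findex p v u); rewrite iter_findex.
Qed.

Lemma anc_refl A (p : A -> A) v : anc p v v.
Proof. by exists 0. Qed.

Lemma anc_trans A (p : A -> A) u v w : anc p u v -> anc p v w -> anc p u w.
Proof. by move=> [k <-] [l <-]; exists (k + l); rewrite iterD. Qed.

Lemma anc_par A (p : A -> A) v : anc p (p v) v.
Proof. by exists 1. Qed.

(* The state of the search after i steps: d is the discovery time, 0 when unvisited, p the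
   parent, and the open vertices are the ancestors of cur. *)
Record dfs_state n (e : rel 'I_n) (s : 'I_n) (d : 'I_n -> nat) (p : 'I_n -> 'I_n)
    (cnt : nat) (cur : 'I_n) (i : nat) : Prop := DfsState {
  dfs_cur : 0 < d cur;
  dfs_root : d s = 1;
  dfs_par_root : p s = s;
  dfs_le : forall v, d v <= cnt;
  dfs_surj : forall k, 0 < k -> k <= cnt -> exists v, d v = k;
  dfs_inj : forall u v, 0 < d u -> d u = d v -> u = v;
  dfs_par : forall v, 0 < d v -> v != s -> [/\ 0 < d (p v), d (p v) < d v & e (p v) v];
  dfs_closed : forall v, 0 < d v -> ~ anc p v cur -> forall u, e v u -> 0 < d u;
  dfs_anc : forall u v, 0 < d u -> 0 < d v -> e u v -> anc p u v \/ anc p v u;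
  (* Each step raises 2 * cnt minus the depth of cur by one. *)
  dfs_progress : (cur = s /\ forall u, e s u -> 0 < d u) \/
    (exists2 k, iter k p cur = s & k + 2 + i <= 2 * cnt) }.

Lemma dfs_init n (e : rel 'I_n) s : irreflexive e ->
  dfs_state e s (fun v => v == s : nat) (fun=> s) 1 s 0.
Proof.
move=> ie; split=> /=; rewrite ?eqxx //.
- by move=> v; case: (_ == _).
- by move=> [|[|k]] // _ _; exists s; rewrite eqxx.
- by move=> u v; do 2!case: eqP => // ->.
- by move=> v; case: eqP.
- by move=> v; case: eqP => // -> _ []; apply: anc_refl.
- by move=> u v; do 2!case: eqP => // ->; rewrite ie.
- by right; exists 0.
Qed.

Lemma dfs_visited_iter n (e : rel 'I_n) s d p cnt cur i v k :
  dfs_state e s d p cnt cur i -> 0 < d v -> 0 < d (iter k p v).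
Proof.
case=> _ rs ps _ _ _ par _ _ _ dv; elim: k => //= k IH.
have [->|/par[]//] := eqVneq (iter k p v) s; by rewrite ps rs.
Qed.

(** A visited neighbour of the new vertex [f] is still open, since closed vertices have no unvisited
    neighbours. It is thus an ancestor of [cur], and adjacent visited vertices remain comparable. *)
Lemma dfs_push n (e : rel 'I_n) s d p cnt cur i f : symmetric e -> irreflexive e ->
  dfs_state e s d p cnt cur i -> e cur f -> d f = 0 ->
  dfs_state e s (fun v => if v == f then cnt.+1 else d v) (fun v => if v == f then cur else p v)
    cnt.+1 f i.+1.
Proof.
move=> se ie D ecf df; have vis k v := @dfs_visited_iter _ _ _ _ _ _ _ _ v k D.
case: (D) => dc rs ps le sur inj par clo cmp pro.
set d' := fun v => _; set p' := fun v => _.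
have d'f : d' f = cnt.+1 by rewrite /d' eqxx.
have nf v : 0 < d v -> v != f by apply: contraTneq => ->; rewrite df.
have d'v v : 0 < d v -> d' v = d v by rewrite /d' => /nf/negPf->.
have p'v v : 0 < d v -> p' v = p v by rewrite /p' => /nf/negPf->.
have it k v : 0 < d v -> iter k p' v = iter k p v.
  by move=> dv; elim: k => //= k ->; rewrite p'v // vis.
have ac u v : 0 < d v -> anc p u v -> anc p' u v by move=> dv [k <-]; exists k; rewrite it.
have ca u v : 0 < d v -> anc p' u v -> anc p u v by move=> dv [k <-]; exists k; rewrite it.
have d'P v : 0 < d' v -> v = f \/ 0 < d v by rewrite /d'; case: eqP; [left | right].
have acf u : anc p u cur -> anc p' u f.
  by move=> uc; apply: anc_trans (ac _ _ dc uc) _; exists 1; rewrite /= /p' eqxx.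
have sf : s != f by apply: nf; rewrite rs.
have openf v : 0 < d v -> e v f -> anc p' v f.
  move=> dv evf; apply: acf.
  have [/ancP//|/ancP nv] := boolP (fconnect p cur v).
  by have := clo v dv nv f evf; rewrite df.
split.
- by rewrite d'f.
- by rewrite d'v ?rs.
- by rewrite p'v ?rs.
- by move=> v; rewrite /d'; case: eqP => // _; apply: leqW.
- move=> k k0; rewrite leq_eqVlt => /orP[/eqP->|kc]; first by exists f.
  have [v dv] := sur k k0 kc; exists v; by rewrite d'v ?dv.
- move=> u v /d'P[->|du]; rewrite ?d'f ?(d'v u du) /d'; case: eqP => // _ duv.
    by have := le v; rewrite -duv ltnn.
    by have := le u; rewrite duv ltnn.
  exact: inj.
- move=> v /d'P[->|dv] vs.
    by rewrite d'f /p' eqxx d'v // ltnS le.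
  by have [h1 h2 h3] := par v dv vs; rewrite p'v // !d'v.
- move=> v /d'P[-> []|dv nv u evu]; first exact: anc_refl.
  suff du : 0 < d u by rewrite d'v.
  by apply: clo evu => // vc; apply: nv; apply: acf.
- move=> u v /d'P[->|du] /d'P[->|dv] euv.
  + by rewrite ie in euv.
  + by right; apply: openf => //; rewrite se.
  + by left; apply: openf.
  by have [h|h] := cmp u v du dv euv; [left|right]; apply: ac.
- right; case: pro => [[cs ns]|[k ks hk]]; first by have := ns f; rewrite -cs df => /(_ ecf).
  exists k.+1; first by rewrite iterSr /p' eqxx -/p' it.
  by rewrite mulnS add2n addnS !addSn !ltnS.
Qed.

(** Only [cur] ceases to be open, and its neighbours have all been visited. A pop at the root stays
    there, which is the first alternative of [dfs_progress]. *)
Lemma dfs_pop n (e : rel 'I_n) s d p cnt cur i :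
  dfs_state e s d p cnt cur i -> (forall f, e cur f -> 0 < d f) ->
  dfs_state e s d p cnt (p cur) i.+1.
Proof.
move=> D vis; have viter k v := @dfs_visited_iter _ _ _ _ _ _ _ _ v k D.
case: D => dc rs ps le sur inj par clo cmp pro; split=> //.
- exact: (viter 1).
- move=> v dv nv; have [->|vc] := eqVneq v cur; first exact: vis.
  apply: clo dv _ => -[[|k]] /= h; first by rewrite h eqxx in vc.
  by apply: nv; exists k; rewrite -h -iterSr.
case: pro => [[cs ns]|[k ks hk]]; first by left; rewrite cs ps.
have [cs|cs] := eqVneq cur s; first by left; rewrite {1}cs ps; split=> // u; rewrite -cs; apply: vis.
case: k ks hk => [|k] ks hk; first by rewrite -ks eqxx in cs.
by right; exists k; rewrite -?iterSr // addnS.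
Qed.

Lemma dfs_cnt_le n (e : rel 'I_n) s d p cnt cur i : dfs_state e s d p cnt cur i -> cnt <= n.
Proof.
move=> D; have /uniq_leq_size : uniq (iota 1 cnt) by apply: iota_uniq.
move=> /(_ (map d (enum 'I_n))); rewrite size_iota size_map size_enum_ord; apply.
move=> k; rewrite mem_iota add1n ltnS => /andP[k0 kc]; have [v <-] := dfs_surj D k0 kc.
by apply: map_f; rewrite mem_enum.
Qed.

(** After 2n steps the progress inequality would need a count above n, so the search is back at the
    root, where no other vertex is open. *)
Lemma dfs_done n (e : rel 'I_n) s d p cnt cur :
  dfs_state e s d p cnt cur (n + n) -> forall v u, 0 < d v -> e v u -> 0 < d u.
Proof.
move=> D; have cn := dfs_cnt_le D; case: D => dc rs ps le sur inj par clo cmp pro.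
case: pro => [[cs ns]|[k _]]; last first.
  by rewrite addnn -mul2n => /leq_trans/(_ (leq_mul (leqnn 2) cn)); rewrite -[X in _ <= X]add0n leq_add2r addn2.
move=> v u dv; have [->|vs] := eqVneq v s; first exact: ns.
apply: clo => //; rewrite cs => -[k].
have -> : iter k p s = s by elim: k => //= k ->.
by move=> sv; rewrite sv eqxx in vs.
Qed.

(* low is only constrained by its local closure properties and by the fact that its values are attained. *)
Record lowpoint n (e : rel 'I_n) (t : 'I_n) (d : 'I_n -> nat) (p : 'I_n -> 'I_n)
    (low : 'I_n -> nat) : Prop := Lowpoint {
  low_attained : forall v, 0 < d v ->
    (low v = 0 /\ 0 < d t /\ anc p v t) \/
    (exists x u, [/\ anc p v x, 0 < d x, 0 < d u, x = u \/ e x u & d u = low v]);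
  low_nbr : forall v u, 0 < d v -> e v u -> low v <= d u;
  low_par : forall v, 0 < d v -> low (p v) <= low v;
  low_t : 0 < d t -> low t = 0 }.

Lemma path_exits_through n (e : rel 'I_n) (X : pred 'I_n) c x q :
  (forall z u, X z -> e z u -> X u \/ u = c) ->
  path e x q -> X x -> ~~ X (last x q) -> c \in q.
Proof.
move=> out; elim: q x => [|y q IH] x /=; first by move=> _ ->.
move=> /andP[exy pq] Xx Xl; rewrite inE.
by have [Xy|->] := out x y Xx exy; [rewrite (IH y) ?orbT | rewrite eqxx].
Qed.

(** The bounds on discovery times later show that tree paths avoid a given vertex. *)
Lemma tree_path n (e : rel 'I_n) s d p cnt cur i k v : symmetric e ->
  dfs_state e s d p cnt cur i -> 0 < d v ->
  exists q, [/\ path e v q, last v q = iter k p v &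
    forall z, z \in v :: q -> d (iter k p v) <= d z <= d v].
Proof.
move=> se D dv; elim: k => [|k [q [pq lq bq]]].
  by exists [::]; split=> // z; rewrite inE => /eqP->; rewrite leqnn.
have vk := dfs_visited_iter k D dv.
have [ks|ks] := eqVneq (iter k p v) s.
  by exists q; rewrite /= ks (dfs_par_root D) -ks.
have [h1 h2 h3] := dfs_par D vk ks; exists (rcons q (iter k.+1 p v)); split.
- by rewrite rcons_path pq lq /= se.
- by rewrite last_rcons.
move=> z; rewrite -rcons_cons mem_rcons inE => /orP[/eqP->|/bq/andP[z1 z2]].
  rewrite leqnn /= (leq_trans (ltnW h2)) //.
  by have /bq/andP[] : v \in v :: q by rewrite mem_head.
by rewrite z2 andbT (leq_trans (ltnW h2)).
Qed.

Lemma anc_path n (e : rel 'I_n) s d p cnt cur i u v : symmetric e ->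
  dfs_state e s d p cnt cur i -> 0 < d v -> anc p u v ->
  exists q, [/\ path e v q, last v q = u & forall z, z \in v :: q -> d u <= d z <= d v].
Proof. by move=> se D dv [k <-]; apply: tree_path D dv. Qed.

Lemma anc_path_down n (e : rel 'I_n) s d p cnt cur i u v : symmetric e ->
  dfs_state e s d p cnt cur i -> 0 < d v -> anc p u v ->
  exists q, [/\ path e u q, last u q = v & forall z, z \in u :: q -> d u <= d z <= d v].
Proof.
move=> se D dv /(anc_path se D dv)[q [pq lq bq]]; exists (rev (belast v q)).
have mq : u :: rev (belast v q) =i v :: q.
  by move=> z; rewrite -lq -rev_rcons -lastI mem_rev.
split; last by move=> z; rewrite mq; apply: bq.
  by rewrite -lq rev_path; under eq_path do rewrite se.
by case: (q) lq => [|y l] /= lq; rewrite ?rev_cons ?last_rcons.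
Qed.

Lemma root_anc n (e : rel 'I_n) s d p cnt cur i v :
  dfs_state e s d p cnt cur i -> 0 < d v -> anc p s v.
Proof.
move=> D; have [k] := ubnP (d v); elim: k v => // k IH v lek dv.
have [->|vs] := eqVneq v s; first exact: anc_refl.
have [h1 h2 _] := dfs_par D dv vs.
by apply: anc_trans (IH (p v) _ h1) (anc_par _ _); apply: leq_trans h2 _.
Qed.

Lemma st_path_ends n (e : rel 'I_n) s t P : st_path e s t P -> s \in P /\ t \in P.
Proof.
case: P => // a l /and4P[/eqP-> _ /eqP<- _]; by rewrite mem_head mem_last.
Qed.

Lemma st_path_shorten n (e : rel 'I_n) s t q :
  path e s q -> last s q = t -> exists P, st_path e s t P.
Proof.
by case/shortenP => p pp up _ lp; exists (s :: p); rewrite /= eqxx pp lp eqxx.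
Qed.

(** By induction the parent of [v] lies on an s-t path [P], unless it is s. A low point above the
    parent gives a walk from [v] that bypasses the parent and ends in s or t, hence on [P]. Its
    first part, preceded by the edge from the parent, is an ear of [P] through [v]. *)
Lemma kept_on_st_path n (e : rel 'I_n) s t d p cnt cur i low (K : {set 'I_n}) :
  symmetric e -> dfs_state e s d p cnt cur i -> lowpoint e t d p low ->
  (forall v, v \in K -> 0 < d v /\ (v = s \/ p v \in K /\ low v < d (p v))) ->
  forall v, v \in K -> v != s -> on_st_path e s t v.
Proof.
move=> se D L Kdef v; have [k] := ubnP (d v); elim: k v => // k IH v lek vK vs.
have [dv [evs|[pK lowv]]] := Kdef v vK; first by rewrite evs eqxx in vs.
have [dp0 dpv epv] := dfs_par D dv vs.
have [P sP pP] : on_st_path e s t (p v).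
  have [ps|ps] := eqVneq (p v) s; last exact: IH (leq_trans dpv lek) pK ps.
  (* The root has time 1, so a smaller low point is 0, which marks a subtree that contains t. *)
  have low0 : low v = 0 by move: lowv; rewrite ps (dfs_root D); case: (low v).
  have [[_ [dt _]]|[x [u [_ _ du _ eu]]]] := low_attained L dv; last by rewrite eu low0 in du.
  have [q [pq lq _]] := anc_path_down se D dt (root_anc D dt).
  have [P sP] := st_path_shorten pq lq; exists P => //.
  by rewrite ps; have [] := st_path_ends sP.
have [vP|vP] := boolP (v \in P); first by exists P.
have [sinP tinP] := st_path_ends sP.
(* The walk goes down from [v], among vertices discovered after the parent, and then possibly up
   from [u], among vertices discovered before it. *)
have [w [pw lw nw]] : exists w, [/\ path e v w, last v w \in P & p v \notin v :: w].
  have [[_ [dt vt]]|[x [u [vx dx du xu eu]]]] := low_attained L dv.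
    have [q [pq lq bq]] := anc_path_down se D dt vt; exists q; rewrite lq; split=> //.
    by apply/negP => /bq/andP[]; rewrite leqNgt dpv.
  have [q1 [pq1 lq1 bq1]] := anc_path_down se D dx vx.
  have [q2 [pq2 lq2 bq2]] := anc_path se D du (root_anc D du).
  case: xu => [exu|exu].
    have /bq1/andP[] : x \in v :: q1 by rewrite -lq1 mem_last.
    by rewrite exu eu => /leq_ltn_trans/(_ lowv)/ltn_trans/(_ dpv); rewrite ltnn.
  exists (q1 ++ u :: q2); rewrite cat_path pq1 lq1 /= exu pq2 last_cat /= lq2; split=> //.
  rewrite -cat_cons mem_cat negb_or; apply/andP; split.
    by apply/negP => /bq1/andP[]; rewrite leqNgt dpv.
  by apply/negP => /bq2/andP[_]; rewrite eu leqNgt lowv.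
have [x [w' [pw' /eqP exv lw' [sub uw' _ nw']]]] :=
  subpath_between (a := pred1 v) (b := mem P) pw (eqxx v) lw.
subst x; case: (lastP w') pw' lw' sub uw' nw' => [|w1 z] pw' lw' sub uw' nw'.
  by rewrite /= (negPf vP) in lw'.
rewrite last_rcons belast_rcons in lw' nw'.
have zp : p v != z.
  by apply: contraNneq nw => ->; apply: sub; rewrite inE mem_rcons mem_head orbT.
have sP' : spath e s t P by rewrite -st_pathE.
have pear : path e (p v) (rcons (v :: w1) z) by rewrite /= epv.
have uear : uniq (v :: w1) by move: uw'; rewrite -rcons_cons rcons_uniq => /andP[].
have [P' sP1 sub'] := ear se sP' pP lw' zp pear uear nw'.
by exists P'; [rewrite st_pathE | apply: sub'; rewrite mem_head].
Qed.

(** If [v] is not kept, some ancestor [y] of it fails the test against its parent. The subtree of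
    [y] can be left only through [p y] and contains neither s nor t, so a path through [v] would
    visit [p y] both before and after [v]. *)
Lemma on_st_path_kept n (e : rel 'I_n) s t d p cnt cur i low (K : {set 'I_n}) :
  symmetric e -> dfs_state e s d p cnt cur i -> (forall v u, 0 < d v -> e v u -> 0 < d u) ->
  lowpoint e t d p low ->
  (forall v, 0 < d v -> v = s \/ (p v \in K /\ low v < d (p v)) -> v \in K) ->
  forall v, on_st_path e s t v -> v \in K.
Proof.
move=> se D clo L Kdef v [P sP vP].
have ds : 0 < d s by rewrite (dfs_root D).
have vispath x q : path e x q -> 0 < d x -> {in x :: q, forall z, 0 < d z}.
  elim: q x => [|y q IH] x /=; first by move=> _ dx z; rewrite inE => /eqP->.
  move=> /andP[exy pq] dx z; rewrite inE => /orP[/eqP->//|zq].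
  exact: IH pq (clo _ _ dx exy) z zq.
have visP z : z \in P -> 0 < d z.
  case: (P) sP => // a q /and4P[/eqP-> pq _ _]; exact: vispath.
apply/negPn/negP => vK.
have [y [yv ys dy low_y]] : exists y, [/\ anc p y v, y != s, 0 < d y & d (p y) <= low y].
  move: (visP v vP) vK; have [k] := ubnP (d v); elim: k (v) => // k IH x lek dx xK.
  have xs : x != s by apply: contra xK => /eqP->; apply: Kdef => //; left.
  have [h1 h2 _] := dfs_par D dx xs.
  have [pK|pK] := boolP (p x \in K).
    exists x; split=> //; first exact: anc_refl.
    by rewrite leqNgt; apply: contra xK => lx; apply: Kdef => //; right.
  have [y [h3 h4 h5 h6]] := IH (p x) (leq_trans h2 lek) h1 pK.
  by exists y; split=> //; apply: anc_trans h3 (anc_par _ _).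
have [dp0 dpy _] := dfs_par D dy ys.
pose X z := (0 < d z) && fconnect p z y.
have dX u z : 0 < d z -> anc p u z -> d u <= d z.
  by move=> dz /(anc_path se D dz)[q [_ lq bq]]; have /bq/andP[] := mem_head z q.
have lX z : X z -> low y <= low z.
  move=> /andP[dz /ancP[k <-]]; elim: k => //= k IH; apply: leq_trans _ IH.
  by apply: (low_par L); apply: dfs_visited_iter D dz.
have Xs : ~~ X s.
  apply/negP => /andP[_ /ancP/(dX _ _ ds)]; rewrite (dfs_root D) => dy1.
  by have := leq_trans dpy dy1; rewrite ltnS leqn0 => /eqP dp; rewrite dp in dp0.
have Xt : ~~ X t.
  apply/negP => Xt; have := lX t Xt; case/andP: Xt => dt _; rewrite (low_t L dt) leqn0 => /eqP ly.
  by rewrite ly leqn0 in low_y; rewrite (eqP low_y) in dp0.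
(* A neighbour outside the subtree is a proper ancestor of [y]; all of these except [p y] are
   discovered earlier than the low point of [y] permits. *)
have out z u : X z -> e z u -> X u \/ u = p y.
  move=> Xz ezu; case/andP: (Xz) => dz /ancP yz; have du := clo z u dz ezu.
  have lu : d (p y) <= d u := leq_trans low_y (leq_trans (lX z Xz) (low_nbr L dz ezu)).
  have [zu|[k ek]] := dfs_anc D dz du ezu.
    by left; rewrite /X du; apply/ancP; apply: anc_trans yz zu.
  case: yz => j ej; case: (leqP k j) => [kj|jk].
    by left; rewrite /X du; apply/ancP; exists (j - k); rewrite -ek -iterD subnK.
  right; apply: (dfs_inj D) => //; apply/eqP; rewrite eqn_leq lu andbT.
  apply: dX => //; exists (k - j.+1).
  have -> : p y = iter j.+1 p z by rewrite /= ej.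
  by rewrite -iterD subnK.
have Xv : X v by rewrite /X visP //; apply/ancP.
case/splitPr: vP sP {visP} => p1 p2; rewrite st_pathE spath_cat_cons.
move=> /and5P[/eqP hs /eqP lt sp pq up].
have c2 : p y \in p2 by apply: (path_exits_through out pq); rewrite ?lt.
have c1 : p y \in p1.
  case: p1 hs sp {up} => [|a p1] hs sp; first by rewrite /= in hs; rewrite hs in Xv; rewrite Xv in Xs.
  rewrite -mem_rev; apply: (path_exits_through out _ Xv).
    by have := sym_sorted_rev (rcons (a :: p1) v) se; rewrite rev_rcons sp.
  by rewrite rev_cons last_rcons; move: hs => /= ->.
move: up; rewrite cat_uniq => /and3P[_ /hasPn/(_ (p y)) h _].
by move: h; rewrite inE c2 orbT /= c1 => /(_ isT).
Qed.

(** * A structured language compiled to the machine *)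

Inductive exp :=
| Cst of nat
| Var of nat
| Plus of exp & exp
| Minus of exp & exp
| Arr of nat & exp.

Inductive cmd :=
| Asg of nat & exp
| Put of nat & exp & exp
| Inp of nat & exp
| Out of exp & exp
| Seq of cmd & cmd
| If of exp & cmd & cmd
| For of nat & nat & cmd.

Record store := Store { vars : nat -> nat; arrs : nat -> nat -> nat; raw : nat -> nat }.

Definition setv x k st := Store (upd (vars st) x k) (arrs st) (raw st).

Definition seta k i v st :=
  Store (vars st) (fun k' => if k' == k then upd (arrs st k) i v else arrs st k') (raw st).

Definition setr i v st := Store (vars st) (arrs st) (upd (raw st) i v).

Fixpoint ev (st : store) (e : exp) : nat :=
  match e with
  | Cst k => k
  | Var x => vars st x
  | Plus e1 e2 => ev st e1 + ev st e2
  | Minus e1 e2 => ev st e1 - ev st e2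
  | Arr k e => arrs st k (ev st e)
  end.

(* Registers below 20 hold the program variables, register 20 the address Z of the arrays and
   registers 21 to 31 intermediate results; cell i of array k < 8 is at address Z + 8 * i + k,
   and raw i is cell base + i, as long as it lies below Z. *)
Definition base := 32.

(** Loop bounds are read once, so this is total. Cells from Z on belong to the arrays: an input from
    there does nothing, and an output to there changes [raw] only where [corr] does not look. *)
Fixpoint sem (Z : nat) (c : cmd) (st : store) : store :=
  match c with
  | Asg x e => setv x (ev st e) st
  | Put k e1 e2 => seta k (ev st e1) (ev st e2) st
  | Inp x e => if base + ev st e < Z then setv x (raw st (ev st e)) st else st
  | Out e1 e2 => setr (ev st e1) (ev st e2) st
  | Seq c1 c2 => sem Z c2 (sem Z c1 st)
  | If e c1 c2 => if ev st e == 0 then sem Z c2 st else sem Z c1 st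
  | For x b c =>
      iter (vars st b) (fun st' => setv x (vars st' x).+1 (sem Z c st')) (setv x 0 st)
  end.

Fixpoint asg (c : cmd) : seq nat :=
  match c with
  | Asg x _ | Inp x _ => [:: x]
  | Put _ _ _ | Out _ _ => [::]
  | Seq c1 c2 | If _ c1 c2 => asg c1 ++ asg c2
  | For x _ c => x :: asg c
  end.

Fixpoint puts (c : cmd) : seq nat :=
  match c with
  | Put k _ _ => [:: k]
  | Asg _ _ | Inp _ _ | Out _ _ => [::]
  | Seq c1 c2 | If _ c1 c2 => puts c1 ++ puts c2
  | For _ _ c => puts c
  end.

Fixpoint outs (c : cmd) : bool :=
  match c with
  | Out _ _ => true
  | Asg _ _ | Inp _ _ | Put _ _ _ => false
  | Seq c1 c2 | If _ c1 c2 => outs c1 || outs c2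
  | For _ _ c => outs c
  end.

Lemma sem_vars Z c st x : x \notin asg c -> vars (sem Z c st) x = vars st x.
Proof.
elim: c st => [y e|k e1 e2|y e|e1 e2|c1 IH1 c2 IH2|e c1 IH1 c2 IH2|y b c IH] st //=.
- by rewrite inE /upd => /negPf->.
- by rewrite inE; case: ifP => //= _; rewrite /upd => /negPf->.
- by rewrite mem_cat negb_or => /andP[h1 h2]; rewrite IH2 ?IH1.
- by rewrite mem_cat negb_or => /andP[h1 h2]; case: ifP; rewrite ?IH2 ?IH1.
rewrite inE negb_or => /andP[xy xc]; elim: (vars st b) => /= [|i IHi]; rewrite /upd (negPf xy) //.
by rewrite IH.
Qed.

Lemma sem_arrs Z c st k : k \notin puts c -> arrs (sem Z c st) k = arrs st k.
Proof.
elim: c st => [y e|k' e1 e2|y e|e1 e2|c1 IH1 c2 IH2|e c1 IH1 c2 IH2|y b c IH] st //=.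
- by rewrite inE => /negPf->.
- by case: ifP.
- by rewrite mem_cat negb_or => /andP[h1 h2]; rewrite IH2 ?IH1.
- by rewrite mem_cat negb_or => /andP[h1 h2]; case: ifP; rewrite ?IH2 ?IH1.
by move=> kc; elim: (vars st b) => //= i IHi; rewrite IH.
Qed.

Lemma sem_raw Z c st : ~~ outs c -> raw (sem Z c st) = raw st.
Proof.
elim: c st => [y e|k' e1 e2|y e|e1 e2|c1 IH1 c2 IH2|e c1 IH1 c2 IH2|y b c IH] st //=.
- by case: ifP.
- by rewrite negb_or => /andP[h1 h2]; rewrite IH2 ?IH1.
- by rewrite negb_or => /andP[h1 h2]; case: ifP; rewrite ?IH2 ?IH1.
by move=> kc; elim: (vars st b) => //= i IHi; rewrite IH.
Qed.

Lemma sem_for Z x b c st (I : nat -> store -> Prop) :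
  b \notin asg (For x b c) -> x \notin asg c ->
  I 0 (setv x 0 st) ->
  (forall i st', i < vars st b -> vars st' x = i -> I i st' ->
     I i.+1 (setv x i.+1 (sem Z c st'))) ->
  I (vars st b) (sem Z (For x b c) st).
Proof.
move=> bx xc I0 Istep /=.
set body := fun st' => _.
have [] // : I (vars st b) (iter (vars st b) body (setv x 0 st)) /\
    vars (iter (vars st b) body (setv x 0 st)) x = vars st b.
elim: {-2}(vars st b) (leqnn (vars st b)) => [|i IH] lei /=; first by rewrite /upd eqxx.
have [Ii xi] := IH (ltnW lei); rewrite /body /= xi; split; [exact: Istep | by rewrite /= /upd eqxx].
Qed.

(** * Straight-line code and expressions *)

Definition ecode (i : instr) (m : memory) : memory :=
  match i with
  | Const r k => upd m r k
  | Add r a b => upd m r (m a + m b)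
  | Defs.Sub r a b => upd m r (m a - m b)
  | Rd r a => upd m r (m (m a))
  | Wr a b => upd m (m a) (m b)
  | _ => m
  end.

Definition straight (i : instr) := if i is (Jz _ _ | Jmp _ | Halt) then false else true.

Definition ecodes (l : seq instr) (m : memory) := foldl (fun m i => ecode i m) m l.

Fixpoint steps (prog : seq instr) (k : nat) (c : nat * memory) : option (nat * memory) :=
  if k is k'.+1 then
    if step prog c is Some c' then steps prog k' c' else None
  else Some c.

Lemma steps_add prog k1 k2 c c1 :
  steps prog k1 c = Some c1 -> steps prog (k1 + k2) c = steps prog k2 c1.
Proof.
elim: k1 c => /= [|k IH] c; first by case=> ->.
by case: (step prog c) => // c'; apply: IH.
Qed.

Lemma steps_run prog k fuel c c' : steps prog k c = Some c' -> step prog c' = None ->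
  k <= fuel -> run prog fuel c = Some c'.2.
Proof.
elim: k c fuel => /= [|k IH] c fuel; first by case=> -> sN _; case: fuel => [|f] /=; rewrite sN.
case sc: (step prog c) => [c1|] // sk sN; case: fuel => // f kf /=; rewrite sc; exact: IH.
Qed.

Definition code_at (prog : seq instr) (pos : nat) (l : seq instr) :=
  forall i, i < size l -> nth Halt prog (pos + i) = nth Halt l i.

Lemma code_at_cat prog pos l1 l2 : code_at prog pos (l1 ++ l2) ->
  code_at prog pos l1 /\ code_at prog (pos + size l1) l2.
Proof.
move=> h; split=> i li.
  by rewrite h ?size_cat ?nth_cat ?li // ltn_addr.
by rewrite -addnA h ?size_cat ?ltn_add2l // nth_cat ltnNge leq_addr addKn.
Qed.

Lemma code_at_cons prog pos i l : code_at prog pos (i :: l) ->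
  nth Halt prog pos = i /\ code_at prog pos.+1 l.
Proof.
move=> h; split; first by have := h 0 isT; rewrite addn0.
by move=> j jl; rewrite addSnnS h.
Qed.

Lemma steps_straight prog pos l m : code_at prog pos l -> all straight l ->
  steps prog (size l) (pos, m) = Some (pos + size l, ecodes l m).
Proof.
elim: l pos m => [|i l IH] pos m /=; first by rewrite addn0.
move=> /code_at_cons[hi hl] /andP[si sl]; rewrite hi addnS -addSn -(IH _ _ hl sl).
by case: i si {hi}.
Qed.

(** In place of a multiplication, three doublings give the stride 8 of the interleaved arrays. *)
Definition caddr d k :=
  [:: Add d d d; Add d d d; Add d d d; Const d.+1 k; Add d d d.+1; Add d d 20].

(** The registers from [d] on form the evaluation stack. There is no move instruction, so a variable
    is fetched by adding 0. *)
Fixpoint cexp (d : nat) (e : exp) : seq instr :=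
  match e with
  | Cst k => [:: Const d k]
  | Var x => [:: Const d 0; Add d x d]
  | Plus e1 e2 => cexp d e1 ++ cexp d.+1 e2 ++ [:: Add d d d.+1]
  | Minus e1 e2 => cexp d e1 ++ cexp d.+1 e2 ++ [:: Defs.Sub d d d.+1]
  | Arr k e => cexp d e ++ caddr d k ++ [:: Rd d d]
  end.

Fixpoint wfe (d : nat) (e : exp) : bool :=
  match e with
  | Cst k => d < base
  | Var x => (d < base) && (x < 20)
  | Plus e1 e2 | Minus e1 e2 => wfe d e1 && wfe d.+1 e2
  | Arr k e => [&& wfe d e, d.+1 < base & k < 8]
  end.

(** Registers 21 to 31 are left unconstrained, so that evaluation may overwrite them. Interleaving
    lets eight arrays of unbounded length share the memory above Z. *)
Definition corr (Z : nat) (m : memory) (st : store) := [/\ base <= Z,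
  forall x, x < 20 -> m x = vars st x, m 20 = Z,
  forall k i, k < 8 -> m (Z + 8 * i + k) = arrs st k i &
  forall i, base + i < Z -> m (base + i) = raw st i].

Lemma corr_ext Z m m' st :
  (forall i, (i < 21) || (base <= i) -> m' i = m i) -> corr Z m st -> corr Z m' st.
Proof.
move=> h [Zb hv hZ ha hr]; split=> //.
- by move=> x x20; rewrite h ?hv // ltnW.
- by rewrite h.
- by move=> k i k8; rewrite h ?ha // -addnA (leq_trans Zb (leq_addr _ _)) orbT.
- by move=> i iZ; rewrite h ?hr // leq_addr orbT.
Qed.

Lemma straight_cexp d e : all straight (cexp d e).
Proof.
elim: e d => [k|x|e1 IH1 e2 IH2|e1 IH1 e2 IH2|k e IH] d //=; rewrite !all_cat.
- by rewrite IH1 IH2.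
- by rewrite IH1 IH2.
by rewrite IH.
Qed.

Lemma ecodes_cat l1 l2 m : ecodes (l1 ++ l2) m = ecodes l2 (ecodes l1 m).
Proof. exact: foldl_cat. Qed.

Lemma ecodes_caddr d k m : 20 < d ->
  let m' := ecodes (caddr d k) m in
  m' d = m 20 + 8 * m d + k /\ forall i, i != d -> i != d.+1 -> m' i = m i.
Proof.
move=> d20; rewrite /ecodes /= /upd !eqxx.
have -> : d == d.+1 = false by rewrite -{1}[d]add0n -[d.+1]add1n eqn_add2r.
have -> : 20 == d = false by apply/negbTE; rewrite neq_ltn d20.
have -> : 20 == d.+1 = false by apply/negbTE; rewrite neq_ltn ltnW.
split; first by lia.
by move=> i /negPf-> /negPf->.
Qed.

Lemma wfe_lt d e : wfe d e -> d < base.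
Proof.
elim: e d => [k|x|e1 IH1 e2 _|e1 IH1 e2 _|k e IH] d //=; first by case/andP.
- by case/andP=> /IH1.
- by case/andP=> /IH1.
by case/andP=> /IH.
Qed.

Lemma cexp_correct Z d e m st : 20 < d -> wfe d e -> corr Z m st ->
  let m' := ecodes (cexp d e) m in
  m' d = ev st e /\ forall i, (i < d) || (base <= i) -> m' i = m i.
Proof.
move: d m; have neq k i : k < base -> (i < k) || (base <= i) -> (i == k) = false.
  move=> kb h; apply/negbTE; apply: contraTneq h => ->.
  by rewrite ltnn /= -ltnNge.
pose ok e := forall d m, 20 < d -> wfe d e -> corr Z m st ->
  let m' := ecodes (cexp d e) m in
  m' d = ev st e /\ forall i, (i < d) || (base <= i) -> m' i = m i.
have bin e1 e2 d m : ok e1 -> ok e2 ->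
    20 < d -> wfe d e1 && wfe d.+1 e2 -> corr Z m st ->
    let m' := ecodes (cexp d e1 ++ cexp d.+1 e2) m in
    [/\ m' d = ev st e1, m' d.+1 = ev st e2 & forall i, (i < d) || (base <= i) -> m' i = m i].
  move=> IH1 IH2 d20 /andP[w1 w2] cm; rewrite ecodes_cat; have [v1 f1] := IH1 d m d20 w1 cm.
  set m1 := ecodes _ m in v1 f1 *.
  have cm1 : corr Z m1 st.
    apply: corr_ext cm => i /orP[i21|ib]; apply: f1; rewrite ?ib ?orbT //.
    by rewrite (leq_trans i21).
  have [v2 f2] := IH2 d.+1 m1 (ltnW d20) w2 cm1; split=> //.
    by rewrite f2 ?ltnSn.
  by move=> i h; rewrite f2 ?f1 //; case/orP: h => [/ltnW h|->]; rewrite ?orbT // ltnS h.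
suff : ok e by [].
elim: e => [k|x|e1 IH1 e2 IH2|e1 IH1 e2 IH2|k e IH] d m d20 w cm m'.
- by rewrite /m' /ecodes /= /upd eqxx; split=> // i /neq-> //; apply: wfe_lt w.
- have db := wfe_lt w; move: w cm => /= /andP[_ x20] [_ hv _ _ _].
  rewrite /m' /ecodes /= /upd eqxx addn0.
  have -> : x == d = false by apply/negbTE; rewrite neq_ltn (leq_trans x20) // ltnW.
  by split=> [|i /neq-> //]; rewrite hv.
- have db := wfe_lt w; have [v1 v2 f] := bin _ _ _ m IH1 IH2 d20 w cm.
  rewrite /m' /= catA ecodes_cat; set m1 := ecodes _ m in v1 v2 f *.
  by rewrite /ecodes /= /upd eqxx v1 v2; split=> // i h; rewrite neq ?f.
- have db := wfe_lt w; have [v1 v2 f] := bin _ _ _ m IH1 IH2 d20 w cm.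
  rewrite /m' /= catA ecodes_cat; set m1 := ecodes _ m in v1 v2 f *.
  by rewrite /ecodes /= /upd eqxx v1 v2; split=> // i h; rewrite neq ?f.
move: w => /= /and3P[w db k8]; have [v f] := IH d m d20 w cm.
rewrite /m' [cexp _ _](erefl : _ = cexp d e ++ caddr d k ++ [:: Rd d d]) !ecodes_cat; set m1 := ecodes _ m in v f *.
have [v1 f1] := ecodes_caddr k m1 d20; set m2 := ecodes _ m1 in v1 f1 *.
case: cm => Zb hv hZ ha hr.
have m12 i : (i < d) || (base <= i) -> m2 i = m i.
  move=> h; rewrite f1 ?f //; first by rewrite neq // ltnW.
  by rewrite neq //; case/orP: h => [/ltnW|] h; rewrite ltnS h ?orbT.
rewrite /ecodes /= /upd eqxx v1; split; last by move=> i h; rewrite neq ?m12 // ltnW.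
rewrite m12; last by rewrite f ?d20 // hZ -addnA (leq_trans Zb (leq_addr _ _)) orbT.
by rewrite f ?d20 // hZ v ha.
Qed.

(** * Compilation of commands *)

Fixpoint csize (c : cmd) : nat :=
  match c with
  | Asg x e => size (cexp 21 e) + 2
  | Put k e1 e2 => size (cexp 21 e1) + (6 + (size (cexp 22 e2) + 1))
  | Inp x e => size (cexp 21 (Plus e (Cst base))) + 5
  | Out e1 e2 => size (cexp 21 (Plus e1 (Cst base))) + (size (cexp 22 e2) + 3)
  | Seq c1 c2 => csize c1 + csize c2
  | If e c1 c2 => size (cexp 21 e) + (csize c1 + csize c2).+2
  | For x b c => csize c + 6
  end.

(** Jump targets are absolute, hence [pos] and a size function that does not depend on it. Truncated
    subtraction followed by [Jz] serves as comparison, against the bound of a loop and against Z in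
    [Inp] and [Out]. *)
Fixpoint compile (pos : nat) (c : cmd) : seq instr :=
  match c with
  | Asg x e => cexp 21 e ++ [:: Const 22 0; Add x 21 22]
  | Put k e1 e2 => cexp 21 e1 ++ caddr 21 k ++ cexp 22 e2 ++ [:: Wr 21 22]
  | Inp x e => cexp 21 (Plus e (Cst base)) ++
      [:: Defs.Sub 22 20 21; Jz 22 (pos + csize c); Rd 21 21; Const 22 0; Add x 21 22]
  | Out e1 e2 => cexp 21 (Plus e1 (Cst base)) ++ cexp 22 e2 ++
      [:: Defs.Sub 23 20 21; Jz 23 (pos + csize c); Wr 21 22]
  | Seq c1 c2 => compile pos c1 ++ compile (pos + csize c1) c2
  | If e c1 c2 =>
      let p1 := (pos + size (cexp 21 e)).+1 in
      cexp 21 e ++ Jz 21 (p1 + csize c1).+1 :: compile p1 c1 ++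
      Jmp (pos + csize c) :: compile (p1 + csize c1).+1 c2
  | For x b c' =>
      [:: Const x 0; Defs.Sub 21 b x; Jz 21 (pos + csize c)] ++ compile (pos + 3) c' ++
      [:: Const 21 1; Add x x 21; Jmp pos.+1]
  end.

Lemma size_compile c pos : size (compile pos c) = csize c.
Proof.
elim: c pos => [x e|k e1 e2|x e|e1 e2|c1 IH1 c2 IH2|e c1 IH1 c2 IH2|x b c IH] pos /=;
  rewrite ?size_cat //=.
- by rewrite !size_cat.
- by rewrite IH1 IH2.
- by rewrite size_cat /= IH1 IH2 !addnS.
by rewrite IH addn3 addnC.
Qed.

(** Variables 0 to 5 are parameters: never assigned, and the only loop bounds. So the code may
    reread a bound in every round although [sem] reads it once, and the number of rounds is known
    from the initial store. *)
Fixpoint wfc (c : cmd) : bool :=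
  match c with
  | Asg x e => [&& 5 < x, x < 20 & wfe 21 e]
  | Put k e1 e2 => [&& k < 8, wfe 21 e1 & wfe 22 e2]
  | Inp x e => [&& 5 < x, x < 20 & wfe 21 e]
  | Out e1 e2 => wfe 21 e1 && wfe 22 e2
  | Seq c1 c2 => wfc c1 && wfc c2
  | If e c1 c2 => [&& wfe 21 e, wfc c1 & wfc c2]
  | For x b c => [&& 5 < x, x < 20, b < 6, x \notin asg c & wfc c]
  end.

(** A conditional is charged for both branches. A round of a loop adds 5 instructions to its body,
    for test, increment and jump; initialisation and final test take 3. *)
Fixpoint cost (beta : nat -> nat) (c : cmd) : nat :=
  match c with
  | For x b c => beta b * (cost beta c + 5) + 3
  | Seq c1 c2 => cost beta c1 + cost beta c2
  | If e c1 c2 => size (cexp 21 e) + (cost beta c1 + cost beta c2).+2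
  | _ => csize c
  end.

Lemma wfc_asg c x : wfc c -> x < 6 -> x \notin asg c.
Proof.
move=> w x6; have neq y : 5 < y -> (x == y) = false.
  by move=> y5; apply/negbTE; rewrite neq_ltn (leq_trans x6).
elim: c w => [y e|k e1 e2|y e|e1 e2|c1 IH1 c2 IH2|e c1 IH1 c2 IH2|y b c IH] //=.
- by move=> /and3P[y5 _ _]; rewrite inE neq.
- by move=> /and3P[y5 _ _]; rewrite inE neq.
- by move=> /andP[/IH1 h1 /IH2 h2]; rewrite mem_cat negb_or h1.
- by move=> /and3P[_ /IH1 h1 /IH2 h2]; rewrite mem_cat negb_or h1.
by move=> /and5P[y5 _ _ _ /IH h]; rewrite inE neq.
Qed.

Lemma steps_trans prog k1 k2 c c1 c2 :
  steps prog k1 c = Some c1 -> steps prog k2 c1 = Some c2 -> steps prog (k1 + k2) c = Some c2.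
Proof. by move=> h1 h2; rewrite (steps_add _ h1). Qed.

Lemma corr_setv Z m m' st x v : corr Z m st -> x < 20 ->
  m' x = v -> (forall i, (i < 21) || (base <= i) -> i != x -> m' i = m i) ->
  corr Z m' (setv x v st).
Proof.
move=> [Zb hv hZ ha hr] x20 mx mi.
have big i : 20 <= i -> i != x by move=> h; rewrite neq_ltn (leq_trans x20 h) orbT.
split=> //.
- move=> y y20 /=; rewrite /upd; have [->//|yx] := eqVneq y x.
  by rewrite mi ?hv // ltnS ltnW.
- by rewrite mi // big.
- move=> k i k8; have h : base <= Z + 8 * i + k by rewrite -addnA (leq_trans Zb) ?leq_addr.
  by rewrite mi ?ha ?h ?orbT // big // (leq_trans _ h).
- move=> i iZ; rewrite mi ?hr ?leq_addr ?orbT // big //.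
Qed.

Lemma corr_seta Z m st k i v : corr Z m st -> k < 8 ->
  corr Z (upd m (Z + 8 * i + k) v) (seta k i v st).
Proof.
move=> [Zb hv hZ ha hr] k8; rewrite /base in Zb hr *.
split=> //=; rewrite /upd.
- by move=> x x20; case: eqP => [h|_]; [lia | apply: hv].
- by case: eqP => [h|_]; [lia | ].
- move=> k' i' k8'; case: eqP => [h|h].
    have [-> ->] : k' = k /\ i' = i by lia.
    by rewrite !eqxx.
  case: eqP => [ek|_]; last exact: ha.
  subst k' => /=; case: eqP => [ei|_]; [by subst i' | exact: ha].
- by move=> j jZ; case: eqP => [h|_]; [lia | apply: hr].
Qed.

Lemma corr_setr Z m st i v : corr Z m st ->
  corr Z (if base + i < Z then upd m (base + i) v else m) (setr i v st).
Proof.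
move=> [Zb hv hZ ha hr]; rewrite /base in Zb hr *.
case: ifP => iZ; split=> //=; rewrite /upd.
- by move=> x x20; case: eqP => [h|_]; [lia | apply: hv].
- by move=> k' i' k8'; case: eqP => [h|h]; [lia | apply: ha].
- by move=> j jZ; rewrite eqn_add2l; case: eqP => // _; apply: hr.
by move=> j jZ; case: eqP => [ij|_]; [rewrite -ij jZ in iZ | apply: hr].
Qed.

Lemma cexp_steps Z d e m st prog pos l : 20 < d -> wfe d e -> corr Z m st ->
  code_at prog pos (cexp d e ++ l) ->
  exists m1, [/\ steps prog (size (cexp d e)) (pos, m) = Some (pos + size (cexp d e), m1),
    m1 d = ev st e, corr Z m1 st, (forall i, (i < d) || (base <= i) -> m1 i = m i) &
    code_at prog (pos + size (cexp d e)) l].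
Proof.
move=> d20 w cm /code_at_cat[c1 c2]; have [v f] := cexp_correct d20 w cm.
exists (ecodes (cexp d e) m); split=> //.
  by apply: steps_straight => //; apply: straight_cexp.
apply: corr_ext cm => i /orP[i21|ib]; apply: f; rewrite ?ib ?orbT //.
by rewrite (leq_trans i21).
Qed.

Lemma wfe_offset d e : wfe d e -> d.+1 < base -> wfe d (Plus e (Cst base)).
Proof. by move=> /= -> ->. Qed.

Lemma compile_for Z prog pos x b c m st beta : wfc (For x b c) ->
  (forall m st, corr Z m st -> (forall b, b < 6 -> vars st b = beta b) ->
    exists k m', [/\ k <= cost beta c, steps prog k (pos + 3, m) = Some (pos + 3 + csize c, m') &
      corr Z m' (sem Z c st)]) ->
  code_at prog pos (compile pos (For x b c)) -> corr Z m st ->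
  (forall b, b < 6 -> vars st b = beta b) ->
  exists k m', [/\ k <= cost beta (For x b c),
    steps prog k (pos, m) = Some (pos + csize (For x b c), m') &
    corr Z m' (sem Z (For x b c) st)].
Proof.
move=> w IH /code_at_cat[/code_at_cons[i0 /code_at_cons[i1 /code_at_cons[i2 _]]] /code_at_cat[_]].
rewrite size_compile => /code_at_cons[i3 /code_at_cons[i4 /code_at_cons[i5 _]]] cm bet.
rewrite /= addn3 in i3 i4 i5 IH.
have [x5 x20 b6 xc _] := and5P w; have wc : wfc c by case/and5P: w.
have bx : b != x by rewrite neq_ltn (leq_trans b6).
have bc := wfc_asg wc b6; rewrite /= in i3 i4 i5 IH *.
set N := vars st b; pose body st' := setv x (vars st' x).+1 (sem Z c st').
have NE : N = beta b by rewrite /N bet.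
pose s0 := setv x 0 st; pose m0 := upd m x 0.
have cm0 : corr Z m0 s0.
  by apply: (corr_setv cm x20); rewrite /m0 /upd ?eqxx // => i _ /negPf->.
have loop j : j <= N -> exists k m', [/\ k <= j * (cost beta c + 5),
    steps prog k (pos.+1, m0) = Some (pos.+1, m'), corr Z m' (iter j body s0),
    vars (iter j body s0) x = j & forall b, b < 6 -> vars (iter j body s0) b = beta b].
  elim: j => [|j IHj] jN.
    exists 0, m0; split=> //=; rewrite /upd ?eqxx // => y y6.
    by rewrite (negPf (_ : y != x)) ?bet // neq_ltn (leq_trans y6).
  have [k [m1 [lek st1 c1 xj bj]]] := IHj (ltnW jN); set sj := iter j body s0 in c1 xj bj *.
  have [_ hv _ _ _] := c1.
  pose m2 := upd m1 21 (m1 b - m1 x).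
  have m2_21 : m2 21 = N - j.
    by rewrite /m2 /upd /= !hv ?xj ?bj ?NE // (leq_trans b6).
  have c2 : corr Z m2 sj.
    apply: corr_ext c1 => i; rewrite /m2 /upd; case: eqP => // -> //.
  have [k' [m3 [lek' st3 c3]]] := IH m2 sj c2 bj.
  exists (k + (2 + (k' + 3))), (upd (upd m3 21 1) x (upd m3 21 1 x + upd m3 21 1 21)).
  have xN21 : (x == 21) = false by apply/negbTE; rewrite neq_ltn (leq_trans x20).
  split.
  - by rewrite mulSn [_ + j * _]addnC leq_add // addnCA leq_add.
  - apply: (steps_trans st1); rewrite /= i1 /= i2 -/m2 m2_21 subn_eq0 leqNgt jN /=.
    by apply: (steps_trans st3); rewrite /= i3 /= i4 /= i5.
  - have xs : vars (sem Z c sj) x = j by rewrite sem_vars.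
    rewrite iterS -/sj {1}/body xj; have [_ hv3 _ _ _] := c3.
    apply: (corr_setv c3 x20).
      by rewrite /upd eqxx xN21 hv3 ?xs // addn1.
    move=> i i21 ix; rewrite /upd (negPf ix); case: eqP => // ei.
    by rewrite ei in i21.
  - by rewrite iterS -/sj {1}/body /= /upd eqxx xj.
  - move=> y y6; have yx : y != x by rewrite neq_ltn (leq_trans y6).
    by rewrite iterS -/sj {1}/body /= /upd (negPf yx) sem_vars ?bj // wfc_asg.
have [k [m1 [lek st1 c1 xN bN]]] := loop N (leqnn _); have [_ hv _ _ _] := c1.
exists (1 + (k + 2)), (upd m1 21 (m1 b - m1 x)); split.
- by rewrite addnC -addnA leq_add // -NE.
- apply: (@steps_trans _ 1 _ _ (pos.+1, m0)); first by rewrite /= i0.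
  apply: (steps_trans st1); rewrite /= i1 /= i2 {1}/upd /=.
  by rewrite !hv ?xN ?bN ?NE ?subnn // (leq_trans b6).
by apply: corr_ext c1 => i; rewrite /upd; case: eqP => // -> //.
Qed.

Lemma compile_correct Z beta c prog pos m st : wfc c -> code_at prog pos (compile pos c) ->
  corr Z m st -> (forall b, b < 6 -> vars st b = beta b) ->
  exists k m', [/\ k <= cost beta c, steps prog k (pos, m) = Some (pos + csize c, m') &
    corr Z m' (sem Z c st)].
Proof.
elim: c pos m st => [x e|a e1 e2|x e|e1 e2|c1 IH1 c2 IH2|e c1 IH1 c2 IH2|x b c IH] pos m st w.
- have [x5 x20 we] := and3P w.
  rewrite [compile _ _]/= => code cm _; have [m1 [st1 v1 c1 _ code2]] := cexp_steps (isT : 20 < 21) we cm code.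
  have := steps_straight m1 code2 isT; set m2 := ecodes _ _ => st2.
  exists (size (cexp 21 e) + 2), m2; split=> //.
    by rewrite (steps_trans st1 st2) /= addnA.
  rewrite [sem _ _ _]/=.
  apply: (corr_setv c1 x20); rewrite /m2 /ecodes /= /upd ?eqxx.
    have -> : (21 == 22) = false by [].
    by rewrite v1 addn0.
  move=> i i21 /negPf->; case: eqP => // ei; by rewrite ei in i21.
- have [k8 w1 w2] := and3P w.
  rewrite [compile _ _]/= => code cm _.
  have [m1 [st1 v1 c1 _ code1]] := cexp_steps (isT : 20 < 21) w1 cm code.
  have [code2 code3] := code_at_cat (code1 : code_at _ _ (caddr 21 a ++ _)).
  have st2 := steps_straight m1 code2 isT; have [v2 f2] := ecodes_caddr a m1 (isT : 20 < 21).
  set m2 := ecodes _ m1 in st2 v2 f2.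
  have [Zb _ hZ _ _] := c1; rewrite hZ v1 in v2.
  have c2 : corr Z m2 st.
    apply: corr_ext c1 => i i21; rewrite f2 //; by apply: contraTneq i21 => ->.
  have [m3 [st3 v3 c3 f3 code4]] := cexp_steps (isT : 20 < 22) w2 c2 code3.
  have := steps_straight m3 code4 isT; set m4 := ecodes _ _ => st4.
  exists (csize (Put a e1 e2)), m4; split=> //.
    have := steps_trans (steps_trans (steps_trans st1 st2) st3) st4; rewrite -!addnA.
    exact.
  by rewrite /m4 /ecodes /= v3 f3 // v2; apply: corr_seta.
- have [x5 x20 we] := and3P w.
  rewrite [compile _ _]/= => code cm _.
  have [m1 [st1 v1 c1 _ code1]] := cexp_steps (isT : 20 < 21) (wfe_offset we isT) cm code.
  have [i1 /code_at_cons[i2 code2]] := code_at_cons code1.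
  have [_ _ hZ _ hr] := c1.
  have m1_21 : m1 21 = base + ev st e by rewrite v1 /= addnC.
  pose m2 := upd m1 22 (m1 20 - m1 21).
  have c2 : corr Z m2 st.
    by apply: corr_ext c1 => i i21; rewrite /m2 /upd; case: eqP => // ei; rewrite ei in i21.
  rewrite [sem _ _ _]/=; case: ltnP => rZ; last first.
    exists (size (cexp 21 (Plus e (Cst base))) + 2), m2; split=> //.
      by rewrite leq_add2l.
    apply: (steps_trans st1); rewrite /= i1 /= i2 {1}/upd /= hZ m1_21.
    by move: rZ; rewrite -subn_eq0 => ->; rewrite /m2 hZ m1_21.
  have := steps_straight m2 code2 isT; set m3 := ecodes _ _ => st3.
  exists (size (cexp 21 (Plus e (Cst base))) + 2 + 3), m3; split=> //.
      by rewrite -addnA.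
    have st2 : steps prog 2 (pos + size (cexp 21 (Plus e (Cst base))), m1) =
        Some ((pos + size (cexp 21 (Plus e (Cst base)))).+2, m2).
      rewrite /= i1 /= i2 {1}/upd /= hZ m1_21 subn_eq0 leqNgt rZ /=.
      by rewrite /m2 hZ m1_21.
    rewrite (steps_trans (steps_trans st1 st2) st3); congr (Some (_, _)).
    by rewrite -addn2 -!addnA.
  apply: (corr_setv c2 x20); rewrite /m3 /ecodes /= /upd ?eqxx /=.
    have [_ _ _ _ hr2] := c2.
    by rewrite addn0 (_ : m2 21 = base + ev st e) ?hr2 // /m2 /upd /= m1_21.
  move=> i i21 /negPf->; case: eqP => // ei; first by rewrite ei in i21.
  by case: eqP => // ei'; rewrite ei' in i21.
- have [w1 w2] := andP w.
  rewrite [compile _ _]/= => code cm _.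
  have [m1 [st1 v1 c1 _ code1]] := cexp_steps (isT : 20 < 21) (wfe_offset w1 isT) cm code.
  have [m2 [st2 v2 c2 f2 code2]] := cexp_steps (isT : 20 < 22) w2 c1 code1.
  have [i1 /code_at_cons[i2 /code_at_cons[i3 _]]] := code_at_cons code2.
  have m2_21 : m2 21 = base + ev st e1 by rewrite f2 // v1 /= addnC.
  pose m3 := upd m2 23 (m2 20 - m2 21).
  have c3 : corr Z m3 st.
    by apply: corr_ext c2 => i i21; rewrite /m3 /upd; case: eqP => // ei; rewrite ei in i21.
  have [_ _ hZ _ _] := c2.
  have := corr_setr (ev st e1) (ev st e2) c3; rewrite [sem _ _ _]/=.
  have st12 := steps_trans st1 st2.
  case: ltnP => rZ c4; last first.
    exists (size (cexp 21 (Plus e1 (Cst base))) + size (cexp 22 e2) + 2), m3; split=> //.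
      by rewrite -addnA !leq_add2l.
    apply: (steps_trans st12); rewrite /= i1 /= i2 {1}/upd /= hZ m2_21.
    by move: rZ; rewrite -subn_eq0 => ->; rewrite /m3 hZ m2_21.
  eexists (size (cexp 21 (Plus e1 (Cst base))) + size (cexp 22 e2) + 3), _; split; last exact: c4.
    by rewrite -addnA leqnn.
  rewrite (steps_add _ st12) /= i1 /= i2 {1}/upd /= hZ m2_21 subn_eq0 leqNgt rZ /= i3 /=.
  rewrite -[upd m2 23 _]/(upd m2 23 _) /upd /= m2_21 v2 /m3 hZ m2_21.
  by congr (Some (_, _)); rewrite -addn3 -!addnA.
- have [w1 w2] := andP w; move=> /code_at_cat[code1 code2] cm bet; rewrite size_compile in code2.
  have [k1 [m1 [l1 st1 cm1]]] := IH1 _ _ _ w1 code1 cm bet.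
  have bet1 b : b < 6 -> vars (sem Z c1 st) b = beta b.
    by move=> b6; rewrite sem_vars ?bet // wfc_asg.
  have [k2 [m2 [l2 st2 cm2]]] := IH2 _ _ _ w2 code2 cm1 bet1.
  exists (k1 + k2), m2; split=> //; first exact: leq_add.
  by rewrite (steps_trans st1 st2) /= addnA.
- have [we w1 w2] := and3P w; rewrite [compile _ _]/= => code cm bet.
  have [m1 [st1 v1 cm1 _ code1]] := cexp_steps (isT : 20 < 21) we cm code.
  have [i1 /code_at_cat[code2]] := code_at_cons code1.
  rewrite size_compile => /code_at_cons[i2 code3].
  rewrite [sem _ _ _]/=; case: ifP => e0.
    have [k2 [m2 [l2 st2 cm2]]] := IH2 _ _ _ w2 code3 cm1 bet.
    exists (size (cexp 21 e) + (1 + k2)), m2; split=> //.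
      by rewrite /= leq_add2l add1n ltnS ltnW // ltnS (leq_trans l2) // leq_addl.
    apply: (steps_trans st1); rewrite /= i1 v1 e0 st2 /=.
    by rewrite !addSn -!addnA !addnS.
  have [k2 [m2 [l2 st2 cm2]]] := IH1 _ _ _ w1 code2 cm1 bet.
  exists (size (cexp 21 e) + (1 + (k2 + 1))), m2; split=> //.
    by rewrite /= leq_add2l add1n addn1 !ltnS (leq_trans l2) // leq_addr.
  apply: (steps_trans st1); rewrite /= i1 v1 e0.
  by apply: (steps_trans st2); rewrite /= i2.
move=> code cm bet; apply: (compile_for w _ code cm bet) => m' st' cm' bet'.
have [x5 x20 b6 xc _] := and5P w; have wc : wfc c by case/and5P: w.
by apply: IH => //; move: code => /code_at_cat[_ /code_at_cat[]].
Qed.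

(** * Running time *)

Fixpoint degree (dg : nat -> nat) (c : cmd) : nat :=
  match c with
  | For x b c => dg b + degree dg c
  | Seq c1 c2 | If _ c1 c2 => maxn (degree dg c1) (degree dg c2)
  | _ => 0
  end.

(** [C] depends on the program alone, which makes the final constant uniform over all inputs. *)
Lemma cost_polynomial dg c : exists C, forall beta X, 0 < X -> (forall b, beta b <= X ^ dg b) ->
  cost beta c <= C * X ^ degree dg c.
Proof.
have mono C X a b : 0 < X -> C * X ^ a <= C * X ^ maxn a b.
  by move=> X0; rewrite leq_mul // leq_pexp2l // leq_maxl.
have monor C X a b : 0 < X -> C * X ^ a <= C * X ^ maxn b a by rewrite maxnC; apply: mono.
have one X a : 0 < X -> 0 < X ^ a by rewrite expn_gt0 => ->.
elim: c => [x e|a e1 e2|x e|e1 e2|c1 [C1 H1] c2 [C2 H2]|e c1 [C1 H1] c2 [C2 H2]|x b c [C H]].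
- by exists (csize (Asg x e)) => *; rewrite muln1.
- by exists (csize (Put a e1 e2)) => *; rewrite muln1.
- by exists (csize (Inp x e)) => *; rewrite muln1.
- by exists (csize (Out e1 e2)) => *; rewrite muln1.
- exists (C1 + C2) => beta X X0 hb /=; rewrite mulnDl leq_add //.
    exact: leq_trans (H1 _ _ X0 hb) (mono _ _ _ _ X0).
  exact: leq_trans (H2 _ _ X0 hb) (monor _ _ _ _ X0).
- exists (size (cexp 21 e) + (C1 + C2 + 2)) => beta X X0 hb /=; rewrite mulnDl leq_add //.
    by rewrite -{1}[size _]muln1 leq_mul // one.
  rewrite -addn2 mulnDl leq_add //; last by rewrite -[X in X <= _]muln1 leq_mul // one.
  rewrite mulnDl leq_add //; first exact: leq_trans (H1 _ _ X0 hb) (mono _ _ _ _ X0).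
  exact: leq_trans (H2 _ _ X0 hb) (monor _ _ _ _ X0).
exists (C + 5 + 3) => beta X X0 hb /=; rewrite mulnDl leq_add //; last first.
  by rewrite -[X in X <= _]muln1 leq_mul // one.
rewrite expnD mulnCA leq_mul // mulnDl leq_add //; first exact: H.
by rewrite -[X in X <= _]muln1 leq_mul // one.
Qed.

(** * Relocating the input and delivering the answer *)

Definition copies c k := flatten [seq [:: Add 2 2 4; Wr 2 c'] | c' <- iota c k].

(* Only cells 0 to 3 can be used at first: D = 2 * size es + 32 * n is computed in cell 3, it is
   beyond the input, and t and the cells 4 to 31 are saved at D, D + 4 to D + 31. *)
Definition prologue : seq instr :=
  [:: Add 3 3 3] ++ nseq 32 (Add 3 3 0) ++
  [:: Wr 3 2; Const 2 4; Add 2 2 3; Wr 2 4; Const 4 1] ++ copies 5 27 ++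
  [:: Rd 2 3; Const 4 32; Add 20 3 4; Add 4 0 0; Const 5 0; Add 5 5 3] ++
  nseq 32 (Defs.Sub 5 5 0).

(* The answer is cells 1 to n + 31, where cells 1 to 31 get values at least n, which denote no vertex. *)
Definition epilogue : seq instr :=
  Const 1 0 :: [seq Add r 0 1 | r <- iota 2 30] ++ [:: Const 1 31; Add 0 0 1; Add 1 0 1].

Lemma ecodes_nseq_add r a k m i : a != r ->
  ecodes (nseq k (Add r r a)) m i = if i == r then m r + k * m a else m i.
Proof.
move=> ar; elim: k m => [|k IH] m /=; first by case: eqP => [->|]; rewrite ?addn0.
rewrite IH /upd eqxx (negPf ar) mulSn addnA; by case: eqP.
Qed.

Lemma ecodes_nseq_sub r a k m i : a != r ->
  ecodes (nseq k (Defs.Sub r r a)) m i = if i == r then m r - k * m a else m i.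
Proof.
move=> ar; elim: k m => [|k IH] m /=; first by case: eqP => [->|]; rewrite ?subn0.
rewrite IH /upd eqxx (negPf ar) mulSn subnDA; by case: eqP.
Qed.

(** Cell 2 is the write address and cell 4 the constant 1. The address is raised before each write,
    so it starts one below [D + c]. *)
Lemma ecodes_copies D c k m : 4 < c -> c + k <= 32 -> 32 <= D ->
  m 2 = D + c - 1 -> m 4 = 1 ->
  let m' := ecodes (copies c k) m in
  [/\ forall i, i < 32 -> i != 2 -> m' i = m i,
      forall i, c <= i -> i < c + k -> m' (D + i) = m i &
      forall i, 32 <= i -> (i < D + c) || (D + c + k <= i) -> m' i = m i].
Proof.
elim: k c m => [|k IH] c m c4 ck D32 m2 m4 m'.
  by split=> // i ci; rewrite addn0 ltnNge ci.
pose m1 := upd (upd m 2 (D + c)) (D + c) (m c).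
have E : m' = ecodes (copies c.+1 k) m1.
  rewrite /m' /copies /= -/(copies c.+1 k) /ecodes /= -/(ecodes _ _); congr ecodes.
  have -> : m 2 + m 4 = D + c by rewrite m2 m4; lia.
  have -> : upd m 2 (D + c) 2 = D + c by [].
  by have -> : upd m 2 (D + c) c = m c by rewrite /upd; case: eqP => // ec; rewrite ec in c4.
have h1 i : i < 32 -> i != 2 -> m1 i = m i.
  move=> i32 i2; rewrite /m1 /upd (negPf i2); case: eqP => // ei; lia.
have h2 : m1 2 = D + c.+1 - 1.
  by rewrite /m1 /upd eqxx addnS subn1; case: eqP => //; lia.
have h4 : m1 4 = 1 by rewrite h1.
have ck' : c.+1 + k <= 32 by lia.
have [a1 a2 a3] := IH c.+1 m1 (ltnW c4) ck' D32 h2 h4.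
rewrite E; split.
- by move=> i i32 i2; rewrite a1 ?h1.
- move=> i ci ik; have [eci|nci] := eqVneq i c.
    subst i; rewrite a3; first by rewrite /m1 /upd eqxx.
      by lia.
    by apply/orP; left; lia.
  rewrite a2; [|by lia|by lia]; rewrite h1 //; last by apply/eqP; lia.
  lia.
- move=> i i32 ib; rewrite a3 // /m1 /upd; last by lia.
  by case: eqP => [ei|_]; [lia | case: eqP => [ei|//]; lia].
Qed.

Lemma nth_flatten_pairs (A : Type) (f g : A -> nat) x0 es j : j < size es ->
  nth 0 (flatten [seq [:: f p; g p] | p <- es]) (2 * j) = f (nth x0 es j) /\
  nth 0 (flatten [seq [:: f p; g p] | p <- es]) (2 * j).+1 = g (nth x0 es j).
Proof.
elim: es j => // p es IH [|j] jes; first by [].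
by rewrite mulnS; apply: IH.
Qed.

Lemma init_mem_edge n (s t : 'I_n) es j x0 : j < size es ->
  init_mem s t es (4 + 2 * j) = (nth x0 es j).1 /\
  init_mem s t es (5 + 2 * j) = (nth x0 es j).2.
Proof.
move=> jes; have [h1 h2] := nth_flatten_pairs (fun p => val p.1) (fun p => val p.2) x0 jes.
by rewrite -h1 -h2.
Qed.

Lemma init_mem_beyond n (s t : 'I_n) es i : 4 + 2 * size es <= i -> init_mem s t es i = 0.
Proof.
move=> h; rewrite /init_mem nth_default //= size_flatten /shape -map_comp.
rewrite (_ : sumn _ = 2 * size es) //; elim: (es) => //= p l ->.
by rewrite mulnS.
Qed.

(* What the program finds: word a of the input is in raw, possibly moved to D + a. *)
Record start n (s t : 'I_n) (es : seq ('I_n * 'I_n)) (Z D : nat) (st : store) : Prop := Start {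
  start_n : vars st 0 = n;
  start_s : vars st 1 = s;
  start_t : vars st 2 = t;
  start_D : vars st 3 = D;
  start_2n : vars st 4 = 2 * n;
  start_E : vars st 5 = 2 * size es;
  start_DE : D = 2 * size es + 32 * n;
  start_Z : Z = D + base;
  start_arrs : forall k i, arrs st k i = 0;
  start_low : forall a, 4 <= a -> a < base -> raw st (a + D - base) = init_mem s t es a;
  start_raw : forall a, base <= a -> a < D -> raw st (a - base) = init_mem s t es a }.

(** Since n is positive, D exceeds neither too little nor by accident: it is at least 32 and at
    least the length of the input, so the saved words overlap nothing. The cell of [size es] has
    been overwritten, and its double is recovered by subtracting n from D 32 times. *)
Lemma prologue_correct n (s t : 'I_n) es :
  exists D m st, [/\ ecodes prologue (init_mem s t es) = m, start s t es (D + base) D st &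
    corr (D + base) m st].
Proof.
set m0 := init_mem s t es.
pose D := 2 * size es + 32 * n; pose m := ecodes prologue m0.
pose st := Store m (fun _ _ => 0) (fun i => m (base + i)).
exists D, m, st; suff [h1 h2] : start s t es (D + base) D st /\ corr (D + base) m st by [].
have n0 : 0 < n by apply: leq_trans (ltn_ord s).
have DE : D = 2 * size es + 32 * n by []; clearbody D.
have D32 : 32 <= D by rewrite DE; lia.
have neq a b : a < b \/ b < a -> (a == b) = false by move=> h; apply/eqP; lia.
have [m1 e1 E1] : exists2 m1, ecodes (nseq 32 (Add 3 3 0)) (ecodes [:: Add 3 3 3] m0) = m1 &
    forall i, m1 i = if i == 3 then D else m0 i.
  eexists; first by [].
  move=> i; rewrite ecodes_nseq_add // /ecodes [foldl _ _ _]/= /upd eqxx.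
  by case: eqP => // _; rewrite DE addnn -mul2n.
have [m2 e2 E2] : exists2 m2,
    ecodes [:: Wr 3 2; Const 2 4; Add 2 2 3; Wr 2 4; Const 4 1] m1 = m2 &
    forall i, m2 i = if i == 4 then 1 else if i == D + 4 then m0 4 else if i == 2 then D + 4
    else if i == D then val t else m1 i.
  eexists; first by [].
  move=> i.
  have D3 : (3 == D) = false by apply/eqP; lia.
  have D4 : (4 == D) = false by apply/eqP; lia.
  have m13 : m1 3 = D by rewrite E1.
  have m12 : m1 2 = t by rewrite E1.
  have m14 : m1 4 = m0 4 by rewrite E1.
  rewrite /ecodes [foldl _ _ _]/= /upd m13 m12 /= D3 D4 m14 [4 + D]addnC.
  by case: (i == 4) => //; case: (i == 2).
have m22 : m2 2 = D + 5 - 1 by rewrite E2 /= (neq 2 (D + 4)); lia.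
have m24 : m2 4 = 1 by rewrite E2.
have := ecodes_copies (isT : 4 < 5) (isT : 5 + 27 <= 32) D32 m22 m24.
move e3 : (ecodes _ m2) => m3 [b1 b2 b3].
have small i : i < 32 -> i != 2 -> i != 4 -> m3 i = m1 i.
  move=> i32 i2 i4; rewrite b1 // E2 (negPf i2) (negPf i4).
  by rewrite (neq i (D + 4)) ?(neq i D) //; lia.
have m30 : m3 0 = n by rewrite small // E1.
have m31 : m3 1 = s by rewrite small // E1.
have m33 : m3 3 = D by rewrite small // E1.
have m3D : m3 D = t.
  rewrite b3 //; last by rewrite -[X in X < _]addn0 ltn_add2l.
  by rewrite E2 eqxx (neq D 4) ?(neq D (D + 4)) ?(neq D 2) //; lia.
have [m4 e4 E4] : exists2 m4,
    ecodes [:: Rd 2 3; Const 4 32; Add 20 3 4; Add 4 0 0; Const 5 0; Add 5 5 3] m3 = m4 &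
    forall i, m4 i = if i == 5 then D else if i == 4 then n + n else if i == 20 then D + 32
    else if i == 2 then val t else m3 i.
  eexists; first by [].
  move=> i; rewrite /ecodes [foldl _ _ _]/= /upd m30 m33 m3D /=.
  by case: (i == 5) => //; case: (i == 4).
have Em i : m i = if i == 5 then 2 * size es else m4 i.
  have -> : m = ecodes (nseq 32 (Defs.Sub 5 5 0)) m4.
    by rewrite /m /prologue 5!ecodes_cat e1 e2 e3 e4.
  rewrite ecodes_nseq_sub //; case: eqP => // _; rewrite !E4 [if 0 == 5 then _ else _]/= m30.
  by rewrite eqxx DE addnK.
clearbody m; have far i : 32 <= i -> m i = m3 i.
  by move=> i32; rewrite Em E4 (neq i 5) ?(neq i 4) ?(neq i 20) ?(neq i 2) //; lia.
have zero i : D + 32 <= i -> m i = 0.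
  move=> h; have i32 : 32 <= i by lia.
  have hb : D + 5 + 27 <= i by lia.
  rewrite far // b3 ?hb ?orbT // E2 E1 (neq i 4) ?(neq i (D + 4)) ?(neq i 2) ?(neq i D) ?(neq i 3); try lia.
  by apply: init_mem_beyond; lia.
rewrite /st {st}; split; last first.
  split=> //=; first by rewrite leq_addl.
    by rewrite Em E4.
  move=> k i k8; apply: zero; rewrite -addnA leq_addr //.
split=> //=.
- by rewrite Em E4 /= m30.
- by rewrite Em E4 /= m31.
- by rewrite Em E4.
- by rewrite Em E4 /= m33.
- by rewrite Em E4 /= mul2n addnn.
- rewrite /base => a a4 a32; rewrite subnKC; last by lia.
  rewrite far; last by lia.
  have [->|na4] := eqVneq a 4.
    rewrite b3; [|by lia|by apply/orP; left; lia].
    by rewrite addnC E2 eqxx (neq (D + 4) 4) //; lia.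
  rewrite addnC b2; [|by lia|by lia].
  by rewrite E2 E1 (neq a 4) ?(neq a (D + 4)) ?(neq a 2) ?(neq a D) ?(neq a 3) //; lia.
rewrite /base => a a32 aD; rewrite subnKC // far // b3 //; last by rewrite ltn_addr.
by rewrite E2 E1 (neq a 4) ?(neq a (D + 4)) ?(neq a 2) ?(neq a D) ?(neq a 3) //; lia.
Qed.

Lemma ecodes_fill l m i : all (fun r => 1 < r) l ->
  ecodes [seq Add r 0 1 | r <- l] m i = if i \in l then m 0 + m 1 else m i.
Proof.
elim: l m => //= r l IH m /andP[r1 al]; rewrite -/(ecodes _ _) IH // inE /upd.
have [-> ->] : (0 == r) = false /\ (1 == r) = false by case: r r1 => [|[|r]].
by case: (i \in l); rewrite ?orbT ?orbF.
Qed.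

Lemma epilogue_correct n m : m 0 = n ->
  let m' := ecodes epilogue m in
  [/\ m' 0 = n + 31, forall i, 0 < i < 32 -> n <= m' i & forall i, 32 <= i -> m' i = m i].
Proof.
move=> m0 m'.
have E i : m' i = if i == 1 then n + 31 + 31 else if i == 0 then n + 31 else
    if i \in iota 2 30 then n else m i.
  rewrite /m' /epilogue -cat1s 2!ecodes_cat; set m1 := ecodes [:: _] m.
  have [h0 h1] : m1 0 = n /\ m1 1 = 0 by [].
  have E1 j : ecodes [seq Add r 0 1 | r <- iota 2 30] m1 j = if j \in iota 2 30 then n else m1 j.
    by rewrite ecodes_fill // h0 h1 addn0.
  move: (ecodes _ m1) E1 => m2 E1.
  rewrite /ecodes [foldl _ _ _]/= /upd !E1 /= h0.
  case: eqP => // i1; case: eqP => // i0; case: ifP => // _.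
  by rewrite /m1 /ecodes /= /upd; case: eqP.
split; first by rewrite E.
- move=> i /andP[i0 i32]; rewrite E mem_iota i32 andbT.
  case: eqP => [_|/eqP i1]; first by rewrite -addnA leq_addr.
  rewrite eqn0Ngt i0 /= ifT //; by rewrite ltn_neqAle eq_sym i1.
move=> i i32; rewrite E.
have -> : i \in iota 2 30 = false by rewrite mem_iota; lia.
by case: i i32 => [|[|i]].
Qed.

(** Cell 32 + v answers for the vertex v, where the value n denotes no vertex. The output also
    ranges over cells 1 to 31, which therefore must not name vertices. *)
Lemma output_set_spec n mf (T : {set 'I_n}) : mf 0 = n + 31 ->
  (forall i, 0 < i < 32 -> n <= mf i) ->
  (forall v : 'I_n, mf (32 + v) = if v \in T then val v else n) -> output_set n mf = T.
Proof.
move=> m0 junk out; apply/setP => v; rewrite inE; apply/existsP/idP => [[[i /= il] /eqP mv]|vT].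
  have [i32|i32] := ltnP i.+1 32.
    by have := junk i.+1 i32; rewrite mv leqNgt ltn_ord.
  have jn : i.+1 - 32 < n by rewrite ltn_subLR // -(addn1 31) addnAC addn1 addnC -m0.
  have := out (Ordinal jn); rewrite /= subnKC // mv; case: ifP => [uT vu|_ vn].
    by rewrite (_ : v = Ordinal jn) //; apply: val_inj.
  by have := ltn_ord v; rewrite vn ltnn.
have jl : 31 + v < mf 0 by rewrite m0 addnC ltn_add2r.
by exists (Ordinal jl); rewrite /= -addSn out vT.
Qed.

(** Variables 3 and 5 hold D and twice the number of edges, which are quadratic as the edge list has
    no repetition; the other parameters are linear. All are bounded by the matching power of 33 n,
    because 2 n^2 + 32 n is at most its square. *)
Lemma machine_correct (main : cmd) :
  wfc main ->
  let dg b := if (b == 3) || (b == 5) then 2 else 1 in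
  degree dg main <= 2 ->
  exists c, forall n (e : rel 'I_n) (s t : 'I_n) es, edge_list e es ->
  exists mf st Z D, [/\
    run (prologue ++ compile (size prologue) main ++ epilogue) (c * n ^ 2 + c)
      (0, init_mem s t es) = Some mf,
    start s t es Z D st &
    forall T : {set 'I_n}, (forall v : 'I_n, raw (sem Z main st) v = if v \in T then val v else n) ->
      output_set n mf = T].
Proof.
move=> wm dg deg2; have [C hC] := cost_polynomial dg main.
exists (C * 33 ^ 2 + (size prologue + size epilogue)) => n e s t es el.
have n0 : 0 < n by apply: leq_trans (ltn_ord s).
have esn : size es <= n ^ 2.
  case: el => ues _; have := max_card (mem es); rewrite (card_uniqP ues).
  by rewrite card_prod card_ord -mulnn.
have [D [m1 [st [em1 start_st cm]]]] := prologue_correct s t es.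
set prog := prologue ++ _.
have code : code_at prog 0 prog by move=> i _; rewrite add0n.
have [code1] := code_at_cat code; rewrite add0n => /code_at_cat[code2 code3].
rewrite size_compile in code3.
have st1 : steps prog (size prologue) (0, init_mem s t es) = Some (size prologue, m1).
  by rewrite (steps_straight _ code1 (erefl : all straight prologue)) add0n em1.
pose beta b := if b < 6 then vars st b else 0.
have bE b : b < 6 -> vars st b = beta b by rewrite /beta => ->.
have [k [m2 [lek st2 cm2]]] := compile_correct wm code2 cm bE.
have st3 := steps_straight m2 code3 (erefl : all straight epilogue).
have [_ hv _ _ hr] := cm2; case: (start_st) => v0 v1 v2 v3 v4 v5 DE ZE _ _ _.
have m20 : m2 0 = n by rewrite (hv 0 isT) (sem_vars _ _ (@wfc_asg main 0 wm isT)).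
have [f0 f1 f2] := epilogue_correct m20; set mf := ecodes epilogue m2 in f0 f1 f2 st3.
exists mf, st, (D + base), D; split; [|exact: start_st|].
  have := steps_trans st1 (steps_trans st2 st3) => st4.
  apply: (steps_run st4).
    have hs : size prog = size prologue + csize main + size epilogue.
      by rewrite /prog size_cat size_cat size_compile addnA.
    rewrite /step nth_default; first by [].
    by rewrite hs; apply: leqnn.
  have bX b : beta b <= (33 * n) ^ dg b.
    have sq : 2 * n ^ 2 + 32 * n <= (33 * n) ^ 2.
      by rewrite expnMn -!mulnn; nia.
    have sn := ltn_ord s; have tn := ltn_ord t.
    rewrite /beta /dg; case: b => [|[|[|[|[|[|b]]]]]] /=; rewrite ?expn1 ?v0 ?v1 ?v2 ?v4.
    - exact: leq_pmull.
    - apply: leq_trans (ltnW sn) _; exact: leq_pmull.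
    - apply: leq_trans (ltnW tn) _; exact: leq_pmull.
    - by rewrite v3 DE; apply: leq_trans sq; rewrite leq_add2r leq_mul2l esn.
    - by rewrite leq_mul2r orbT.
    - rewrite v5; apply: leq_trans sq; apply: leq_trans (leq_addr _ _).
      by rewrite leq_mul2l esn.
    exact: leq0n.
  have X0 : 0 < 33 * n by rewrite muln_gt0.
  have lekX : k <= C * 33 ^ 2 * n ^ 2.
    apply: leq_trans lek _; apply: leq_trans (hC _ _ X0 bX) _.
    by rewrite -mulnA -expnMn leq_mul2l leq_pexp2l ?orbT.
  move: (size prologue) (size epilogue) (C * 33 ^ 2) lekX => P E K kK.
  by rewrite addnCA mulnDl -addnA; apply: leq_add kK _; rewrite addnA leq_addl.
move=> T rT; apply: (output_set_spec f0 f1) => v; rewrite f2; last exact: leq_addr.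
rewrite (hr v); first exact: rT.
rewrite addnC ltn_add2r DE; apply: leq_trans (ltn_ord v) _.
by apply: leq_trans (leq_addl _ _); apply: leq_pmull.
Qed.

(** * The algorithm *)

Arguments sem : simpl never.

Notation "c1 ;; c2" := (Seq c1 c2) (at level 60, right associativity).
Notation skip := (Asg 19 (Cst 0)).

Lemma sem_seq Z c1 c2 st : sem Z (c1 ;; c2) st = sem Z c2 (sem Z c1 st).
Proof. by []. Qed.

Lemma sem_asg Z x e st : sem Z (Asg x e) st = setv x (ev st e) st.
Proof. by []. Qed.

Lemma sem_put Z k e1 e2 st : sem Z (Put k e1 e2) st = seta k (ev st e1) (ev st e2) st.
Proof. by []. Qed.

Lemma sem_inp Z x e st : sem Z (Inp x e) st =
  if base + ev st e < Z then setv x (raw st (ev st e)) st else st.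
Proof. by []. Qed.

Lemma sem_out Z e1 e2 st : sem Z (Out e1 e2) st = setr (ev st e1) (ev st e2) st.
Proof. by []. Qed.

Lemma sem_if Z e c1 c2 st :
  sem Z (If e c1 c2) st = if ev st e == 0 then sem Z c2 st else sem Z c1 st.
Proof. by []. Qed.

Definition semE := (sem_seq, sem_asg, sem_put, sem_out, sem_if).

(* Array 0 holds the offsets u * n of the rows of the adjacency matrix, which is array 1. *)
Definition Adj (u v : exp) := Arr 1 (Plus (Arr 0 u) v).
Definition SetAdj (u v : exp) k := Put 1 (Plus (Arr 0 u) v) (Cst k).

Record ctx n (s t : 'I_n) (g : rel 'I_n) (st : store) : Prop := Ctx {
  ctx_n : vars st 0 = n;
  ctx_s : vars st 1 = s;
  ctx_t : vars st 2 = t;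
  ctx_2n : vars st 4 = 2 * n;
  ctx_row : forall u : 'I_n, arrs st 0 u = u * n;
  ctx_adj : forall u v : 'I_n, arrs st 1 (u * n + v) = g u v :> nat }.

(** * Adjacency matrix and reading of the input *)

Lemma ctx_ext n (s t : 'I_n) g st st' : ctx s t g st ->
  (forall x, x < 6 -> vars st' x = vars st x) ->
  arrs st' 0 = arrs st 0 -> arrs st' 1 = arrs st 1 -> ctx s t g st'.
Proof. by case=> h0 h1 h2 h4 hr ha hv e0 e1; split; rewrite ?hv // ?e0 ?e1. Qed.

Lemma ctx_sem n (s t : 'I_n) g Z c st : ctx s t g st -> wfc c ->
  0 \notin puts c -> 1 \notin puts c -> ctx s t g (sem Z c st).
Proof.
move=> C wc p0 p1; apply: (ctx_ext C); rewrite ?sem_arrs // => x x6.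
by rewrite sem_vars // wfc_asg.
Qed.

Lemma ctx_setv n (s t : 'I_n) g x k st : ctx s t g st -> 5 < x -> ctx s t g (setv x k st).
Proof.
move=> C x6; apply: (ctx_ext C) => // y y6; rewrite /= /upd.
by case: eqP => // e; subst y; move: x6; rewrite ltnNge -ltnS y6.
Qed.

Lemma ctx_seta n (s t : 'I_n) g k i v st : ctx s t g st -> 1 < k -> ctx s t g (seta k i v st).
Proof. by move=> C; case: k => [|[|k]] // _; apply: (ctx_ext C). Qed.

Lemma ev_adj n (s t : 'I_n) g st (u v : 'I_n) eu e' : ctx s t g st -> ev st eu = u -> ev st e' = v ->
  ev st (Adj eu e') = g u v.
Proof. by move=> C hu hv; rewrite /= hu hv (ctx_row C) (ctx_adj C). Qed.

Lemma row_inj n (u v u' v' : 'I_n) : (u * n + v == u' * n + v') = (u == u') && (v == v').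
Proof.
have n0 : 0 < n by apply: leq_trans (ltn_ord u).
apply/eqP/andP => [h|[/eqP-> /eqP->]//]; split; apply/eqP/val_inj.
  by have /= := congr1 (divn^~ n) h; rewrite !divnMDl // !divn_small // !addn0.
by have /= := congr1 (modn^~ n) h; rewrite !modnMDl !modn_small.
Qed.

Lemma ctx_eq n (s t : 'I_n) g g' st : g =2 g' -> ctx s t g st -> ctx s t g' st.
Proof. by move=> h [h0 h1 h2 h4 hr ha]; split=> // u v; rewrite -h ha. Qed.

Lemma ctx_setadj n (s t : 'I_n) g Z st (u v : 'I_n) eu e' (b : bool) : ctx s t g st ->
  ev st eu = u -> ev st e' = v ->
  ctx s t (fun x y => if (x == u) && (y == v) then b else g x y) (sem Z (SetAdj eu e' b) st).
Proof.
move=> C hu hv; rewrite /SetAdj sem_put /= hu hv (ctx_row C).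
case: C => h0 h1 h2 h4 hr ha; split=> //= x y; rewrite /upd row_inj.
by case: ifP.
Qed.

Definition build_rows := Asg 7 (Cst 0) ;; For 6 0 (Put 0 (Var 6) (Var 7) ;; Asg 7 (Plus (Var 7) (Var 0))).

Lemma build_rows_correct n Z st : vars st 0 = n ->
  forall u : 'I_n, arrs (sem Z build_rows st) 0 u = u * n.
Proof.
move=> v0; rewrite /build_rows semE; set st1 := sem Z _ st.
have v1 : vars st1 0 = n by [].
pose I i st' := [/\ vars st' 7 = i * n, vars st' 0 = n & forall u, u < i -> arrs st' 0 u = u * n].
have [] : I n (sem Z (For 6 0 (Put 0 (Var 6) (Var 7) ;; Asg 7 (Plus (Var 7) (Var 0)))) st1).
  rewrite -{1}v1; apply: sem_for => //.
  move=> i st' _ vi [h7 h0 hu]; rewrite !semE; split=> /=; rewrite /upd /= ?h7 ?h0 ?vi ?mulSn //.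
    by rewrite addnC.
  move=> u; rewrite ltnS leq_eqVlt; case: eqP => [->//|_] /=; exact: hu.
by move=> _ _ h u; apply: h.
Qed.

(** Variable 7 is the address of the first word of an edge. Words below 32 were saved D cells
    further on, and [raw] starts at cell 32, hence the two shifts. *)
Definition read_edge :=
  Asg 7 (Plus (Cst 4) (Plus (Var 6) (Var 6))) ;;
  If (Minus (Cst base) (Var 7)) (Asg 7 (Plus (Var 7) (Var 3))) skip ;;
  Inp 8 (Minus (Var 7) (Cst base)) ;;
  Inp 9 (Minus (Plus (Var 7) (Cst 1)) (Cst base)) ;;
  SetAdj (Var 8) (Var 9) 1 ;;
  SetAdj (Var 9) (Var 8) 1.

(** Only parameters may bound loops, and variable 5 is twice the number of edges; the second half of
    the rounds does nothing. *)
Definition read_edges :=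
  For 6 5 (If (Minus (Var 5) (Plus (Var 6) (Var 6))) read_edge skip).

Lemma read_edges_correct n (e : rel 'I_n) (s t : 'I_n) es Z D st st0 : edge_list e es ->
  start s t es Z D st0 -> ctx s t (fun _ _ => false) st ->
  raw st = raw st0 -> vars st 3 = D -> vars st 5 = 2 * size es ->
  ctx s t e (sem Z read_edges st).
Proof.
move=> [_ ees] S C rs v3 v5.
pose gr i u v := ((u, v) \in take i es) || ((v, u) \in take i es).
pose I i st' := [/\ ctx s t (gr i) st', raw st' = raw st0, vars st' 3 = D & vars st' 5 = 2 * size es].
have [] : I (2 * size es) (sem Z read_edges st); last first.
  move=> C' _ _ _; apply: ctx_eq C' => u v; rewrite /gr ees.
  by rewrite take_oversize // mul2n -addnn leq_addr.
rewrite -{1}v5; apply: sem_for => //.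
  by split=> //; apply: ctx_setv => //; apply: ctx_eq C => u v; rewrite /gr take0.
move=> i st' i2 vi [C' r' v3' v5'].
suff [h1 h2 h3 h4] : I i.+1 (sem Z (If (Minus (Var 5) (Plus (Var 6) (Var 6))) read_edge skip) st').
  by split=> //; apply: ctx_setv.
rewrite sem_if /= vi v5' addnn -mul2n -mulnBr muln_eq0 /= subn_eq0.
case: leqP => isz.
  rewrite semE; split=> //; apply: ctx_setv => //; apply: ctx_eq C' => u v.
  by rewrite /gr !take_oversize // (leq_trans isz).
split; last 3 first.
- by rewrite sem_raw.
- by rewrite sem_vars.
- by rewrite sem_vars.
have [es0 _] : exists p, p \in es by case: (es) isz => // p l _; exists p; rewrite mem_head.
have [ea eb] := init_mem_edge s t es0 isz; set p := nth es0 es i in ea eb.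
rewrite /read_edge !(sem_seq, sem_asg) sem_if.
set st1 := setv 7 _ st'; have C1 : ctx s t (gr i) st1 by apply: ctx_setv.
have a1 : vars st1 7 = 4 + 2 * i by rewrite /= /upd /= vi mul2n -addnn.
have r1 : raw st1 = raw st0 by [].
have d1 : vars st1 3 = D by [].
clearbody st1; set st2 := if _ then _ else _.
have [C2 [a [r2 v2 ra rb aZ]]] : ctx s t (gr i) st2 /\ exists a, [/\ raw st2 = raw st0, vars st2 7 = a,
    raw st0 (a - base) = p.1, raw st0 (a + 1 - base) = p.2 & base + (a + 1 - base) < Z].
  rewrite /st2 [ev _ _]/= a1; case: S => _ _ _ _ _ _ DE -> _ low high.
  have a_D : 5 + 2 * i < D.
    rewrite DE; apply: leq_trans (_ : 2 * size es + 32 <= _).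
      by move: isz; rewrite -(leq_pmul2l (isT : 0 < 2)) mulnS; lia.
    by rewrite leq_add2l leq_pmulr // (leq_trans _ (ltn_ord s)).
  (* The address is even, so both words of an edge lie on the same side of 32. *)
  case: eqP => a32; rewrite sem_asg.
    split; first exact: ctx_setv.
    exists (4 + 2 * i); have a32' : base <= 4 + 2 * i by apply/eqP.
    split=> //; first by rewrite high // ltnW.
      by rewrite -addnA [2 * i + 1]addnC addnA high // leqW.
    by rewrite /base in a32' a_D *; lia.
  split; first exact: ctx_setv.
  exists (4 + 2 * i + D); have a32' : 4 + 2 * i < 32 by rewrite /base in a32; lia.
  split=> //; first by rewrite /= /upd /= a1 d1.
  - by rewrite low.
  - rewrite (_ : 4 + 2 * i + D + 1 = 5 + 2 * i + D); last by lia.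
    by rewrite low // /base; lia.
  by rewrite /base in a_D *; lia.
clearbody st2.
have -> : sem Z (Inp 8 (Minus (Var 7) (Cst base))) st2 = setv 8 p.1 st2.
  rewrite sem_inp /= v2 r2 ra ifT //.
  by apply: leq_ltn_trans aZ; rewrite leq_add2l leq_sub2r // leq_addr.
have -> : sem Z (Inp 9 (Minus (Plus (Var 7) (Cst 1)) (Cst base))) (setv 8 p.1 st2) =
    setv 9 p.2 (setv 8 p.1 st2).
  by rewrite sem_inp /= /upd /= v2 r2 rb aZ.
set st4 := setv 9 _ _.
have C4 : ctx s t (gr i) st4 by apply: ctx_setv => //; apply: ctx_setv.
have h8 : ev st4 (Var 8) = p.1 by [].
have h9 : ev st4 (Var 9) = p.2 by [].
have C5 := ctx_setadj Z true C4 h8 h9.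
have h8' : ev (sem Z (SetAdj (Var 8) (Var 9) true) st4) (Var 8) = p.1 by [].
have h9' : ev (sem Z (SetAdj (Var 8) (Var 9) true) st4) (Var 9) = p.2 by [].
have C6 := ctx_setadj Z true C5 h9' h8'.
apply: ctx_eq C6 => u v; rewrite /gr (take_nth es0) // -/p !mem_rcons !inE.
have pE x y : ((x, y) == p) = (x == p.1) && (y == p.2) by case: (p).
rewrite !pE [(v == p.1) && _]andbC.
by case: ((u == p.2) && _); case: ((u == p.1) && _); rewrite /= ?orbT.
Qed.

(** * Depth-first search on the machine *)

Definition find_unvisited :=
  Asg 9 (Var 0) ;;
  For 10 0 (If (Adj (Var 7) (Var 10)) (If (Arr 2 (Var 10)) skip (Asg 9 (Var 10))) skip).

Lemma find_unvisited_correct n (s t : 'I_n) g Z st (cur : 'I_n) : ctx s t g st -> vars st 7 = cur ->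
  let x := vars (sem Z find_unvisited st) 9 in
  (x = n /\ forall u, g cur u -> 0 < arrs st 2 u) \/
  (exists u : 'I_n, [/\ x = u, g cur u & arrs st 2 u = 0]).
Proof.
move=> C v7; rewrite /find_unvisited sem_seq sem_asg /=.
pose I i st' := [/\ ctx s t g st', vars st' 7 = cur, arrs st' 2 = arrs st 2 &
  (vars st' 9 = n /\ forall u : 'I_n, u < i -> g cur u -> 0 < arrs st 2 u) \/
  (exists u : 'I_n, [/\ vars st' 9 = u, g cur u & arrs st 2 u = 0])].
set st1 := setv 9 _ st; have C1 : ctx s t g st1 by apply: ctx_setv.
have v1 : vars st1 0 = n by rewrite (ctx_n C1).
set c := For _ _ _; suff [_ _ _ [[h1 h2]|h]] : I n (sem Z c st1).
- by left; split=> // u; apply: h2.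
- by right.
rewrite -{1}v1; apply: sem_for => //.
  by split=> //; [apply: ctx_setv | left; split=> //; apply: (ctx_n C)].
move=> i st'; rewrite v1 => iv vi [C' v7' a2 h]; pose v := Ordinal iv.
have adj : ev st' (Adj (Var 7) (Var 10)) = g cur v by apply: (ev_adj C').
suff [h1 h2 h3 h4] : I i.+1 (sem Z (If (Adj (Var 7) (Var 10))
    (If (Arr 2 (Var 10)) skip (Asg 9 (Var 10))) skip) st').
  by split=> //; apply: ctx_setv.
split; [exact: ctx_sem | by rewrite sem_vars | by rewrite sem_arrs | ].
rewrite sem_if adj; case gv: (g cur v); last first.
  case: h => [[h1 h2]|h]; [left|by right]; split=> // u; rewrite ltnS leq_eqVlt.
  by case/orP => [/eqP eu|]; [rewrite (_ : u = v) ?gv //; apply: val_inj | apply: h2].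
rewrite sem_if /= vi a2; case: eqP => dv; last first.
  case: h => [[h1 h2]|h]; [left|by right]; split=> // u; rewrite ltnS leq_eqVlt.
  case/orP => [/eqP eu _|]; last exact: h2.
  by rewrite lt0n eu; apply/eqP.
by right; exists v; rewrite semE /= vi.
Qed.

(** Array 2 holds discovery times, array 3 parents, array 4 the vertex of each time. The value n in
    variable 9 means that no neighbour is unvisited, and then the search steps back. *)
Definition dfs_step :=
  find_unvisited ;;
  If (Minus (Var 0) (Var 9))
    (Put 3 (Var 9) (Var 7) ;; Asg 6 (Plus (Var 6) (Cst 1)) ;; Put 2 (Var 9) (Var 6) ;;
     Put 4 (Var 6) (Var 9) ;; Asg 7 (Var 9))
    (Asg 7 (Arr 3 (Var 7))).

Definition search :=
  Put 2 (Var 1) (Cst 1) ;; Put 3 (Var 1) (Var 1) ;; Put 4 (Cst 1) (Var 1) ;;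
  Asg 6 (Cst 1) ;; Asg 7 (Var 1) ;; For 8 4 dfs_step.

Record searched n (s t : 'I_n) e (d : 'I_n -> nat) (p : 'I_n -> 'I_n) cnt cur i st : Prop := Searched {
  searched_ctx : ctx s t e st;
  searched_dfs : dfs_state e s d p cnt cur i;
  searched_d : forall v : 'I_n, arrs st 2 v = d v;
  searched_p : forall v : 'I_n, 0 < d v -> arrs st 3 v = p v;
  searched_ord : forall v : 'I_n, 0 < d v -> arrs st 4 (d v) = v;
  searched_cnt : vars st 6 = cnt;
  searched_cur : vars st 7 = cur }.

Lemma dfs_step_correct n (s t : 'I_n) e Z d p cnt cur i st :
  symmetric e -> irreflexive e -> searched s t e d p cnt cur i st ->
  exists d' p' cnt' cur', searched s t e d' p' cnt' cur' i.+1 (sem Z dfs_step st).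
Proof.
move=> se ie [C D hd hp ho h6 h7].
have := find_unvisited_correct Z C h7; rewrite /dfs_step sem_seq.
set st1 := sem Z find_unvisited st.
have C1 : ctx s t e st1 by apply: ctx_sem.
have e2 : arrs st1 2 = arrs st 2 by rewrite sem_arrs.
have e3 : arrs st1 3 = arrs st 3 by rewrite sem_arrs.
have e4 : arrs st1 4 = arrs st 4 by rewrite sem_arrs.
have e6 : vars st1 6 = cnt by rewrite sem_vars.
have e7 : vars st1 7 = cur by rewrite sem_vars.
rewrite sem_if [ev _ _]/= (ctx_n C1).
move: st1 C1 e2 e3 e4 e6 e7 => st1 C1 e2 e3 e4 e6 e7.
case=> [[-> vis]|[f [e9 ef df]]].
  rewrite subnn eqxx semE; exists d, p, cnt, (p cur); split=> //=.
  - exact: ctx_setv.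
  - by apply: dfs_pop => // f /vis; rewrite hd.
  - by rewrite e2.
  - by rewrite e3.
  - by rewrite e4.
  - by rewrite /upd /= e7 e3 hp // (dfs_cur D).
rewrite e9 subn_eq0 leqNgt ltn_ord /=.
rewrite hd in df; have D' := dfs_push se ie D ef df.
have cf (v : 'I_n) : 0 < d v -> (val v == val f) = false.
  by move=> dv; apply: contraTF dv => /eqP/val_inj->; rewrite df.
do 4!eexists; split; [|exact: D'|..]; rewrite !semE /= /upd /= ?e9.
- by do ![apply: ctx_setv => // | apply: ctx_seta => //].
- by move=> v; rewrite e2 e6 addn1 (inj_eq (@ord_inj n)) hd.
- move=> v; rewrite (inj_eq (@ord_inj n)) e3 e7; case: eqP => // _ dv; exact: hp.
- move=> v; rewrite e4 e6 addn1; case: eqP => [->|vf dv]; first by rewrite eqxx.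
  rewrite ltn_eqF ?ltnS ?(dfs_le D) //; exact: ho.
- by rewrite e6 addn1.
- by [].
Qed.

Lemma search_correct n (s t : 'I_n) e Z st : symmetric e -> irreflexive e -> ctx s t e st ->
  (forall v, arrs st 2 v = 0) ->
  exists d p cnt cur, searched s t e d p cnt cur (n + n) (sem Z search st).
Proof.
move=> se ie C a2; rewrite /search !sem_seq !semE /=.
set st1 := setv 7 _ _.
have C1 : ctx s t e st1 by do ![apply: ctx_setv => // | apply: ctx_seta => //].
pose I i st' := exists d p cnt cur, searched s t e d p cnt cur i st'.
set c := For _ _ _; suff : I (n + n) (sem Z c st1) by [].
have v4 : vars st1 4 = n + n by rewrite (ctx_2n C1) mul2n addnn.
rewrite -{1}v4; apply: sem_for => //.
  exists (fun v => v == s : nat), (fun=> s), 1, s; split.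
  - exact: ctx_setv.
  - exact: dfs_init.
  - by move=> v; rewrite /= /upd /= (ctx_s C) (inj_eq (@ord_inj n)) a2; case: eqP.
  - by move=> v; rewrite /= /upd /= (ctx_s C) (inj_eq (@ord_inj n)); case: eqP.
  - by move=> v; rewrite /= /upd /= (ctx_s C); case: eqP => // ->.
  - by [].
  - by rewrite /= /upd /= (ctx_s C).
move=> i st' _ _ [d [p [cnt [cur S]]]].
have [d' [p' [cnt' [cur' [C' D' hd hp ho h6 h7]]]]] := dfs_step_correct Z se ie S.
exists d', p', cnt', cur'; split=> //; exact: ctx_setv.
Qed.

Lemma searched_ext n (s t : 'I_n) e d p cnt cur i st st' : searched s t e d p cnt cur i st ->
  ctx s t e st' -> (forall k, k < 5 -> arrs st' k = arrs st k) ->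
  vars st' 6 = vars st 6 -> vars st' 7 = vars st 7 -> searched s t e d p cnt cur i st'.
Proof.
case=> C D hd hp ho h6 h7 C' ha h6' h7'; split=> //; rewrite ?h6' ?h7' //.
- by move=> v; rewrite ha.
- by move=> v dv; rewrite ha // hp.
- by move=> v dv; rewrite ha // ho.
Qed.

Lemma searched_sem n (s t : 'I_n) e d p cnt cur i Z c st : searched s t e d p cnt cur i st ->
  wfc c -> all (fun k => 4 < k) (puts c) -> all (fun x => 7 < x) (asg c) ->
  searched s t e d p cnt cur i (sem Z c st).
Proof.
move=> S wc /allP ac /allP xc; have np k : k < 5 -> k \notin puts c.
  by move=> k5; apply/negP => /ac; rewrite ltnNge -ltnS k5.
apply: (searched_ext S).
- by apply: ctx_sem => //; [apply: searched_ctx S | apply: np | apply: np].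
- by move=> k k5; rewrite sem_arrs ?np.
- by rewrite sem_vars //; apply/negP => /xc.
- by rewrite sem_vars //; apply/negP => /xc.
Qed.

Lemma searched_setv n (s t : 'I_n) e d p cnt cur i x k st :
  searched s t e d p cnt cur i st -> 7 < x -> searched s t e d p cnt cur i (setv x k st).
Proof.
move=> S x7; apply: (searched_ext S) => //; first by apply: ctx_setv; [apply: searched_ctx S | lia].
  by rewrite /= /upd; case: eqP => // ex; rewrite -ex in x7.
by rewrite /= /upd; case: eqP => // ex; rewrite -ex in x7.
Qed.

Lemma searched_seta n (s t : 'I_n) e d p cnt cur i k j v st :
  searched s t e d p cnt cur i st -> 4 < k -> searched s t e d p cnt cur i (seta k j v st).
Proof.
move=> S k4; apply: (searched_ext S) => //; first by apply: ctx_seta; [apply: searched_ctx S | lia].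
by move=> k' k5 /=; case: eqP => // ek; lia.
Qed.

(** * Low points on the machine *)

Definition scan_low :=
  For 12 0 (If (Adj (Var 10) (Var 12))
    (If (Minus (Var 11) (Arr 2 (Var 12))) (Asg 11 (Arr 2 (Var 12))) skip) skip).

Lemma scan_low_correct n (s t : 'I_n) e d p cnt cur j Z st (v : 'I_n) :
  searched s t e d p cnt cur j st -> vars st 10 = v ->
  let x := vars (sem Z scan_low st) 11 in
  [/\ x <= vars st 11, forall u, e v u -> x <= d u &
    x = vars st 11 \/ exists2 u, e v u & x = d u].
Proof.
move=> S v10; pose I i st' := [/\ searched s t e d p cnt cur j st', vars st' 10 = v,
  vars st' 11 <= vars st 11,
  forall u : 'I_n, u < i -> e v u -> vars st' 11 <= d u &
  vars st' 11 = vars st 11 \/ exists2 u, e v u & vars st' 11 = d u].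
have v0 := ctx_n (searched_ctx S).
suff [_ _ h1 h2 h3] : I n (sem Z scan_low st) by split=> // u; apply: h2.
rewrite -{1}v0; apply: sem_for => //.
  by split=> //; [apply: searched_setv | left].
move=> i st'; rewrite v0 => iv vi [S' v10' le11 h att]; pose w := Ordinal iv.
set c := If _ _ _; suff [h1 h2 h3 h4 h5] : I i.+1 (sem Z c st').
  by split=> //; apply: searched_setv.
have adj : ev st' (Adj (Var 10) (Var 12)) = e v w by apply: (ev_adj (searched_ctx S')).
have dw : arrs st' 2 i = d w by rewrite -(searched_d S').
have hS (u : 'I_n) : u < i.+1 -> u = w \/ u < i.
  by rewrite ltnS leq_eqVlt => /orP[/eqP eu|->]; [left; apply: val_inj | right].
split; [exact: searched_sem | by rewrite sem_vars | ..]; rewrite /c sem_if adj.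
- case: (e v w) => //=; rewrite sem_if /= vi dw; case: eqP => // /eqP.
  by rewrite semE /= /upd /= subn_eq0 -ltnNge vi dw => /ltnW/leq_trans; apply.
- move=> u /hS[->|ui] evu.
    rewrite evu /= sem_if /= vi dw; case: eqP => [/eqP|_]; last by rewrite semE /= /upd /= vi dw.
    by rewrite subn_eq0.
  case: (e v w) => /=; last exact: h.
  rewrite sem_if /= vi dw; case: eqP => [_|/eqP]; first exact: h.
  by rewrite semE /= /upd /= subn_eq0 -ltnNge vi dw => /ltnW/leq_trans; apply; apply: h.
case ew: (e v w) => //=; rewrite sem_if /= vi dw; case: eqP => // _.
by right; exists w; rewrite // semE /= /upd /= vi dw.
Qed.

Definition low_init := For 8 0 (Put 5 (Var 8) (Arr 2 (Var 8))) ;; Put 5 (Var 2) (Cst 0).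

(** Times are treated in decreasing order, so all children have passed on their values when a vertex
    is scanned; it then passes its own to its parent. Times beyond the number of visited vertices
    are skipped. *)
Definition low_step :=
  Asg 9 (Minus (Var 0) (Var 8)) ;;
  If (Minus (Plus (Var 6) (Cst 1)) (Var 9))
    (Asg 10 (Arr 4 (Var 9)) ;; Asg 11 (Arr 5 (Var 10)) ;; scan_low ;;
     Put 5 (Var 10) (Var 11) ;; Asg 13 (Arr 3 (Var 10)) ;;
     If (Minus (Arr 5 (Var 13)) (Var 11)) (Put 5 (Var 13) (Var 11)) skip)
    skip.

Definition compute_low := low_init ;; For 8 0 low_step.

(** The condition [low_attained] for a single value. It holds all along, since values only move up
    the tree. *)
Definition attained n (e : rel 'I_n) (t : 'I_n) d p v k :=
  (k = 0 /\ 0 < d t /\ anc p v t) \/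
  (exists x u : 'I_n, [/\ anc p v x, 0 < d x, 0 < d u, x = u \/ e x u & d u = k]).

Lemma attained_par n (e : rel 'I_n) t d (p : 'I_n -> 'I_n) v k :
  attained e t d p v k -> attained e t d p (p v) k.
Proof.
have up w : anc p v w -> anc p (p v) w by apply: anc_trans; apply: anc_par.
by move=> [[h1 [h2 /up h3]]|[x [u [/up h1 h2 h3 h4 h5]]]]; [left | right; exists x, u].
Qed.

Lemma low_init_correct n (s t : 'I_n) e d p cnt cur j Z st : searched s t e d p cnt cur j st ->
  forall v : 'I_n, arrs (sem Z low_init st) 5 v = if v == t then 0 else d v.
Proof.
move=> S v; have v0 := ctx_n (searched_ctx S).
rewrite /low_init sem_seq; set c := For _ _ _; set st1 := sem Z c st.
have S1 : searched s t e d p cnt cur j st1 by apply: searched_sem.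
rewrite sem_put /= (ctx_t (searched_ctx S1)) /upd (inj_eq (@ord_inj n)); case: eqP => // _.
pose I i st' := searched s t e d p cnt cur j st' /\ forall u : 'I_n, u < i -> arrs st' 5 u = d u.
suff [_ h] : I n st1 by apply: h.
rewrite -{1}v0; apply: sem_for => //; first by split=> //; apply: searched_setv.
move=> i st'; rewrite v0 => iv vi [S' h]; split.
  by apply: searched_setv => //; apply: searched_sem.
move=> u; rewrite ltnS semE /= vi /upd; case: eqP => [<- _|ui].
  by rewrite (searched_d S').
by rewrite leq_eqVlt => /orP[/eqP//|]; apply: h.
Qed.

Lemma compute_low_correct n (s t : 'I_n) e d p cnt cur j Z st :
  searched s t e d p cnt cur j st -> (forall v u, 0 < d v -> e v u -> 0 < d u) ->
  searched s t e d p cnt cur j (sem Z compute_low st) /\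
  lowpoint e t d p (fun v => arrs (sem Z compute_low st) 5 v).
Proof.
move=> S clo; split; first exact: searched_sem.
have D := searched_dfs S; have cn := dfs_cnt_le D.
have v0 := ctx_n (searched_ctx S).
pose low st' (v : 'I_n) := arrs st' 5 v.
pose I i st' := [/\ searched s t e d p cnt cur j st',
  forall v, 0 < d v -> attained e t d p v (low st' v),
  forall v, n - i < d v -> (forall u, e v u -> low st' v <= d u) /\ low st' (p v) <= low st' v &
  0 < d t -> low st' t = 0].
suff [_ h1 h2 h3] : I n (sem Z compute_low st).
  split=> //.
    by move=> v u dv evu; have [|/(_ u evu)] := h2 v; rewrite ?subnn.
  by move=> v dv; have [|_] := h2 v; rewrite ?subnn.
rewrite /compute_low sem_seq; have L := low_init_correct Z S.
have {S} := @searched_sem _ _ _ _ _ _ _ _ _ Z low_init _ S isT isT isT.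
move: (sem Z low_init st) L => st1 L S.
have {}v0 := ctx_n (searched_ctx S); rewrite -{1}v0; apply: sem_for => //.
  split; first exact: searched_setv.
  - move=> v dv; rewrite /low /= L; case: eqP => [evt|_].
      by rewrite evt in dv *; left; split=> //; split=> //; apply: anc_refl.
    by right; exists v, v; split=> //; [apply: anc_refl | left].
  - by move=> v; rewrite subn0 ltnNge (leq_trans (dfs_le D v)).
  by rewrite /low /= L eqxx.
move=> i st'; rewrite v0 => iv vi [S' J1 J2 J3].
set c := low_step; suff [h1 h2 h3 h4] : I i.+1 (sem Z c st').
  by split=> //; apply: searched_setv.
rewrite /c /low_step sem_seq sem_asg; set st2 := setv 9 _ st'.
have S2 : searched s t e d p cnt cur j st2 by apply: searched_setv.
have v9 : vars st2 9 = n - i by rewrite /= (ctx_n (searched_ctx S')) vi.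
have v6 : vars st2 6 = cnt by rewrite (searched_cnt S2).
have e5 : arrs st2 5 = arrs st' 5 by [].
move: st2 S2 v9 v6 e5 => st2 S2 v9 v6 e5; rewrite sem_if [ev _ _]/= v6 v9 addn1 subn_eq0.
have k0 : 0 < n - i by rewrite subn_gt0.
case: (ltnP cnt (n - i)) => kc.
  rewrite semE; have e5' : low (setv 19 (ev st2 (Cst 0)) st2) =1 low st' by move=> v; rewrite /low /= e5.
  split; [exact: searched_setv | ..].
  - by move=> v dv; rewrite e5'; apply: J1.
  - move=> v dv; have := dfs_le D v; have : n - i <= d v by rewrite subnS in dv; lia.
    by lia.
  by rewrite e5'.
have [v dv] := dfs_surj D k0 kc; have dv0 : 0 < d v by rewrite dv.
rewrite sem_seq sem_asg [ev st2 _]/= v9 -dv (searched_ord S2) // sem_seq sem_asg sem_seq.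
set st3 := setv 11 _ _.
have S3 : searched s t e d p cnt cur j st3 by do 2!(apply: searched_setv => //).
have v10 : vars st3 10 = v by [].
have v11 : vars st3 11 = low st' v by rewrite /low -e5.
have e53 : arrs st3 5 = arrs st' 5 by [].
move: st3 S3 v10 v11 e53 => st3 S3 v10 v11 e53.
have := scan_low_correct Z S3 v10; set st4 := sem Z scan_low st3; rewrite v11.
have S4 : searched s t e d p cnt cur j st4 by apply: searched_sem.
have v10' : vars st4 10 = v by rewrite sem_vars.
have e54 : arrs st4 5 = arrs st' 5 by rewrite sem_arrs.
move: st4 S4 v10' e54 => st4 S4 v10' e54; set x := vars st4 11 => -[xle xnbr xatt].
rewrite sem_seq sem_put [ev st4 (Var 10)]/= [ev st4 (Var 11)]/= v10' sem_seq sem_asg.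
set st5 := setv 13 _ _.
have S5 : searched s t e d p cnt cur j st5.
  by apply: searched_setv => //; apply: searched_seta.
have v13 : vars st5 13 = p v by rewrite /= /upd /= v10' (searched_p S4).
have x5 : vars st5 11 = x by [].
have e55 u : low st5 u = if u == v then x else low st' u.
  by rewrite /low /= /upd (inj_eq (@ord_inj n)) e54.
move: st5 S5 v13 x5 e55 => st5 S5 v13 x5 e55.
rewrite sem_if sem_put sem_asg [ev _ (Minus _ _)]/= v13 x5 -/(low st5 (p v)) subn_eq0.
set st6 := if _ then _ else _.
have S6 : searched s t e d p cnt cur j st6.
  by rewrite /st6; case: ifP => _; [apply: searched_setv | apply: searched_seta].
have e56 u : low st6 u = if (u == p v) && (x < low st5 u) then x else low st5 u.
  rewrite /st6; case: (leqP (low st5 (p v)) x) => lx /=.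
    by case: eqP => // ->; rewrite ltnNge lx.
  rewrite /low /= v13 x5 /upd (inj_eq (@ord_inj n)); case: eqP => [->|//] /=.
  by rewrite -/(low st5 _) lx.
have vx : low st6 v = x by rewrite e56 e55 eqxx ltnn andbF.
have le6 u : low st6 u <= low st' u.
  have le5 : low st5 u <= low st' u by rewrite e55; case: eqP => [->|].
  by rewrite e56; case: ifP => // /andP[_ /ltnW/leq_trans]; apply.
have px : low st6 (p v) <= x by rewrite e56 eqxx /=; case: ltnP.
have attx : attained e t d p v x.
  case: xatt => [->|[u evu ->]]; first exact: J1.
  right; exists v, u; split=> //; [exact: anc_refl | | by right].
  exact: clo evu.
split=> //.
- move=> w dw; rewrite e56; case: ifP => [/andP[/eqP-> _]|_]; first exact: attained_par.
  by rewrite e55; case: eqP => [->|_] //; apply: J1.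
- move=> w; rewrite subnS => dw; have [->|wv] := eqVneq w v.
    by rewrite vx; split.
  have wk : n - i < d w.
    rewrite ltn_neqAle; apply/andP; split; last by lia.
    by rewrite -dv; apply: contraNneq wv => dvw; rewrite (dfs_inj D dv0 dvw).
  (* Finished vertices have times beyond that of [v], and the parent of [v] is discovered no later
     than [v]; so finished values stay, and other values only decrease. *)
  have wp : w != p v.
    apply: contraTneq wk => ->; rewrite -leqNgt -dv; have [->|vs] := eqVneq v s.
      by rewrite (dfs_par_root D).
    by have [_ /ltnW] := dfs_par D dv0 vs.
  have [h1 h2] := J2 w wk; rewrite (_ : low st6 w = low st' w); last first.
    by rewrite e56 (negPf wp) e55 (negPf wv).
  by split=> //; apply: leq_trans h2.
by move=> dt; apply/eqP; rewrite -leqn0 -(J3 dt).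
Qed.

(** * Kept vertices on the machine *)

Definition keep_step :=
  Asg 9 (Plus (Var 8) (Cst 1)) ;;
  If (Minus (Plus (Var 6) (Cst 1)) (Var 9))
    (Asg 10 (Arr 4 (Var 9)) ;; Asg 13 (Arr 3 (Var 10)) ;;
     If (Arr 6 (Var 13))
       (If (Minus (Arr 2 (Var 13)) (Arr 5 (Var 10))) (Put 6 (Var 10) (Cst 1)) skip) skip)
    skip.

Definition compute_keep := Put 6 (Var 1) (Cst 1) ;; For 8 0 keep_step.

Definition kept n (st : store) : {set 'I_n} := [set v : 'I_n | arrs st 6 v != 0].

(** By increasing discovery time the parent is settled before its children, so a single pass yields
    a fixed point of the recursive rule. *)
Lemma compute_keep_correct n (s t : 'I_n) e d p cnt cur j Z st :
  searched s t e d p cnt cur j st -> (forall v, arrs st 6 v = 0) ->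
  let K := kept n (sem Z compute_keep st) in
  forall v, v \in K <-> 0 < d v /\ (v = s \/ p v \in K /\ arrs st 5 v < d (p v)).
Proof.
move=> S a6; have D := searched_dfs S; have cn := dfs_cnt_le D.
pose ok (K : {set 'I_n}) (v : 'I_n) := v = s \/ p v \in K /\ arrs st 5 v < d (p v).
pose I i st' := [/\ searched s t e d p cnt cur j st', arrs st' 5 = arrs st 5, s \in kept n st',
  forall v, v \in kept n st' -> 0 < d v /\ ok (kept n st') v &
  forall v, 0 < d v -> d v <= i -> ok (kept n st') v -> v \in kept n st'].
suff [_ _ _ h1 h2] : I n (sem Z compute_keep st).
  by move=> K v; split=> [/h1//|[dv o]]; apply: h2 dv (leq_trans (dfs_le D v) cn) o.
rewrite /compute_keep sem_seq sem_put /= (ctx_s (searched_ctx S)).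
set st1 := seta _ _ _ st; have S1 : searched s t e d p cnt cur j st1 by apply: searched_seta.
have K1 v : (v \in kept n st1) = (v == s).
  by rewrite inE /= /upd a6 (inj_eq (@ord_inj n)); case: (v == s).
have e5 : arrs st1 5 = arrs st 5 by [].
move: st1 S1 K1 e5 => st1 S1 K1 e5.
have v0 := ctx_n (searched_ctx S1); rewrite -{1}v0; apply: sem_for => //.
  have eK : kept n (setv 8 0 st1) = kept n st1 by [].
  split; [exact: searched_setv | by [] | by rewrite eK K1 | ..]; rewrite eK.
    by move=> v; rewrite K1 => /eqP->; rewrite (dfs_root D); split=> //; left.
  by move=> v dv; rewrite leqNgt dv.
move=> i st'; rewrite v0 => iv vi [S' e5' sK h1 h2].
suff [g1 g2 g3 g4 g5] : I i.+1 (sem Z keep_step st') by split=> //; apply: searched_setv.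
have same st2 : searched s t e d p cnt cur j st2 -> arrs st2 5 = arrs st 5 ->
    kept n st2 = kept n st' ->
    (forall v, d v = i.+1 -> ok (kept n st') v -> v = s) -> I i.+1 st2.
  move=> S2 e52 eK hv; split; rewrite ?eK //= => v dv; rewrite leq_eqVlt => /orP[/eqP dvi o|].
    by rewrite (hv v dvi o).
  exact: h2.
rewrite /keep_step sem_seq sem_asg; set st2 := setv 9 _ st'.
have S2 : searched s t e d p cnt cur j st2 by apply: searched_setv.
have v9 : vars st2 9 = i.+1 by rewrite /= /upd /= vi addn1.
have e52 : arrs st2 5 = arrs st 5 by [].
have eK2 : kept n st2 = kept n st' by [].
move: st2 S2 v9 e52 eK2 => st2 S2 v9 e52 eK2.
rewrite sem_if [ev _ _]/= (searched_cnt S2) v9 addn1 subn_eq0.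
case: (ltnP cnt i.+1) => ic.
  apply: same; rewrite ?semE //; first exact: searched_setv.
  by move=> v dv _; have := dfs_le D v; rewrite dv leqNgt ic.
have [v dv] := dfs_surj D (ltn0Sn i) ic; have dv0 : 0 < d v by rewrite dv.
have only u : d u = i.+1 -> u = v by move=> du; apply: (dfs_inj D); rewrite du.
have o9 : arrs st2 4 i.+1 = v by rewrite -dv (searched_ord S2).
rewrite sem_seq sem_asg sem_seq sem_asg [ev st2 _]/= v9 o9.
set st3 := setv 13 _ _.
have S3 : searched s t e d p cnt cur j st3 by apply: searched_setv => //; apply: searched_setv.
have v10 : vars st3 10 = v by [].
have v13 : vars st3 13 = p v by rewrite /= /upd /= (searched_p S2).
have e53 : arrs st3 5 = arrs st 5 by [].
have eK3 : kept n st3 = kept n st' by [].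
move: st3 S3 v10 v13 e53 eK3 => st3 S3 v10 v13 e53 eK3.
rewrite sem_if [ev _ _]/= v13; case: eqP => [pK|/eqP pK].
  apply: same; rewrite ?semE //; first exact: searched_setv.
  move=> u /only-> [//|[]]; by rewrite -eK3 inE pK.
have {}pK : p v \in kept n st' by rewrite -eK3 inE.
rewrite sem_if [ev _ _]/= v13 v10 e53 (searched_d S3) subn_eq0.
case: (leqP (d (p v)) (arrs st 5 v)) => lv.
  apply: same; rewrite ?semE //; first exact: searched_setv.
  by move=> u /only-> [//|[_]]; rewrite ltnNge lv.
rewrite sem_put /= v10; set st4 := seta _ _ _ st3.
have S4 : searched s t e d p cnt cur j st4 by apply: searched_seta.
have K4 u : (u \in kept n st4) = (u == v) || (u \in kept n st').
  rewrite inE /= /upd (inj_eq (@ord_inj n)); case: (u == v) => //=.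
  by rewrite -eK3 inE.
have mono u : ok (kept n st') u -> ok (kept n st4) u.
  by move=> [->|[h h']]; [left | right; rewrite K4 h orbT].
split=> //.
- by rewrite K4 sK orbT.
- move=> u; rewrite K4 => /orP[/eqP->|/h1[du o]]; split=> //; apply: mono => //.
  by right.
move=> u du; rewrite leq_eqVlt K4 => /orP[/eqP/only->|ui o]; first by rewrite eqxx.
have [->|us] := eqVneq u s; first by rewrite sK orbT.
rewrite (h2 u du ui) ?orbT //; case: o => [//|[]]; first by left.
(* The newly kept [v] can affect only its children, which are discovered after it. *)
rewrite K4 => /orP[/eqP pu|h] h'; [|by right].
have [_ + _] := dfs_par D du us; rewrite pu dv => /leq_trans/(_ ui)/ltnW.
by rewrite ltnn.
Qed.

Definition restrict_step :=
  If (Arr 6 (Var 8)) (If (Arr 6 (Var 9)) skip (SetAdj (Var 8) (Var 9) 0)) (SetAdj (Var 8) (Var 9) 0).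

Definition restrict_edges := For 8 0 (For 9 0 restrict_step).

Lemma restrict_edges_correct n (s t : 'I_n) e Z st : ctx s t e st ->
  ctx s t (restrict e (kept n st)) (sem Z restrict_edges st).
Proof.
move=> C; set K := kept n st.
(* The pairs lexicographically before (i, j) have been treated. *)
pose rel_at i j (u v : 'I_n) :=
  if (u < i) || (u == i :> nat) && (v < j) then restrict e K u v else e u v.
pose I i st' := ctx s t (rel_at i 0) st' /\ kept n st' = K.
have [Cn _] : I n (sem Z restrict_edges st); last first.
  by apply: ctx_eq Cn => u v; rewrite /rel_at ltn_ord.
rewrite -{1}(ctx_n C); apply: sem_for => //.
  by split=> //; apply: ctx_setv => //; apply: ctx_eq C => u v; rewrite /rel_at andbF.
move=> i st'; rewrite (ctx_n C) => iv vi [C' K']; pose u := Ordinal iv.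
suff [h1 h2] : I i.+1 (sem Z (For 9 0 restrict_step) st') by split=> //; apply: ctx_setv.
pose J j st2 := [/\ ctx s t (rel_at i j) st2, kept n st2 = K & vars st2 8 = i].
have [Cj Kj _] : J n (sem Z (For 9 0 restrict_step) st'); last first.
  split=> //; apply: ctx_eq Cj => x y; rewrite /rel_at ltn_ord andbT ltn0 andbF orbF.
  by rewrite ltnS [x <= i]leq_eqVlt orbC.
rewrite -{1}(ctx_n C'); apply: sem_for => //; first by split=> //; apply: ctx_setv.
move=> j st2; rewrite (ctx_n C') => jv vj [C2 K2 v8]; pose v := Ordinal jv.
suff [h1 h2 h3] : J j.+1 (sem Z restrict_step st2) by split=> //; apply: ctx_setv.
have at_eq x y : rel_at i j.+1 x y = if (x == u) && (y == v) then restrict e K u v else rel_at i j x y.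
  rewrite /rel_at ltnS [y <= j]leq_eqVlt andb_orr.
  have -> : (x == i :> nat) = (x == u) by [].
  have -> : (y == j :> nat) = (y == v) by [].
  case: eqP => [->|_]; rewrite ?orbF //=; case: eqP => [->|_] //=.
  by rewrite orbT.
have in8 : (arrs st2 6 i != 0) = (u \in K) by rewrite -K2 inE.
have in9 : (arrs st2 6 j != 0) = (v \in K) by rewrite -K2 inE.
have set0 : ~~ restrict e K u v -> J j.+1 (sem Z (SetAdj (Var 8) (Var 9) 0) st2).
  move=> nr; split; [|by []|by []].
  have C3 := @ctx_setadj _ _ _ _ Z _ u v (Var 8) (Var 9) false C2 v8 vj.
  by apply: ctx_eq C3 => x y; rewrite at_eq; case: ifP => //; rewrite (negPf nr).
rewrite /restrict_step sem_if /= v8; case: eqP => [a0|/eqP]; last rewrite in8 => uK.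
  by apply: set0; rewrite /restrict -in8 a0 /= andbF.
rewrite sem_if /= vj; case: eqP => [a0|/eqP]; last rewrite in9 => vK.
  by apply: set0; rewrite /restrict -in9 a0 /= !andbF.
rewrite semE; split=> //; apply: ctx_setv => //; apply: ctx_eq C2 => x y.
rewrite at_eq; case: ifP => // /andP[/eqP-> /eqP->].
by rewrite /rel_at /= !ltnn andbF /restrict uK vK !andbT.
Qed.

(** * Elimination on the machine *)

Definition Neq (e1 e2 : exp) := Plus (Minus e1 e2) (Minus e2 e1).

Lemma ev_neq st e1 e2 : (ev st (Neq e1 e2) == 0) = (ev st e1 == ev st e2).
Proof. by rewrite /= addn_eq0 !subn_eq0 eqn_leq. Qed.

Definition scan_nbh :=
  Asg 9 (Cst 0) ;;
  For 12 0 (If (Adj (Var 8) (Var 12))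
    (Asg 9 (Plus (Var 9) (Cst 1)) ;; Asg 10 (Var 11) ;; Asg 11 (Var 12)) skip).

(** Variables 10 and 11 hold the last two neighbours found, shifted from 11 to 10. The invariant
    also describes the case of one neighbour, from which the case of two arises. *)
Lemma scan_nbh_correct n (s t : 'I_n) g Z st (w : 'I_n) : ctx s t g st -> vars st 8 = w ->
  let st' := sem Z scan_nbh st in
  vars st' 9 = #|nbh g w| /\
  (#|nbh g w| = 2 -> exists a b : 'I_n, [/\ vars st' 10 = a, vars st' 11 = b, a != b &
    nbh g w = [set a; b]]).
Proof.
move=> C v8 st'; rewrite {}/st' /scan_nbh sem_seq sem_asg.
pose N i := [set u in nbh g w | u < i].
pose I i st' := [/\ ctx s t g st' /\ vars st' 8 = w, vars st' 9 = #|N i|,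
  #|N i| = 1 -> exists b : 'I_n, vars st' 11 = b /\ N i = [set b] &
  #|N i| = 2 -> exists a b : 'I_n, [/\ vars st' 10 = a, vars st' 11 = b, a != b & N i = [set a; b]]].
set st1 := setv 9 _ st; have C1 : ctx s t g st1 by apply: ctx_setv.
have v81 : vars st1 8 = w by [].
have v91 : vars st1 9 = 0 by [].
move: st1 C1 v81 v91 => st1 C1 v81 v91.
set c := For _ _ _; suff [_ h1 _ h2] : I n (sem Z c st1).
  have eN : N n = nbh g w by apply/setP => u; rewrite inE ltn_ord andbT.
  by rewrite eN in h1 h2.
rewrite -{1}(ctx_n C1); apply: sem_for => //.
  have N0 : N 0 = set0 by apply/setP => u; rewrite !inE ltn0 andbF.
  by split; rewrite ?N0 ?cards0 //; split=> //; apply: ctx_setv.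
move=> i st'; rewrite (ctx_n C1) => iv vi [[C' v8'] h9 h1 h2]; pose v := Ordinal iv.
set c' := If _ _ _; suff [[g1 g2] g3 g4 g5] : I i.+1 (sem Z c' st').
  by split=> //; split=> //; apply: ctx_setv.
have adj : ev st' (Adj (Var 8) (Var 12)) = g w v by apply: (ev_adj C').
have eN : N i.+1 = if g w v then v |: N i else N i.
  apply/setP => u; rewrite [LHS]inE ltnS leq_eqVlt (_ : (u == i :> nat) = (u == v)) // inE.
  by case gv: (g w v); rewrite !inE; case: eqP => [->|_] //=; rewrite gv.
have vN : v \notin N i by rewrite !inE ltnn andbF.
rewrite /c' sem_if adj /=; move: eN; case: (g w v) => /= eN; last first.
  by rewrite semE; split; rewrite ?eN //; split=> //; apply: ctx_setv.
have cN : #|N i.+1| = #|N i|.+1 by rewrite eN cardsU1 vN.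
rewrite !semE /=; split; rewrite ?cN.
- by split=> //; do 3!(apply: ctx_setv => //).
- by rewrite /upd /= h9 addn1.
- move=> [/eqP]; rewrite cards_eq0 => /eqP N0; exists v; rewrite eN N0 setU0.
  by rewrite /upd /= vi.
- move=> [/h1[b [v11 Nb]]]; exists b, v; rewrite eN Nb /upd /= v11 vi; split=> //.
    by apply: contraNneq vN => <-; rewrite Nb inE.
  by rewrite setUC.
Qed.

Definition remove_vertex :=
  Put 6 (Var 8) (Cst 0) ;;
  SetAdj (Var 10) (Var 8) 0 ;; SetAdj (Var 8) (Var 10) 0 ;;
  SetAdj (Var 11) (Var 8) 0 ;; SetAdj (Var 8) (Var 11) 0 ;;
  SetAdj (Var 10) (Var 11) 1 ;; SetAdj (Var 11) (Var 10) 1.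

Lemma remove_vertex_correct n (s t : 'I_n) g Z st (w a b : 'I_n) : ctx s t g st ->
  symmetric g -> irreflexive g -> vars st 8 = w -> vars st 10 = a -> vars st 11 = b ->
  nbh g w = [set a; b] ->
  ctx s t (contract g w a b) (sem Z remove_vertex st) /\
  kept n (sem Z remove_vertex st) = kept n st :\ w.
Proof.
move=> C sg ig v8 v10 v11 Nw.
have Nwv x : g w x = (x == a) || (x == b) by have /setP/(_ x) := Nw; rewrite !inE.
have aw : a != w by have := ig w; rewrite Nwv => /norP[]; rewrite eq_sym.
have bw : b != w by have := ig w; rewrite Nwv => /norP[_]; rewrite eq_sym.
split; last first.
  apply/setP => v; rewrite !inE sem_seq sem_arrs // sem_put /= v8 /upd (inj_eq (@ord_inj n)).
  by case: (v == w).
rewrite /remove_vertex !sem_seq.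
have C0 : ctx s t g (sem Z (Put 6 (Var 8) (Cst 0)) st) by apply: ctx_seta.
have {}v8 : vars (sem Z (Put 6 (Var 8) (Cst 0)) st) 8 = w by [].
have {}v10 : vars (sem Z (Put 6 (Var 8) (Cst 0)) st) 10 = a by [].
have {}v11 : vars (sem Z (Put 6 (Var 8) (Cst 0)) st) 11 = b by [].
move: (sem Z _ st) C0 v8 v10 v11 => {C}st C v8 v10 v11.
have next h st' x y (u v : 'I_n) (k : bool) : ctx s t h st' /\
    (vars st' 8 = w /\ vars st' 10 = a /\ vars st' 11 = b) -> vars st' x = u -> vars st' y = v ->
    ctx s t (fun x y => if (x == u) && (y == v) then k else h x y) (sem Z (SetAdj (Var x) (Var y) k) st') /\
    (vars (sem Z (SetAdj (Var x) (Var y) k) st') 8 = w /\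
     vars (sem Z (SetAdj (Var x) (Var y) k) st') 10 = a /\
     vars (sem Z (SetAdj (Var x) (Var y) k) st') 11 = b).
  by move=> [Ch vs] hu hv; split=> //; apply: ctx_setadj.
have C1 := next g st 10 8 a w false (conj C (conj v8 (conj v10 v11))) v10 v8.
have C2 := next _ _ 8 10 w a false C1 v8 v10.
have C3 := next _ _ 11 8 b w false C2 v11 v8.
have C4 := next _ _ 8 11 w b false C3 v8 v11.
have C5 := next _ _ 10 11 a b true C4 v10 v11.
have [C6 _] := next _ _ 11 10 b a true C5 v11 v10.
apply: ctx_eq C6 => x y; rewrite /contract /swaps.
case: (eqVneq x w) => [->|xw] /=.
  by rewrite ![w == _]eq_sym (negPf aw) (negPf bw) /= Nwv; case: (y == a); case: (y == b).
case: (eqVneq y w) => [->|yw] /=.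
  rewrite ![w == _]eq_sym (negPf aw) (negPf bw) !andbF !andbT /=.
  have -> : g x w = (x == a) || (x == b) by rewrite sg Nwv.
  by case: (x == a); case: (x == b).
by rewrite !andbF /=; case: (x == a); case: (x == b); case: (y == a); case: (y == b);
  rewrite /= ?orbT ?orbF.
Qed.

(** Two truncated differences together test that the degree is exactly 2. *)
Definition eliminate_body :=
  scan_nbh ;;
  If (Minus (Var 9) (Cst 2)) skip
    (If (Minus (Cst 2) (Var 9)) skip (If (Adj (Var 10) (Var 11)) skip remove_vertex)).

Definition eliminate_step :=
  If (Arr 6 (Var 8))
    (If (Neq (Var 8) (Var 1)) (If (Neq (Var 8) (Var 2)) eliminate_body skip) skip) skip.

Definition eliminate := For 8 0 eliminate_step.

Lemma eliminate_step_correct n (e : rel 'I_n) s t dd f g Z st (w : 'I_n) :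
  ctx s t g st -> vars st 8 = w -> reduced e s t dd f g (kept n st) w ->
  exists g', ctx s t g' (sem Z eliminate_step st) /\
    reduced e s t dd f g' (kept n (sem Z eliminate_step st)) w.+1.
Proof.
move=> C v8 R.
have skipped st' : ctx s t g st' -> kept n st' = kept n st ->
    (w \in kept n st -> w != s -> w != t ->
     2 < #|nbh g w| \/ (exists a b, nbh g w = [set a; b] /\ g a b)) ->
    exists g', ctx s t g' st' /\ reduced e s t dd f g' (kept n st') w.+1.
  move=> C' K' h; exists g; split=> //; rewrite K'; apply: reduced_skip => // v vw.
  by rewrite (_ : v = w) //; apply: val_inj.
rewrite /eliminate_step sem_if /= v8; case: eqP => [w0|/eqP w0].
  apply: skipped; rewrite ?semE //; first exact: ctx_setv.
  by rewrite inE w0.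
have wK : w \in kept n st by rewrite inE.
rewrite sem_if ev_neq /= v8 (ctx_s C) (inj_eq (@ord_inj n)); case: eqP => [ws|/eqP ws].
  apply: skipped; rewrite ?semE //; first exact: ctx_setv.
  by rewrite ws eqxx.
rewrite sem_if ev_neq /= v8 (ctx_t C) (inj_eq (@ord_inj n)); case: eqP => [wt|/eqP wt].
  apply: skipped; rewrite ?semE //; first exact: ctx_setv.
  by rewrite wt eqxx.
rewrite /eliminate_body sem_seq.
have [v9 two] := scan_nbh_correct Z C v8.
have C1 : ctx s t g (sem Z scan_nbh st) by apply: ctx_sem.
have K1 : kept n (sem Z scan_nbh st) = kept n st.
  by apply/setP => v; rewrite !inE sem_arrs.
have v81 : vars (sem Z scan_nbh st) 8 = w by rewrite sem_vars.
move: (sem Z scan_nbh st) v9 two C1 K1 v81 => st1 v9 two C1 K1 v81.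
have d2 := red_deg2 R wK ws wt.
rewrite sem_if /= v9 subn_eq0; case: leqP => d; last first.
  by apply: skipped; rewrite ?semE //; [apply: ctx_setv | left].
rewrite sem_if /= v9 subn_eq0 d2.
have [|a [b [v10 v11 ab Nw]]] := two; first by apply/eqP; rewrite eqn_leq d.
rewrite sem_if (@ev_adj _ _ _ _ _ _ _ (Var 10) (Var 11) C1 v10 v11); case gab: (g a b) => /=.
  apply: skipped; rewrite ?semE //; first exact: ctx_setv.
  by move=> _ _ _; right; exists a, b.
have [C2 K2] := remove_vertex_correct Z C1 (red_sym R) (red_irr R) v81 v10 v11 Nw.
exists (contract g w a b); split=> //; rewrite K2 K1.
by apply: reduced_contract => //; rewrite gab.
Qed.

Lemma eliminate_correct n (e : rel 'I_n) s t dd f g Z st :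
  ctx s t g st -> reduced e s t dd f g (kept n st) 0 ->
  exists g', ctx s t g' (sem Z eliminate st) /\
    reduced e s t dd f g' (kept n (sem Z eliminate st)) n.
Proof.
move=> C R.
pose I i st' := exists g', ctx s t g' st' /\ reduced e s t dd f g' (kept n st') i.
suff : I n (sem Z eliminate st) by [].
rewrite -{1}(ctx_n C); apply: sem_for => //; first by exists g; split=> //; apply: ctx_setv.
move=> i st'; rewrite (ctx_n C) => iv vi [g1 [C1 R1]].
have [g2 [C2 R2]] := @eliminate_step_correct _ _ _ _ _ _ _ Z _ (Ordinal iv) C1 vi R1.
by exists g2; split=> //; apply: ctx_setv.
Qed.

(** * Output *)

Definition output_step :=
  Asg 9 (Var 0) ;;
  If (Arr 6 (Var 8))
    (If (Neq (Var 8) (Var 1)) (If (Neq (Var 8) (Var 2)) (Asg 9 (Var 8)) skip) skip) skip ;;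
  Out (Var 8) (Var 9).

Definition output := For 8 0 output_step.

Lemma output_correct n (s t : 'I_n) g Z st : ctx s t g st ->
  forall v : 'I_n, raw (sem Z output st) v =
    if v \in kept n st :\: [set s; t] then val v else n.
Proof.
move=> C; pose I i st' := [/\ ctx s t g st', kept n st' = kept n st &
  forall v : 'I_n, v < i -> raw st' v = if v \in kept n st :\: [set s; t] then val v else n].
suff [_ _ h] : I n (sem Z output st) by move=> v; apply: h.
rewrite -{1}(ctx_n C); apply: sem_for => //; first by split=> //; apply: ctx_setv.
move=> i st'; rewrite (ctx_n C) => iv vi [C' K' h]; pose w := Ordinal iv.
suff [h1 h2 h3] : I i.+1 (sem Z output_step st') by split=> //; apply: ctx_setv.
split; first exact: ctx_sem.
  by rewrite -K'; apply/setP => v; rewrite !inE sem_arrs.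
move=> v; rewrite ltnS leq_eqVlt /output_step !sem_seq sem_out => iv'.
set st2 := sem Z _ _; have r2 : raw st2 = raw st' by rewrite sem_raw // sem_raw.
have v8 : vars st2 8 = i by rewrite !sem_vars.
rewrite /= r2 v8 /upd; case: eqP iv' => [ei _|_ /= /h//].
have -> : v = w by apply: val_inj.
rewrite /st2 sem_asg sem_if /= /upd /= vi -K' !inE.
rewrite (_ : nat_of_ord w = i) //; case: (arrs st' 6 i == 0) => /=.
  by rewrite andbF /upd /= (ctx_n C').
rewrite andbT sem_if ev_neq /= /upd /= vi (ctx_s C').
have -> : (i == s :> nat) = (w == s) by [].
case: (w == s) => /=; first by rewrite /upd /= (ctx_n C').
rewrite sem_if ev_neq /= /upd /= vi (ctx_t C').
have -> : (i == t :> nat) = (w == t) by [].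
by case: (w == t); rewrite /= /upd /= ?(ctx_n C').
Qed.

(** * The whole program *)

Lemma tracking_setT n (g : rel 'I_n) s t : tracking_set g s t [set: 'I_n].
Proof.
have id P : [seq v <- P | v \in [set: 'I_n]] = P.
  by rewrite (eq_filter (a2 := predT)) ?filter_predT // => v; rewrite in_setT.
by move=> P1 P2 _ _ P12; rewrite !id.
Qed.

(** All inner vertices of a path lie in [V], so the trace is the path without its two known ends;
    for s = t the only path is a single vertex. *)
Lemma tracking_interior n (g : rel 'I_n) s t (V : {set 'I_n}) : symmetric g ->
  (forall u v, g u v -> u \in V) -> tracking_set g s t (V :\: [set s; t]).
Proof.
move=> sg sup.
have inV x q : path g x q -> {subset q <= V}.
  elim: q x => // y q IH x /= /andP[gxy pq] z; rewrite inE => /orP[/eqP->|]; last exact: IH pq z.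
  by apply: (sup _ x); rewrite sg.
have rebuild P : st_path g s t P ->
    P = if s == t then [:: s] else s :: rcons [seq v <- P | v \in V :\: [set s; t]] t.
  case: P => // x q /and4P[/eqP-> pq /eqP lq]; rewrite cons_uniq => /andP[sq uq].
  case: (lastP q) pq lq sq uq => [|q' y] pq lq sq uq; first by rewrite /= in lq; rewrite lq eqxx.
  rewrite last_rcons in lq; subst y.
  move: sq; rewrite mem_rcons inE negb_or => /andP[st sq]; rewrite (negPf st) /=.
  rewrite !inE eqxx /= filter_rcons !inE eqxx orbT /=; congr (s :: rcons _ t).
  move: uq; rewrite rcons_uniq => /andP[tq _]; apply/esym/all_filterP/allP => v vq.
  rewrite !inE (inV _ _ pq) ?mem_rcons ?inE ?vq ?orbT // andbT negb_or.
  by apply/andP; split; [apply: contraNneq sq => <- | apply: contraNneq tq => <-].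
move=> P1 P2 /rebuild e1 /rebuild e2 P12 eF; apply: P12.
by rewrite e1 e2 eF.
Qed.

Definition tracking_program :=
  build_rows ;; read_edges ;; search ;; compute_low ;; compute_keep ;; restrict_edges ;;
  eliminate ;; output.

(** [V] is what the program computes, so it is fixed before [f]; a tracking set enters only through
    the forest field of [reduced]. *)
Lemma tracking_program_correct n (e : rel 'I_n) (s t : 'I_n) es Z D st :
  symmetric e -> irreflexive e -> edge_list e es -> start s t es Z D st ->
  exists V : {set 'I_n},
    (forall v : 'I_n, raw (sem Z tracking_program st) v =
       if v \in V :\: [set s; t] then val v else n) /\
    forall f, (exists2 T, tracking_set e s t T & #|T| <= f) ->
      exists g, reduced e s t (max_degree e) f g V n.
Proof.
move=> se ie el S; rewrite /tracking_program sem_seq.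
set st1 := sem Z build_rows st.
have C1 : ctx s t (fun _ _ => false) st1.
  split; rewrite ?sem_vars ?(start_n S) ?(start_s S) ?(start_t S) ?(start_2n S) //.
    by apply: build_rows_correct; apply: start_n S.
  by move=> u v; rewrite sem_arrs // (start_arrs S).
have r1 : raw st1 = raw st by rewrite sem_raw.
have d1 : vars st1 3 = D by rewrite sem_vars // (start_D S).
have E1 : vars st1 5 = 2 * size es by rewrite sem_vars // (start_E S).
have a1 k : k \notin puts build_rows -> forall i, arrs st1 k i = 0.
  by move=> hk i; rewrite sem_arrs // (start_arrs S).
have a12 : forall i, arrs st1 2 i = 0 by apply: a1.
have a16 : forall i, arrs st1 6 i = 0 by apply: a1.
move: st1 C1 r1 d1 E1 a12 a16 {a1} => st1 C1 r1 d1 E1 a12 a16; rewrite sem_seq.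
have C2 := read_edges_correct el S C1 r1 d1 E1.
have a22 i : arrs (sem Z read_edges st1) 2 i = 0 by rewrite sem_arrs.
have a26 i : arrs (sem Z read_edges st1) 6 i = 0 by rewrite sem_arrs.
move: (sem Z read_edges st1) C2 a22 a26 => st2 C2 a22 a26; rewrite sem_seq.
have [d [p [cnt [cur S3]]]] := search_correct Z se ie C2 a22.
have a36 i : arrs (sem Z search st2) 6 i = 0 by rewrite sem_arrs.
move: (sem Z search st2) S3 a36 => st3 S3 a36; rewrite sem_seq.
have clo := dfs_done (searched_dfs S3).
have [S4 L] := compute_low_correct Z S3 clo.
have a46 i : arrs (sem Z compute_low st3) 6 i = 0 by rewrite sem_arrs.
move: (sem Z compute_low st3) S4 L a46 => st4 S4 L a46; rewrite sem_seq.
have Kdef := compute_keep_correct Z S4 a46.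
have C5 : ctx s t e (sem Z compute_keep st4) by apply: ctx_sem => //; apply: searched_ctx S4.
move: (sem Z compute_keep st4) Kdef C5 => st5 Kdef C5; rewrite sem_seq.
have C6 := restrict_edges_correct Z C5.
have K6 : kept n (sem Z restrict_edges st5) = kept n st5.
  by apply/setP => v; rewrite !inE sem_arrs.
move: (sem Z restrict_edges st5) C6 K6 => st6 C6 K6; rewrite sem_seq.
have red f : (exists2 T, tracking_set e s t T & #|T| <= f) ->
    reduced e s t (max_degree e) f (restrict e (kept n st5)) (kept n st6) 0.
  move=> hT; rewrite K6; apply: reduced_init => //.
  - by apply/Kdef; rewrite (dfs_root (searched_dfs S4)); split=> //; left.
  - apply: (on_st_path_kept se (searched_dfs S4) clo L) => v dv o; apply/Kdef; split=> //.
  - by apply: (kept_on_st_path se (searched_dfs S4) L) => v /Kdef.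
exists (kept n (sem Z eliminate st6)); split.
  (* The invariant needs some tracking set to start from, and the set of all vertices is always
     one. *)
  have [|g [C7 _]] := eliminate_correct Z C6 (red n _).
    by exists [set: 'I_n]; [apply: tracking_setT | rewrite cardsT card_ord].
  exact: output_correct C7.
by move=> f hT; have [g [_ R]] := eliminate_correct Z C6 (red f hT); exists g.
Qed.

Theorem mainTheorem8 :
  exists (prog : seq instr) (c : nat),
    forall (n : nat) (e : rel 'I_n), symmetric e -> irreflexive e ->
    forall (s t : 'I_n) (es : seq ('I_n * 'I_n)), edge_list e es ->
    exists mf : memory,
      run prog (c * n ^ 2 + c) (0, init_mem s t es) = Some mf /\
      tracking_set e s t (output_set n mf) /\
      (forall OPT : nat, is_opt_tracking_size e s t OPT ->
         #|output_set n mf| <= 2 * (max_degree e).+1 * OPT).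
Proof.
have [c hc] := @machine_correct tracking_program isT isT.
exists (prologue ++ compile (size prologue) tracking_program ++ epilogue), c.
move=> n e se ie s t es el; have [mf [st [Z [D [hrun S out]]]]] := hc n e s t es el.
have [V [rawV red]] := tracking_program_correct se ie el S.
exists mf; split; first exact: hrun.
rewrite (out _ rawV); split.
  (* Being a tracking set does not involve the size, so the trivial bound n suffices here; the
     optimum enters only below. *)
  have [|g R] := red n.
    by exists [set: 'I_n]; [apply: tracking_setT | rewrite cardsT card_ord].
  apply: (red_track R); first exact: subsetDl.
  exact: tracking_interior (red_sym R) (red_supp R).
move=> OPT [[T [trT cT]] _]; have [|g R] := red OPT; first by exists T; rewrite ?cT.
exact: reduced_card R.
Qed.
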